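(* The following three statements hold. (i) Let $X=\{X_U;\,U\in\mathcal{A}\}$ be a set-indexed Lévy process and let $U_0\in\mathcal{A}$ be such that $m(U_0)>0$. Then for all $U\in\mathcal{A}$ the distribution of $X_U$ is $\mu^{m(U)}$, where $\mu=(P_{X_{U_0}})^{1/m(U_0)}$. Moreover, the law of the process $X$ is completely determined by the law of $X_{U_0}$. (ii) A set-indexed process $\{X_U;\,U\in\mathcal{A}\}$ is a set-indexed Lévy process if and only if its increment process $\{\Delta X_C;\,C\in\mathcal{C}\}$ is an infinitely divisible independently scattered random measure which satisfies the $m$-stationarity property, i.e. such that for all $C_1,C_2\in\mathcal{C}$ the distributions of $\Delta X_{C_1}$ and $\Delta X_{C_2}$ are equal if $m(C_1)=m(C_2)$. (iii) For any infinitely divisible probability measure $\mu$ on $(\mathbf{R},\mathcal{B}(\mathbf{R}))$, there exists a set-indexed Lévy process $X$ such that $P_{X_U}=\mu^{m(U)}$ for all $U\in\mathcal{A}$. In the three statements, with $\mu$ the infinitely divisible probability measure such that $P_{X_U}=\mu^{m(U)}$ for all $U\in\mathcal{A}$, the finite-dimensional distributions of the increment process are given as follows. For all $n\ge 1$, all $C_1,\dots,C_n\in\mathcal{C}$ and all Borel sets $B_1,\dots,B_n\subseteq\mathbf{R}$, $$P(\Delta X_{C_1}\in B_1,\dots,\Delta X_{C_n}\in B_n)=\int \prod_{k=1}^{n}\ \prod_{|J|=k}\mu^{m(D_J\setminus D^{(k+1)})}(d\xi_J)\ \prod_{i=1}^n \mathbf{1}_{B_i}\Big(\sum_{J\ni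 i}\xi_J\Big),$$ where $J$ ranges over the nonempty subsets of $\{1,\dots,n\}$, $D_J=\bigcap_{j\in J}C_j$, $D^{(k)}=\bigcup_{|J|=k}D_J$ for $1\le k\le n$, $D^{(n+1)}=\emptyset$, and the integral is over the real variables $(\xi_J)_J$.
   Context: $\mathcal{T}$ is a locally compact metric space with Borel $\sigma$-algebra $\mathcal{B}$, equipped with a Radon measure $m$. For a class $\mathcal{D}$ of subsets of $\mathcal{T}$, $\mathcal{D}(u)$ is the class of finite unions of elements of $\mathcal{D}$; $\overline{E}$ and $E^\circ$ denote closure and interior. $\mathcal{A}$ is an indexing collection: a nonempty class of compact connected subsets of $\mathcal{T}$ such that (1) $\emptyset\in\mathcal{A}$; $A^\circ\neq A$ for $A\in\mathcal{A}\setminus\{\emptyset,\mathcal{T}\}$; there is an increasing sequence $(B_n)_{n\in\mathbf{N}}$ in $\mathcal{A}(u)$ with $\mathcal{T}=\bigcup_n B_n^\circ$. (2) $\mathcal{A}$ is closed under arbitrary intersections; if $A,B\in\mathcal{A}$ are nonempty, so is $A\cap B$; if $(A_i)$ is an increasing sequence in $\mathcal{A}$ and some $n$ satisfies $A_i\subseteq B_n$ for all $i$, then $\overline{\bigcup_i A_i}\in\mathcal{A}$. (3) $\sigma(\mathcal{A})=\mathcal{B}$. (4) (Separability from above) There are an increasing sequence of finite subclasses $\mathcal{A}_n\subseteq\mathcal{A}$, closed under intersections, with $\emptyset,B_n\in\mathcal{A}_n(u)$, and functions $g_n:\mathcal{A}\to\mathcal{A}_n(u)\cup\{\mathcal{T}\}$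 such that: (a) $g_n$ preserves arbitrary intersections and finite unions ($g_n(\bigcap_{A\in\mathcal{A}'}A)=\bigcap_{A\in\mathcal{A}'}g_n(A)$ for $\mathcal{A}'\subseteq\mathcal{A}$, and $\bigcup_{i=1}^k A_i=\bigcup_{j=1}^p A'_j$ implies $\bigcup_i g_n(A_i)=\bigcup_j g_n(A'_j)$); (b) $A\subseteq (g_n(A))^\circ$ for all $A\in\mathcal{A}$ and all $n$; (c) $g_n(A)\subseteq g_k(A)$ if $n\ge k$; (d) $A=\bigcap_n g_n(A)$; (e) for $A,A'\in\mathcal{A}$, $g_n(A)\cap A'\in\mathcal{A}$, and $g_n(A)\cap A'\in\mathcal{A}_n$ if $A'\in\mathcal{A}_n$; (f) $g_n(\emptyset)=\emptyset$. (5) Every countable intersection of sets in $\mathcal{A}(u)$ is the closure of a countable union of sets in $\mathcal{A}$. Put $\emptyset'=\bigcap_{U\in\mathcal{A}\setminus\{\emptyset\}}U$; it is assumed that $m(\emptyset')=0$. $\mathcal{C}$ is the class of sets $U_0\setminus\bigcup_{i=1}^nU_i$ with $U_i\in\mathcal{A}$, and $\mathcal{C}_0\subseteq\mathcal{C}$ the class of sets $U\setminus V$ with $U,V\in\mathcal{A}$. For a real-valued process $X=\{X_U;\,U\in\mathcal{A}\}$, the increment process is $\Delta X_C=X_{U_0}-\sum_{i=1}^n\sum_{j_1<\dots<j_i}(-1)^{i-1}X_{U_0\cap U_{j_1}\cap\dots\cap U_{j_i}}$ for $C=U_0\setminus\bigcup_{i=1}^nU_i\in\mathcal{C}$. $X$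 has definite increments if $\Delta X_C$ does not depend on the representation of $C$ and $X_\emptyset=\Delta X_\emptyset=0$. A set-indexed Lévy process is a process $X=\{X_U;\,U\in\mathcal{A}\}$ with definite increments such that: (1) $X_{\emptyset'}=0$ a.s.; (2) for all pairwise disjoint $C_1,\dots,C_n\in\mathcal{C}$, $\Delta X_{C_1},\dots,\Delta X_{C_n}$ are independent; (3) ($m$-stationary $\mathcal{C}_0$-increments) for every integer $n$, every $V\in\mathcal{A}$ and all increasing sequences $(U_i)$, $(A_i)$ in $\mathcal{A}$, if $m(U_i\setminus V)=m(A_i)$ for all $i$ then $(\Delta X_{U_1\setminus V},\dots,\Delta X_{U_n\setminus V})$ and $(\Delta X_{A_1},\dots,\Delta X_{A_n})$ have the same law; (4) (continuity in probability) if $(U_n)$ is a sequence in $\mathcal{A}$ with $\overline{\bigcup_n\bigcap_{k\ge n}U_k}=\bigcap_n\overline{\bigcup_{k\ge n}U_k}=A\in\mathcal{A}$, then $\lim_n P(|X_{U_n}-X_A|>\epsilon)=0$ for every $\epsilon>0$. $P_Y$ denotes the law of $Y$. For an infinitely divisible probability measure $\mu$ on $\mathbf{R}$ and $t\ge 0$, $\mu^t$ denotes its $t$-th convolution power (so $\mu^s*\mu^t=\mu^{s+t}$, $\mu^0=\delta_0$, $\mu^t\to\delta_0$ as $t\to0$). $\{\Delta X_C;\,C\in\mathcal{C}\}$ is an independently scattered random measure if for every sequence $(C_n)$ of pairwise disjoint sets in $\mathcal{C}$ the variables $\Delta X_{C_n}$ are independent and, whenever $\bigcup_nC_n\in\mathcal{C}$,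 $\Delta X_{\bigcup_nC_n}=\sum_n\Delta X_{C_n}$ a.s. (the series converging a.s.). It is infinitely divisible if the law of every $\Delta X_C$ is infinitely divisible.
   Formalization: Added assumption: if U_n increases in 𝒜 and the closure V of its union is in 𝒜, then m(U_n) → m(V); without it the claim fails (𝒜 = {∅} and the sets [0,t] in [0,2], m = Lebesgue + δ_1, μ = δ_1), and (iii) with μ = δ_1 forces it. *)

(* Defs.v *)
From HB Require Import structures.
From mathcomp Require Import all_boot all_order all_algebra finmap.
From mathcomp Require Import all_classical all_reals all_analysis measurable_realfun.

Set Implicit Arguments.
Unset Strict Implicit.
Unset Printing Implicit Defensive.

Import Order.TTheory GRing.Theory Num.Theory.
Import numFieldNormedType.Exports.

Local Open Scope classical_set_scope.
Local Open Scope ring_scope.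

#[short(type="measurableMetricType")]
HB.structure Definition MeasurableMetric (K : numDomainType) d :=
  {T of Measurable d T & Metric K T}.

Definition increasing_sets (T : Type) (F : nat -> set T) : Prop :=
  forall n k, (n <= k)%N -> F n `<=` F k.

(* The class D(u).  Unions are over nonempty families, so that the requirement
   that the empty set be in D(u) is not void. *)
Definition finite_unions (T : Type) (D : set (set T)) : set (set T) :=
  [set E | exists (n : nat) (U : 'I_n.+1 -> set T),
     (forall i, D (U i)) /\ E = \bigcup_i U i].

(* Intersections of families of members are over nonempty families: the
   intersection of the empty family would be the whole space, which need not
   be compact. *)
Record is_indexing_collection (T : topologicalType) (A : set (set T))
    (B : nat -> set T) (An : nat -> set (set T)) (g : nat -> set T -> set T)
    : Prop := {
  ic_compact : forall U, A U -> compact U ;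
  ic_connected : forall U, A U -> connected U ;
  ic_set0 : A set0 ;
  ic_interior : forall U, A U -> U <> set0 -> U <> setT -> U° <> U ;
  ic_B_unions : forall n, finite_unions A (B n) ;
  ic_B_increasing : increasing_sets B ;
  ic_B_cover : \bigcup_n (B n)° = setT ;
  ic_bigcap : forall A' : set (set T), A' !=set0 -> A' `<=` A ->
    A (\bigcap_(U in A') U) ;
  ic_setI_neq0 : forall U V, A U -> A V -> U !=set0 -> V !=set0 ->
    U `&` V !=set0 ;
  ic_closure_bigcup : forall U : nat -> set T, (forall i, A (U i)) ->
    increasing_sets U -> (exists n, forall i, U i `<=` B n) ->
    A (closure (\bigcup_i U i)) ;
  ic_sigma : <<s A >> = <<s @open T >> ;
  ic_An_sub : forall n, An n `<=` A ;
  ic_An_finite : forall n, finite_set (An n) ;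
  ic_An_increasing : increasing_sets An ;
  ic_An_setI : forall n U V, An n U -> An n V -> An n (U `&` V) ;
  ic_An_set0 : forall n, finite_unions (An n) set0 ;
  ic_An_B : forall n, finite_unions (An n) (B n) ;
  ic_g_range : forall n U, A U -> finite_unions (An n) (g n U) \/ g n U = setT ;
  ic_g_bigcap : forall n (A' : set (set T)), A' !=set0 -> A' `<=` A ->
    g n (\bigcap_(U in A') U) = \bigcap_(U in A') g n U ;
  ic_g_bigcup : forall n (k p : nat)
    (U : 'I_k.+1 -> set T) (V : 'I_p.+1 -> set T),
    (forall i, A (U i)) -> (forall j, A (V j)) ->
    \bigcup_i U i = \bigcup_j V j ->
    \bigcup_i g n (U i) = \bigcup_j g n (V j) ;
  ic_g_interior : forall n U, A U -> U `<=` (g n U)° ;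
  ic_g_decreasing : forall n k U, A U -> (k <= n)%N -> g n U `<=` g k U ;
  ic_g_limit : forall U, A U -> U = \bigcap_n g n U ;
  ic_g_setI : forall n U V, A U -> A V -> A (g n U `&` V) ;
  ic_g_setI_An : forall n U V, A U -> An n V -> An n (g n U `&` V) ;
  ic_g_set0 : forall n, g n set0 = set0 ;
  ic_bigcap_unions : forall F : nat -> set T,
    (forall n, finite_unions A (F n)) ->
    exists G : nat -> set T,
      (forall n, A (G n)) /\ \bigcap_n F n = closure (\bigcup_n G n)
}.

Definition indexing_collection (T : topologicalType) (A : set (set T)) : Prop :=
  exists B An g, is_indexing_collection A B An g.

Definition empty_prime (T : Type) (A : set (set T)) : set T :=
  \bigcap_(U in [set U | A U /\ U <> set0]) U.

(* The choice n = 0 represents the members of A themselves. *)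
Definition represents (T : Type) (A : set (set T)) (C : set T)
    (n : nat) (U0 : set T) (U : 'I_n -> set T) : Prop :=
  [/\ A U0, forall i, A (U i) & C = U0 `\` \bigcup_i U i].

Definition class_C (T : Type) (A : set (set T)) : set (set T) :=
  [set C | exists n U0 (U : 'I_n -> set T), represents A C U0 U].

Section radon.
Context {R : realType} {d : measure_display} {T : measurableMetricType R d}.
Variable m : {measure set T -> \bar R}.
Local Open Scope ereal_scope.

Record radon_measure : Prop := {
  radon_compact : forall K : set T, compact K -> m K < +oo ;
  radon_outer : forall E : set T, measurable E ->
    m E = ereal_inf [set m U | U in [set U | open U /\ E `<=` U]] ;
  radon_inner : forall U : set T, open U ->
    m U = ereal_sup [set m K | K in [set K | compact K /\ K `<=` U]]
}.

(* This is necessary for Levy processes with laws mu^(m(U)) to exist for every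
   infinitely divisible mu: when mu is the unit mass at 1 such a process is
   X_U = m(U) a.s., and its continuity in probability along increasing
   sequences is exactly this property.  A Radon measure on [0, 2] with an atom
   in ]0, 2] lacks it for the indexing collection of the sets [0, t]. *)
Definition monotonically_continuous (A : set (set T)) : Prop :=
  forall U : nat -> set T, (forall n, A (U n)) -> increasing_sets U ->
    A (closure (\bigcup_n U n)) ->
    m (U n) @[n --> \oo] --> m (closure (\bigcup_n U n)).

End radon.

(* A measure is a function on all sets of reals, its values off the Borel sets
   being irrelevant: laws are compared on the Borel sets only. *)
Definition same_law (R : realType) (mu nu : probability R R) : Prop :=
  forall B : set R, measurable B -> mu B = nu B.

Section convolution.
Context {R : realType}.

Definition sum_pair (z : R * R) : R := z.1 + z.2.

Lemma measurable_sum_pair : measurable_fun setT sum_pair.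
Proof. by apply: measurable_funD; [exact: measurable_fst|exact: measurable_snd]. Qed.

HB.instance Definition _ :=
  isMeasurableFun.Build _ _ _ _ sum_pair measurable_sum_pair.

Definition convolution (mu nu : probability R R) : probability R R :=
  distribution (mu \x nu)%E sum_pair.

Definition convolution_iter (mu : probability R R) (n : nat)
    : probability R R :=
  iter n (convolution mu) (\d_(0 : R)).

Definition infinitely_divisible (mu : probability R R) : Prop :=
  forall n, (0 < n)%N ->
    exists nu : probability R R, same_law mu (convolution_iter nu n).

Definition weak_cvg (I : Type) (F : set_system I) (p : I -> probability R R)
    (nu : probability R R) : Prop :=
  forall f : R -> R, continuous f -> (exists M, forall x, `|f x| <= M) ->
    (\int[p t]_x (f x)%:E)%E @[t --> F] --> (\int[nu]_x (f x)%:E)%E.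

Record convolution_semigroup (p : R -> probability R R) : Prop := {
  cs_zero : same_law (p 0) (\d_(0 : R)) ;
  cs_add : forall s t, 0 <= s -> 0 <= t ->
    same_law (p (s + t)) (convolution (p s) (p t)) ;
  cs_cvg0 : weak_cvg 0^'+ p (\d_(0 : R))
}.

(* The power mu^t of an infinitely divisible mu, for t >= 0: the value at t of
   the weakly continuous convolution semigroup equal to mu at time 1, which
   exists and is unique on the Borel sets. *)
Definition convolution_power (mu : probability R R) (t : R)
    : probability R R :=
  xget (fun=> (\d_(0 : R) : probability R R))
    [set p | convolution_semigroup p /\ same_law (p 1) mu] t.

(* \int nu_{i_1}(dxi_{i_1}) ... nu_{i_k}(dxi_{i_k}) F(xi), for the list
   s = [i_1; ...; i_k]; the coordinates off s are those of xi. *)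
Fixpoint iterated_integral (I : eqType) (nu : I -> probability R R)
    (s : seq I) (F : (I -> R) -> \bar R) (xi : I -> R) : \bar R :=
  match s with
  | [::] => F xi
  | i :: s' =>
    (\int[nu i]_x
       iterated_integral nu s' F (fun j => if j == i then x else xi j))%E
  end.

End convolution.

(* A process is a family of random variables indexed by all the subsets of T;
   only its values on the indexing collection A are ever used. *)

Section processes.
Context {R : realType} {d : measure_display} {Omega : measurableType d}.
Context {P : probability Omega R} {T : topologicalType}.
Implicit Types (A : set (set T)) (X : set T -> {RV P >-> R}).

Definition law (Y : {RV P >-> R}) : probability R R := distribution P Y.

Definition mutually_independent (I : choiceType) (Y : I -> {RV P >-> R})
    : Prop :=
  forall (J : {fset I}) (B : I -> set R), (forall i, measurable (B i)) ->
    P (\bigcap_(i in [set` J]) (Y i @^-1` B i)) =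
    (\big[*%E/1%E]_(i <- J) P (Y i @^-1` B i))%E.

Definition random_vector (n : nat) (Y : nat -> {RV P >-> R}) (w : Omega)
    : n.-tuple R :=
  [tuple Y (val i) w | i < n].

(* Since J ranges over the subsets of size i, the inner sum is the one over
   j_1 < ... < j_i. *)
Definition inclusion_exclusion X (n : nat) (U0 : set T) (U : 'I_n -> set T)
    : {RV P >-> R} :=
  (X U0 : {mfun Omega >-> R}) -
  \sum_(1 <= i < n.+1) \sum_(J : {set 'I_n} | #|J| == i)
    (-1) ^+ i.-1 *
    (X (U0 `&` \bigcap_(j in [set j | j \in J]) U j) : {mfun Omega >-> R}).

(* The increment on C, computed from some representation of C; it is only
   meaningful for processes with definite increments. *)
Definition increment A X (C : set T) : {RV P >-> R} :=
  xget (0 : {mfun Omega >-> R})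
    [set Y | exists n U0 (U : 'I_n -> set T),
       represents A C U0 U /\ Y = inclusion_exclusion X U0 U].

Definition definite_increments A X : Prop :=
  [/\ forall C n U0 (U : 'I_n -> set T) k V0 (V : 'I_k -> set T),
        represents A C U0 U -> represents A C V0 V ->
        inclusion_exclusion X U0 U =1 inclusion_exclusion X V0 V,
      forall w, X set0 w = 0 &
      forall w, increment A X set0 w = 0].

Definition independently_scattered A X : Prop :=
  forall C : nat -> set T, (forall n, class_C A (C n)) -> trivIset setT C ->
    mutually_independent (fun n => increment A X (C n)) /\
    (class_C A (\bigcup_n C n) ->
     {ae P, forall w, series (fun n => increment A X (C n) w) @ \oo -->
                      increment A X (\bigcup_n C n) w}).

Definition infinitely_divisible_increments A X : Prop :=
  forall C, class_C A C -> infinitely_divisible (law (increment A X C)).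

Definition stationary_random_measure A (m : set T -> \bar R) X : Prop :=
  forall C1 C2, class_C A C1 -> class_C A C2 -> m C1 = m C2 ->
    same_law (law (increment A X C1)) (law (increment A X C2)).

Record levy_process A (m : set T -> \bar R) X : Prop := {
  levy_definite : definite_increments A X ;
  levy_start : {ae P, forall w, X (empty_prime A) w = 0} ;
  levy_independent : forall n (C : 'I_n -> set T),
    (forall i, class_C A (C i)) -> trivIset setT C ->
    mutually_independent (fun i => increment A X (C i)) ;
  levy_stationary : forall (n : nat) (V : set T) (U W : nat -> set T),
    A V -> (forall i, A (U i)) -> (forall i, A (W i)) ->
    increasing_sets U -> increasing_sets W ->
    (forall i, m (U i `\` V) = m (W i)) ->
    forall B : set (n.-tuple R), measurable B ->
      P (random_vector n (fun i => increment A X (U i `\` V)) @^-1` B) =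
      P (random_vector n (fun i => increment A X (W i)) @^-1` B) ;
  levy_continuous : forall (U : nat -> set T) (V : set T),
    (forall n, A (U n)) -> A V ->
    closure (\bigcup_n \bigcap_(k in [set k | (n <= k)%N]) U k) = V ->
    \bigcap_n closure (\bigcup_(k in [set k | (n <= k)%N]) U k) = V ->
    forall e : R, 0 < e ->
      P [set w | e < `|X (U n) w - X V w|] @[n --> \oo] --> 0%E
}.

End processes.

(* The law of (X_U; U in A) on the product sigma-algebra generated by the
   coordinates f |-> f U with U in A. *)
Definition cylinder_events (R : realType) (T : Type) (A : set (set T))
    : set (set (set T -> R)) :=
  <<s [set E | exists U (B : set R),
         [/\ A U, measurable B & E = [set f | B (f U)]]] >>.

Definition same_process_law (R : realType) (T : Type) (A : set (set T))
    d (Omega : measurableType d) (P : probability Omega R)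
    d' (Omega' : measurableType d') (P' : probability Omega' R)
    (X : set T -> {RV P >-> R}) (Y : set T -> {RV P' >-> R}) : Prop :=
  forall E, cylinder_events A E ->
    P [set w | E (fun U => X U w)] = P' [set w | E (fun U => Y U w)].

Section finite_dimensional.
Context {T : Type} {n : nat}.
Variable C : 'I_n -> set T.

Definition D_inter (J : {set 'I_n}) : set T :=
  \bigcap_(j in [set j | j \in J]) C j.

Definition D_union (k : nat) : set T :=
  \bigcup_(J in [set J : {set 'I_n} | #|J| = k]) D_inter J.

(* The nonempty subsets of the index set, listed by increasing size. *)
Definition nonempty_subsets : seq {set 'I_n} :=
  flatten [seq enum [set J : {set 'I_n} | #|J| == k] | k <- iota 1 n].

End finite_dimensional.

Definition increment_fdd (R : realType) (T : Type) (m : set T -> \bar R)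
    (mu : probability R R) (n : nat) (C : 'I_n -> set T) (B : 'I_n -> set R)
    : \bar R :=
  iterated_integral
    (fun J : {set 'I_n} =>
       convolution_power mu (fine (m (D_inter C J `\` D_union C #|J|.+1))))
    (@nonempty_subsets n)
    (fun xi => (\prod_(i < n)
                  \1_(B i) (\sum_(J : {set 'I_n} | i \in J) xi J))%:E)
    (fun=> 0).

(* Main.v *)
(** A law is determined by its characteristic function, and a convolution
    semigroup by its law at time 1. A connected member U of A contains, above the
    smallest nonempty member of A, members of A of every intermediate mass;
    hence stationarity makes the law of the increment of a Lévy process over
    W \ U a function q of the mass of W \ U, and q is a semigroup because chains
    in A split into independent pieces. Continuity in probability gives
    q t -> q 0. By induction on the number of sets removed, the law of the
    increment over C is q (m C) for all C in [class_C]; each of the four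
    statements is then about processes with definite, independent increments
    such that the increment over C has law q (m C) ([levy_like]).

    The joint law of increments over C_1, ..., C_n is that of sums of independent
    variables attached to the cells cut out by C_1, ..., C_n, which gives the
    finite-dimensional formula. Sigma-additivity almost surely reduces to the
    almost sure convergence of series of independent variables, obtained from
    Ottaviani's inequality. For the existence, the finite-dimensional laws extend
    by Kolmogorov's theorem; the additivity relations hold only almost surely for
    the coordinates, and the process is corrected so as to satisfy them surely. *)

From HB Require Import structures.
Require Import Defs.
From mathcomp Require Import all_boot all_order all_algebra finmap complex ring lra.
From mathcomp Require Import all_classical all_reals all_analysis measurable_realfun.

Set Implicit Arguments.
Unset Strict Implicit.
Unset Printing Implicit Defensive.

Import Order.TTheory GRing.Theory Num.Theory.
Import numFieldNormedType.Exports.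

Local Open Scope classical_set_scope.
Local Open Scope ring_scope.

(** * Characteristic functions *)

(** Two obstacles shape the passage from a process to its semigroup. The masses found inside one
    member of [A] stop at some finite c, so later times are reached by composing full steps of
    length c. And the weak limit at 0 concerns arbitrary small times, whereas the available
    continuity concerns sequences of sets: times violating the limit are therefore chosen to
    decrease so fast that nested members of [A] carry them. The continuity used there is isolated as
    the hypothesis [H2], which a Lévy process gets from continuity in probability and a scattered
    measure from a telescoping series.

    Uniqueness of semigroups hinges on the ambiguity of n-th roots of a characteristic function;
    non-vanishing and continuity in the frequency remove it. The same non-vanishing allows the law
    over a difference of sets to be obtained by cancellation.

    For the existence, a basis is extracted from the indicators of the members of [A], and only the
    coordinates of that basis are read; the joint laws of the resulting process are then recomputed
    on disjoint pieces. *)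

Section bounded_integrals.
Context {d} {S : measurableType d} {R : realType}.
Implicit Types (P : probability S R) (f : S -> R).

Lemma bounded_integrable P f (M : R) : measurable_fun setT f ->
  (forall x, `|f x| <= M) -> P.-integrable setT (EFin \o f).
Proof.
move=> mf fM; apply: measurable_bounded_integrable => //.
  exact: le_lt_trans (probability_le1 P measurableT) (ltry _).
exists M; split; first exact: num_real.
by move=> N MN x _; exact: le_trans (fM x) (ltW MN).
Qed.

Lemma Rintegral_probability_cst P (r : R) : \int[P]_x r = r.
Proof.
rewrite Rintegral_cst// -[RHS]mulr1; congr (_ * _).
exact: (congr1 (@fine R) (probability_setT P)).
Qed.

Lemma Rintegral_bounded_cvg P (f : nat -> S -> R) (g : S -> R) (M : R) :
  (forall n, measurable_fun setT (f n)) ->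
  (forall n x, `|f n x| <= M) ->
  (forall x, f n x @[n --> \oo] --> g x) ->
  \int[P]_x f n x @[n --> \oo] --> \int[P]_x g x.
Proof.
move=> mf fM fg.
have mg : measurable_fun setT g.
  by apply: (@measurable_fun_cvg _ _ _ _ f) => // x _; exact: fg.
have gM x : `|g x| <= M.
  by apply: (cvgr_to_le (cvg_norm (fg x))); exact: nearW.
have fgE x : (f n x)%:E @[n --> \oo] --> (g x)%:E.
  by apply: cvg_EFin; [exact: nearW|exact: fg].
have [_ _] := @dominated_convergence _ _ _ P setT measurableT
  (fun n x => (f n x)%:E) (fun x => (g x)%:E) (cst M%:E)
  (fun n => iffRL (measurable_EFinP _ _) (mf n))
  (iffRL (measurable_EFinP _ _) mg)
  (aeW _ (fun x _ => fgE x))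
  (@bounded_integrable P (cst M) `|M| (measurable_cst M) (fun=> lexx _)) (aeW _ (fun x n _ => fM n x)).
move=> h; apply: fine_cvg; rewrite fineK//.
exact: (integrable_fin_num measurableT (bounded_integrable P mg gM)).
Qed.

End bounded_integrals.

Section characteristic_function.
Context {R : realType}.
Implicit Types (mu nu : probability R R) (u t : R).

(** The cosine and sine parts are integrated separately: analysis stays with real functions, and
    only the algebra of products and powers takes place in [R[i]]. *)
Definition cf mu u : R[i] :=
  Complex (\int[mu]_x cos (u * x)) (\int[mu]_x sin (u * x)).

Lemma measurable_mulrl u : measurable_fun setT (fun x : R => u * x).
Proof. exact: measurable_funM. Qed.

Lemma measurable_cosM u : measurable_fun setT (fun x : R => cos (u * x)).
Proof.
by apply: (measurableT_comp (f := cos)); [apply: continuous_measurable_fun; exact: continuous_cos|exact: measurable_mulrl].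
Qed.

Lemma measurable_sinM u : measurable_fun setT (fun x : R => sin (u * x)).
Proof.
by apply: (measurableT_comp (f := sin)); [apply: continuous_measurable_fun; exact: continuous_sin|exact: measurable_mulrl].
Qed.

Lemma normr_cos_le1 t : `|cos t| <= 1.
Proof. by rewrite ler_norml cos_geN1 cos_le1. Qed.

Lemma normr_sin_le1 t : `|sin t| <= 1.
Proof. by rewrite ler_norml sin_geN1 sin_le1. Qed.

Lemma cf0 mu : cf mu 0 = 1.
Proof.
rewrite /cf; under eq_Rintegral do rewrite mul0r cos0.
rewrite Rintegral_probability_cst; under eq_Rintegral do rewrite mul0r sin0.
by rewrite Rintegral_probability_cst.
Qed.

Lemma eq_Rintegral_same_law mu nu (f : R -> R) : same_law mu nu ->
  \int[mu]_x f x = \int[nu]_x f x.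
Proof. by move=> h; congr fine; apply: eq_measure_integral => A mA _; exact: h. Qed.

Lemma cf_same_law mu nu : same_law mu nu -> cf mu =1 cf nu.
Proof. by move=> h u; rewrite /cf !(eq_Rintegral_same_law _ h). Qed.

Lemma cf_dirac0 u : cf (\d_(0 : R)) u = 1.
Proof.
rewrite /cf /Rintegral !integral_dirac//=; last 2 first.
- by apply/measurable_EFinP; exact: measurable_sinM.
- by apply/measurable_EFinP; exact: measurable_cosM.
by rewrite !indicE !in_setT !mul1r mulr0 cos0 sin0.
Qed.

Lemma Rintegral_convolution mu nu (f : R -> R) (M : R) :
  measurable_fun setT f -> (forall x, `|f x| <= M) ->
  \int[convolution mu nu]_x f x = \int[mu]_x \int[nu]_y f (x + y).
Proof.
move=> mf fM.
have mfs : measurable_fun setT (fun z : R * R => f (z.1 + z.2)).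
  exact: (measurableT_comp mf measurable_sum_pair).
have is_ : (mu \x nu)%E.-integrable setT (EFin \o (fun z : R * R => f (z.1 + z.2))).
  exact: (@bounded_integrable _ _ _ (mu \x nu)%E _ M mfs).
rewrite /Rintegral /convolution integral_distribution//; last first.
  exact: measurableT_comp.
rewrite -integral12_prod_meas1//; congr fine; apply: eq_integral => x _.
rewrite /fubini_F fineK//.
apply: integrable_fin_num => //.
apply: (@bounded_integrable _ _ _ nu (fun y => f (x + y)) M) => //.
by apply: measurableT_comp => //; exact: measurable_funD.
Qed.

(** After Fubini, the addition formulas for cosine and sine are exactly the real and imaginary parts
    of a complex product. *)
Lemma cf_convolution mu nu u : cf (convolution mu nu) u = cf mu u * cf nu u.
Proof.
have ic (m : probability R R) := @bounded_integrable _ _ _ m _ _ (measurable_cosM u) (fun=> normr_cos_le1 _).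
have is_ (m : probability R R) := @bounded_integrable _ _ _ m _ _ (measurable_sinM u) (fun=> normr_sin_le1 _).
have icr (m : probability R R) r : m.-integrable setT (EFin \o (fun x => r * cos (u * x))).
  apply: (@bounded_integrable _ _ _ m _ `|r|); first by apply: measurable_funM => //; exact: measurable_cosM.
  by move=> x; rewrite normrM ler_piMr// normr_cos_le1.
have isr (m : probability R R) r : m.-integrable setT (EFin \o (fun x => r * sin (u * x))).
  apply: (@bounded_integrable _ _ _ m _ `|r|); first by apply: measurable_funM => //; exact: measurable_sinM.
  by move=> x; rewrite normrM ler_piMr// normr_sin_le1.
rewrite /cf (Rintegral_convolution _ _ (measurable_cosM u) (fun=> normr_cos_le1 _)).
rewrite (Rintegral_convolution _ _ (measurable_sinM u) (fun=> normr_sin_le1 _)).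
set a := \int[nu]_y cos (u * y); set b := \int[nu]_y sin (u * y).
have -> : \int[mu]_x \int[nu]_y cos (u * (x + y)) =
          \int[mu]_x (a * cos (u * x) - b * sin (u * x)).
  apply: eq_Rintegral => x _.
  under eq_Rintegral do rewrite mulrDr cosD.
  rewrite (RintegralB measurableT (icr _ _) (isr _ _)).
  by rewrite (RintegralZl _ measurableT (ic _)) (RintegralZl _ measurableT (is_ _)) mulrC (mulrC b).
have -> : \int[mu]_x \int[nu]_y sin (u * (x + y)) =
          \int[mu]_x (a * sin (u * x) + b * cos (u * x)).
  apply: eq_Rintegral => x _.
  under eq_Rintegral do rewrite mulrDr sinD.
  rewrite (RintegralD measurableT (icr _ _) (isr _ _)).
  by rewrite (RintegralZl _ measurableT (ic _)) (RintegralZl _ measurableT (is_ _)) (mulrC a) (mulrC b).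
rewrite (RintegralB measurableT (icr _ _) (isr _ _)) (RintegralD measurableT (isr _ _) (icr _ _)).
rewrite !(RintegralZl _ measurableT (ic _)) !(RintegralZl _ measurableT (is_ _)).
by congr Complex; rewrite ?(mulrC a) ?(mulrC b) // addrC.
Qed.

Lemma cf_convolution_iter mu n u : cf (convolution_iter mu n) u = cf mu u ^+ n.
Proof.
elim: n => [|n IH]; first by rewrite expr0 cf_dirac0.
by rewrite /convolution_iter/= cf_convolution -/(convolution_iter mu n) IH exprS.
Qed.

End characteristic_function.

Section characteristic_function_injective.
Context {R : realType}.
Implicit Types (mu nu : probability R R) (u a y : R).

(** Integrals of the generators are the parts of the characteristic function, so equality of
    integrals follows by induction. Products are deliberately absent from the constructors; they
    come from [trigpolyM]. *)
Inductive trigpoly : (R -> R) -> Prop :=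
| trigpoly_cos u : trigpoly (fun x => cos (u * x))
| trigpoly_sin u : trigpoly (fun x => sin (u * x))
| trigpoly_lin a f g : trigpoly f -> trigpoly g ->
    trigpoly (fun x => a * f x + g x).

Lemma trigpoly_ext f g : trigpoly f -> f =1 g -> trigpoly g.
Proof. by move=> tf /funext <-. Qed.

Lemma trigpoly_cst a : trigpoly (fun=> a).
Proof.
apply: (trigpoly_ext (trigpoly_lin a (trigpoly_cos 0) (trigpoly_sin 0))) => x.
by rewrite mul0r cos0 sin0 mulr1 addr0.
Qed.

(** The product-to-sum formulas handle pairs of generators; bilinearity does the rest. *)
Lemma trigpolyM f g : trigpoly f -> trigpoly g -> trigpoly (fun x => f x * g x).
Proof.
have half u v (h1 h2 : R -> R) : trigpoly h1 -> trigpoly h2 -> trigpoly (fun x => u * h1 x + v * h2 x).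
  move=> t1 t2; apply: (trigpoly_ext (trigpoly_lin u t1 (trigpoly_lin v t2 (trigpoly_cst 0)))).
  by move=> x; rewrite addr0.
move=> tf; elim: tf g => {f}.
- move=> u g; elim=> {g}.
  + move=> v; apply: (trigpoly_ext (half 2^-1 2^-1 _ _ (trigpoly_cos (u - v)) (trigpoly_cos (u + v)))).
    move=> x; rewrite mulrBl mulrDl cosB cosD; by field.
  + move=> v; apply: (trigpoly_ext (half 2^-1 (- 2^-1) _ _ (trigpoly_sin (u + v)) (trigpoly_sin (u - v)))).
    move=> x; rewrite mulrBl mulrDl sinB sinD; by field.
  + move=> a f g _ tf _ tg; apply: (trigpoly_ext (trigpoly_lin a tf tg)) => x.
    by rewrite mulrDr mulrCA.
- move=> u g; elim=> {g}.
  + move=> v; apply: (trigpoly_ext (half 2^-1 2^-1 _ _ (trigpoly_sin (u + v)) (trigpoly_sin (u - v)))).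
    move=> x; rewrite mulrBl mulrDl sinB sinD; by field.
  + move=> v; apply: (trigpoly_ext (half 2^-1 (- 2^-1) _ _ (trigpoly_cos (u - v)) (trigpoly_cos (u + v)))).
    move=> x; rewrite mulrBl mulrDl cosB cosD; by field.
  + move=> a f g _ tf _ tg; apply: (trigpoly_ext (trigpoly_lin a tf tg)) => x.
    by rewrite mulrDr mulrCA.
- move=> a f g _ tf _ tg h th; apply: (trigpoly_ext (trigpoly_lin a (tf _ th) (tg _ th))) => x.
  by rewrite mulrDl mulrA.
Qed.

Lemma trigpoly_bounded f : trigpoly f ->
  measurable_fun setT f /\ exists M, forall x, `|f x| <= M.
Proof.
elim=> {f}.
- move=> u; split; first exact: measurable_cosM.
  by exists 1 => x; exact: normr_cos_le1.
- move=> u; split; first exact: measurable_sinM.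
  by exists 1 => x; exact: normr_sin_le1.
- move=> a f g _ [mf [Mf fM]] _ [mg [Mg gM]]; split.
    by apply: measurable_funD => //; exact: measurable_funM.
  exists (`|a| * Mf + Mg) => x; apply: le_trans (ler_normD _ _) _.
  by rewrite lerD// normrM ler_wpM2l.
Qed.

Lemma Rintegral_trigpoly mu nu f : cf mu =1 cf nu -> trigpoly f ->
  \int[mu]_x f x = \int[nu]_x f x.
Proof.
move=> munu; elim=> {f}.
- by move=> u; have := munu u; rewrite /cf => -[].
- by move=> u; have := munu u; rewrite /cf => -[].
- move=> a f g tf If tg Ig.
  have [mf [Mf fM]] := trigpoly_bounded tf; have [mg [Mg gM]] := trigpoly_bounded tg.
  have iaf (m : probability R R) : m.-integrable setT (EFin \o (fun x => a * f x)).
    apply: (@bounded_integrable _ _ _ m _ (`|a| * Mf)); first exact: measurable_funM.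
    by move=> x; rewrite normrM ler_wpM2l.
  rewrite !(RintegralD measurableT (iaf _) (bounded_integrable _ mg gM)).
  by rewrite !(RintegralZl _ measurableT (bounded_integrable _ mf fM)) If Ig.
Qed.

(* Its iterates converge to the sign function on [-1, 1]. *)
Definition sign_step y : R := y * (3 - y ^+ 2) / 2.

Lemma trigpoly_sign_step n f : trigpoly f -> trigpoly (fun x => iter n sign_step (f x)).
Proof.
move=> tf; elim: n => //= n IH.
have t2 := trigpolyM IH (trigpolyM IH IH).
apply: (trigpoly_ext (trigpoly_lin (- 2^-1) t2 (trigpolyM (trigpoly_cst (3 / 2)) IH))).
by move=> x; rewrite /sign_step; field.
Qed.

Lemma sign_stepN y : sign_step (- y) = - sign_step y.
Proof. by rewrite /sign_step sqrrN !mulNr. Qed.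

Lemma iter_sign_stepN n y : iter n sign_step (- y) = - iter n sign_step y.
Proof. by elim: n => //= n ->; rewrite sign_stepN. Qed.

(** With z the current iterate, [1 - sign_step z] factors as [(1 - z) * (1 - z / 2 - z ^+ 2 / 2)].
    Since z stays above y, the second factor is at most [1 - y / 2], whence a geometric rate. *)
Lemma iter_sign_step_itv n y : 0 <= y -> y <= 1 ->
  y <= iter n sign_step y <= 1 /\ 1 - iter n sign_step y <= (1 - y / 2) ^+ n.
Proof.
move=> y0 y1; elim: n => [|n [/andP[yz z1] zn]] /=.
  by rewrite lexx y1/=; split => //; rewrite expr0; lra.
set z := iter n _ _ in yz z1 zn *.
have zz : z <= sign_step z by rewrite /sign_step ler_pdivlMr//; nra.
have qE : 1 - sign_step z = (1 - z) * (1 - z / 2 - z ^+ 2 / 2) by rewrite /sign_step; field.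
split.
  by rewrite (le_trans yz zz)/= -subr_ge0 qE; apply: mulr_ge0; nra.
have z2 : 1 - z / 2 - z ^+ 2 / 2 <= 1 - y / 2 by nra.
rewrite qE (exprSr _ n); apply: (@le_trans _ _ ((1 - z) * (1 - y / 2))).
  by rewrite ler_wpM2l// subr_ge0.
by rewrite ler_wpM2r//; lra.
Qed.

Lemma iter_sign_step_cvg y : `|y| <= 1 -> iter n sign_step y @[n --> \oo] --> Num.sg y.
Proof.
have pos z : 0 < z -> z <= 1 -> iter n sign_step z @[n --> \oo] --> (1 : R).
  move=> z0 z1.
  apply: (@squeeze_cvgr _ _ _ _ (fun n => 1 - (1 - z / 2) ^+ n) (fun=> 1)).
  - near=> n; have [/andP[_ ->] h] := iter_sign_step_itv n (ltW z0) z1.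
    by rewrite andbT; lra.
  - rewrite -[X in _ --> X]subr0; apply: cvgB; first exact: cvg_cst.
    apply: cvg_expr; rewrite ger0_norm; lra.
  - exact: cvg_cst.
move=> y1; have [y0|y0|->] := ltgtP y 0.
- rewrite ltr0_sg// -(opprK y); under eq_fun do rewrite iter_sign_stepN.
  by apply: cvgN; apply: pos; [lra|rewrite -(ltr0_norm y0)].
- by rewrite gtr0_sg//; apply: pos => //; rewrite -(gtr0_norm y0).
- rewrite sgr0; have -> : (fun n => iter n sign_step 0) = (fun=> 0).
    by apply/funext; elim=> //= n ->; rewrite /sign_step mul0r mul0r.
  exact: cvg_cst.
Unshelve. all: end_near.
Qed.

Lemma normr_iter_sign_step n y : `|y| <= 1 -> `|iter n sign_step y| <= 1.
Proof.
move=> y1; have [y0|y0] := leP 0 y.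
  have yy : y <= 1 by rewrite -(ger0_norm y0).
  have [/andP[h1 h2] _] := iter_sign_step_itv n y0 yy.
  by rewrite ger0_norm// (le_trans y0).
have ny : 0 <= - y by lra.
have yy : - y <= 1 by rewrite -ltr0_norm.
have [/andP[h1 h2] _] := iter_sign_step_itv n ny yy.
by rewrite -normrN -iter_sign_stepN ger0_norm// (le_trans ny).
Qed.

(** This polynomial sends -1, 0, 1 to 0, 0, 1: applied to a sign it is the indicator of the positive
    reals, and it maps [-1, 1] into itself. *)
Let plus_part (s : R) := (s + s ^+ 2) / 2.

Let normr_plus_part s : `|s| <= 1 -> `|plus_part s| <= 1.
Proof.
rewrite !ler_norml /plus_part => /andP[h1 h2].
by rewrite ler_pdivlMr// ler_pdivrMr//; apply/andP; split; nra.
Qed.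

Let plus_part_cvg (f : nat -> R) l : f n @[n --> \oo] --> l ->
  plus_part (f n) @[n --> \oo] --> plus_part l.
Proof.
move=> fl; apply: cvgMl; apply: cvgD => //.
by under eq_fun do rewrite expr2; rewrite expr2; apply: cvgM.
Qed.

(** Two bounded limits are taken in turn. Iterating [sign_step] on the sine of [L k * (x - a)]
    yields a periodic square wave; letting the frequency [L k] tend to 0 pushes the period to
    infinity and leaves the sign of x - a, hence the indicator of the ray. *)
Lemma eq_cf_ray mu nu a : cf mu =1 cf nu ->
  mu `]a, +oo[%classic = nu `]a, +oo[%classic.
Proof.
move=> munu.
pose L (k : nat) : R := k.+1%:R^-1.
pose h n k x := plus_part (iter n sign_step (sin (L k * (x - a)))).
have trig n k : trigpoly (h n k).
  have t1 : trigpoly (fun x => sin (L k * (x - a))).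
    apply: (trigpoly_ext (trigpoly_lin (cos (L k * a)) (trigpoly_sin (L k))
      (trigpolyM (trigpoly_cst (- sin (L k * a))) (trigpoly_cos (L k))))).
    by move=> x; rewrite mulrBr sinB; ring.
  have t2 := trigpoly_sign_step n t1.
  apply: (trigpoly_ext (trigpoly_lin 2^-1 t2 (trigpolyM (trigpoly_cst 2^-1) (trigpolyM t2 t2)))).
  by move=> x; rewrite /h /plus_part; field.
have mh n k : measurable_fun setT (h n k) by have [] := trigpoly_bounded (trig n k).
have h1 n k x : `|h n k x| <= 1.
  by apply: normr_plus_part; apply: normr_iter_sign_step; exact: normr_sin_le1.
pose g k x := plus_part (Num.sg (sin (L k * (x - a)))).
have hg k x : h n k x @[n --> \oo] --> g k x.
  by apply: plus_part_cvg; apply: iter_sign_step_cvg; exact: normr_sin_le1.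
have mg k : measurable_fun setT (g k).
  by apply: (@measurable_fun_cvg _ _ _ _ (h ^~ k)) => // x _; exact: hg.
have g1 k x : `|g k x| <= 1.
  by apply: (cvgr_to_le (cvg_norm (hg k x))); exact: nearW.
have Ig k : \int[mu]_x g k x = \int[nu]_x g k x.
  have c1 := @Rintegral_bounded_cvg _ _ _ mu _ _ _ (fun n => mh n k) (fun n => h1 n k) (hg k).
  have c2 := @Rintegral_bounded_cvg _ _ _ nu _ _ _ (fun n => mh n k) (fun n => h1 n k) (hg k).
  have e : (fun n => \int[mu]_x h n k x) = (fun n => \int[nu]_x h n k x).
    by apply/funext => n; exact: Rintegral_trigpoly.
  by rewrite e in c1; exact: (cvg_unique _ c1 c2).
have gi x : g k x @[k --> \oo] --> (\1_(`]a, +oo[%classic) x : R).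
  have -> : (\1_(`]a, +oo[%classic) x : R) = plus_part (Num.sg (x - a)).
    rewrite indicE mem_setE in_itv/= andbT /plus_part -subr_gt0.
    by case: sgrP => /=; rewrite ?expr0n ?expr1n ?sqrrN ?expr1n/=; lra.
  (* From this rank on [L k * (x - a)] lies strictly between -pi and pi, where the sine has the sign
     of its argument. *)
  apply: cvg_near_cst; exists (Num.truncn (`|x - a| / pi)) => // k /= kn.
  rewrite /g; congr plus_part.
  have piLt : `|L k * (x - a)| < pi.
    rewrite normrM gtr0_norm ?invr_gt0// mulrC ltr_pdivrMr//.
    rewrite mulrC -ltr_pdivrMr ?pi_gt0//.
    apply: lt_le_trans (Num.Theory.truncnS_gt _) _; by rewrite ler_nat ltnS.
  have sgL : Num.sg (L k * (x - a)) = Num.sg (x - a).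
    by rewrite sgrM gtr0_sg ?invr_gt0// mul1r.
  rewrite -sgL; move: (L k * (x - a)) piLt => z zpi.
  case: (sgrP z) => [->|z0|z0]; first by rewrite sin0 sgr0.
    by rewrite gtr0_sg// sin_gt0_pi// z0/= -(gtr0_norm z0).
  by rewrite -(opprK z) sinN ltr0_sg// oppr_lt0 sin_gt0_pi// oppr_gt0 z0/= -(ltr0_norm z0).
have c1 := @Rintegral_bounded_cvg _ _ _ mu _ _ _ mg g1 gi.
have c2 := @Rintegral_bounded_cvg _ _ _ nu _ _ _ mg g1 gi.
have e : (fun n => \int[mu]_x g n x) = (fun n => \int[nu]_x g n x) by apply/funext.
rewrite e in c1.
have : \int[mu]_x (\1_(`]a, +oo[%classic) x : R) = \int[nu]_x (\1_(`]a, +oo[%classic) x : R).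
  exact: (cvg_unique _ c1 c2).
rewrite /Rintegral !integral_indic// !setIT => fe.
by rewrite -[LHS]fineK ?fin_num_measure// fe fineK// fin_num_measure.
Qed.

Lemma cf_injective mu nu : cf mu =1 cf nu -> same_law mu nu.
Proof.
move=> munu B mB.
apply: (@measure_unique _ _ _ [set A : set R | exists x, A = `]x, +oo[%classic] (fun k => `]- k%:R, +oo[%classic) _ _ _ _ mu nu) => //.
- exact: RGenOInfty.measurableE.
- move=> _ _ [x ->] [y ->]; exists (Num.max x y).
  by apply/seteqP; split => z /=; rewrite !in_itv/= !andbT gt_max; [move=> [-> ->]|move/andP].
- by move=> k; exists (- k%:R).
- rewrite -subTset => x _; exists (Num.bound `|x|) => //=; rewrite in_itv/= andbT ltrNl.
  by rewrite (@le_lt_trans _ _ `|(- x : R)|) ?ler_norm// normrN; exact: (@archi_boundP R `|x| (normr_ge0 (x : R))).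
- by move=> _ [x ->]; exact: eq_cf_ray.
- move=> k; apply: le_lt_trans (probability_le1 mu _) (ltry _); exact: measurable_itv.
Qed.

End characteristic_function_injective.

(** * Convolution semigroups *)

Section convolution_semigroups.
Context {R : realType}.
Implicit Types (p q : R -> probability R R) (mu nu : probability R R) (u t : R).

Lemma continuous_Rintegral_bounded (d : measure_display) (S : measurableType d)
    (P : probability S R) (f : R -> S -> R) (M : R) :
  (forall u, measurable_fun setT (f u)) -> (forall u x, `|f u x| <= M) ->
  (forall x, continuous (f ^~ x)) -> continuous (fun u => \int[P]_x f u x).
Proof.
move=> mf fM cf u.
apply: (@continuity_under_integral _ _ _ P f setT measurableT (u - 1) (u + 1) _ _ (cst M)).
- by move=> x _; exact: bounded_integrable.
- by apply: aeW => x _ y _; exact: cf.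
- by apply: (@bounded_integrable _ _ _ P _ `|M|).
- by move=> x _; apply: aeW => y _; exact: fM.
- by rewrite inE/= in_itv/=; lra.
Qed.

Lemma continuous_Re_cf mu : continuous (fun u => complex.Re (cf mu u)).
Proof.
apply: (@continuous_Rintegral_bounded _ _ mu (fun u x => cos (u * x)) 1).
- exact: measurable_cosM.
- by move=> u x; exact: normr_cos_le1.
- move=> x u; apply: continuous_comp; last exact: continuous_cos.
  exact: mulrr_continuous.
Qed.

Lemma continuous_Im_cf mu : continuous (fun u => complex.Im (cf mu u)).
Proof.
apply: (@continuous_Rintegral_bounded _ _ mu (fun u x => sin (u * x)) 1).
- exact: measurable_sinM.
- by move=> u x; exact: normr_sin_le1.
- move=> x u; apply: continuous_comp; last exact: continuous_sin.
  exact: mulrr_continuous.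
Qed.

Lemma weak_cvg_dirac0_Rintegral p (f : R -> R) : weak_cvg 0^'+ p (\d_(0 : R)) ->
  continuous f -> (exists M, forall x, `|f x| <= M) ->
  \int[p t]_x f x @[t --> 0^'+] --> f 0.
Proof.
move=> pw cf [M fM]; have mf := continuous_measurable_fun cf.
have := pw _ cf (ex_intro _ M fM).
rewrite integral_dirac//=; last exact/measurable_EFinP.
rewrite diracT mul1e => h; apply: fine_cvg; exact: h.
Qed.

Variable p : R -> probability R R.
Hypothesis sg : convolution_semigroup p.

Lemma semigroup_Re_cvg u : complex.Re (cf (p t) u) @[t --> 0^'+] --> (1 : R).
Proof.
have <- : cos (u * 0) = 1 :> R by rewrite mulr0 cos0.
apply: (@weak_cvg_dirac0_Rintegral p (fun x => cos (u * x)) (cs_cvg0 sg)).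
- by move=> x; apply: continuous_comp; [exact: mulrl_continuous|exact: continuous_cos].
- by exists 1 => x; exact: normr_cos_le1.
Qed.

Lemma semigroup_Im_cvg u : complex.Im (cf (p t) u) @[t --> 0^'+] --> (0 : R).
Proof.
have s0 : sin (u * 0) = 0 :> R by rewrite mulr0 sin0.
have := @weak_cvg_dirac0_Rintegral p (fun x => sin (u * x)) (cs_cvg0 sg).
rewrite s0; apply.
- by move=> x; apply: continuous_comp; [exact: mulrl_continuous|exact: continuous_sin].
- by exists 1 => x; exact: normr_sin_le1.
Qed.

Lemma cf_semigroupD s t u : 0 <= s -> 0 <= t ->
  cf (p (s + t)) u = cf (p s) u * cf (p t) u.
Proof. by move=> s0 t0; rewrite (cf_same_law (cs_add sg s0 t0)) cf_convolution. Qed.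

Lemma cf_semigroup0 u : cf (p 0) u = 1.
Proof. by rewrite (cf_same_law (cs_zero sg)) cf_dirac0. Qed.

Lemma cf_semigroupMn n t u : 0 <= t -> cf (p (t *+ n)) u = cf (p t) u ^+ n.
Proof.
move=> t0; elim: n => [|n IH]; first by rewrite mulr0n expr0 cf_semigroup0.
by rewrite mulrS cf_semigroupD ?mulrn_wge0// IH exprS.
Qed.

(** At small times the real part is close to 1, and the value at t is the n-th power of the value at
    t / n. *)
Lemma cf_semigroup_neq0 t u : 0 <= t -> cf (p t) u != 0.
Proof.
rewrite le_eqVlt => /orP[/eqP <-|t0]; first by rewrite cf_semigroup0 oner_eq0.
have := @cvgr_gt _ _ _ _ _ _ (semigroup_Re_cvg u) 0 ltr01.
move=> [e /= e0 he].
pose n := (Num.truncn (t / e)).+1.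
have tn0 : 0 < t / n%:R by rewrite divr_gt0.
have /he : ball_ Num.norm 0 e (t / n%:R).
  rewrite /ball_/= sub0r normrN gtr0_norm// ltr_pdivrMr// mulrC -ltr_pdivrMr//.
  exact: truncnS_gt.
move=> /(_ tn0) re.
have -> : t = (t / n%:R) *+ n by rewrite -mulr_natr divfK// pnatr_eq0.
rewrite cf_semigroupMn; last exact: ltW.
have {}re : 0 < complex.Re (cf (p (t / n%:R)) u) by [].
by apply: expf_neq0; apply: contraTneq re => ->; rewrite ltxx.
Qed.

End convolution_semigroups.

Section semigroup_uniqueness.
Context {R : realType}.

(* G takes finitely many values at n-th roots of unity. *)
Lemma root_of_unity_path_constant (G : R[i] -> R) (z : R -> R[i]) (n : nat) :
  (0 < n)%N -> (forall u, z u ^+ n = 1) -> continuous (G \o z) ->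
  forall a b, G (z a) = G (z b).
Proof.
move=> n0 zn cG a b; apply/eqP/negPn/negP => neq.
(* If the two values differed, these intermediate values would be pairwise distinct and all
   attained, giving n + 1 distinct roots of ['X^n - 1]. *)
have surj k : exists u, G (z u) = G (z a) + (G (z b) - G (z a)) / k.+1%:R.
  pose v := G (z a) + (G (z b) - G (z a)) / k.+1%:R.
  suff : exists u, G (z u) = v by [].
  have vb : Num.min (G (z a)) (G (z b)) <= v <= Num.max (G (z a)) (G (z b)).
    have k1 : 0 < (k.+1%:R : R)^-1 <= 1.
      by rewrite invr_gt0 ltr0n/= invf_le1// ler1n.
    rewrite /v; move: (k.+1%:R^-1) k1 => r /andP[r0 r1].
    rewrite ge_min le_max; case: (ltrgtP (G (z a)) (G (z b))) neq => // h _; nra.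
  have [ab|ba] := leP a b.
    by have [u _ uv] := IVT ab (continuous_subspaceT cG) vb; exists u.
  have [|u _ uv] := @IVT _ (G \o z) _ _ v (ltW ba) (continuous_subspaceT cG).
    by rewrite minC maxC.
  by exists u.
have [u uE] := choice surj.
pose s := [seq z (u k) | k <- iota 0 n.+1].
have us : uniq s.
  rewrite map_inj_uniq ?iota_uniq// => i j /(congr1 G); rewrite !uE => /addrI.
  have d0 : G (z b) - G (z a) != 0 by rewrite subr_eq0 eq_sym.
  by move=> /(mulfI d0)/invr_inj/eqP; rewrite eqr_nat eqSS => /eqP.
have p0 : ('X^n - 1 : {poly R[i]}) != 0 by rewrite -size_poly_eq0 size_XnsubC.
have rs : all (root ('X^n - 1)) s.
  by apply/allP => _ /mapP[k _ ->]; rewrite rootE !hornerE zn subrr.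
by have := max_poly_roots p0 rs us; rewrite size_XnsubC// size_map size_iota ltnn.
Qed.

(** Equal n-th powers determine f only up to a root of unity, but f / g is a continuous path among
    these roots that starts at 1. *)
Lemma eq_root_of_continuous (f g : R -> R[i]) n : (0 < n)%N ->
  continuous (fun u => complex.Re (f u)) -> continuous (fun u => complex.Im (f u)) ->
  continuous (fun u => complex.Re (g u)) -> continuous (fun u => complex.Im (g u)) ->
  (forall u, g u != 0) -> f 0 = g 0 -> (forall u, f u ^+ n = g u ^+ n) -> f =1 g.
Proof.
move=> n0 rf if_ rg ig g0 fg0 fgn u.
pose z u := f u / g u.
have zn v : z v ^+ n = 1 by rewrite /z expr_div_n fgn divff// expf_neq0.
pose N u := complex.Re (g u) ^+ 2 + complex.Im (g u) ^+ 2.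
have N0 v : N v != 0.
  have := g0 v; rewrite /N; case: (g v) => a b /=; rewrite eq_complex/=.
  by apply: contraNN; rewrite paddr_eq0 ?sqr_ge0// !sqrf_eq0.
have cN : continuous N.
  by move=> v; apply: cvgD; apply: cvgM; [exact: rg|exact: rg|exact: ig|exact: ig].
(* Writing out both parts of the quotient reduces its continuity to that of real functions. *)
have zE v : z v = Complex
  ((complex.Re (f v) * complex.Re (g v) + complex.Im (f v) * complex.Im (g v)) / N v)
  ((complex.Im (f v) * complex.Re (g v) - complex.Re (f v) * complex.Im (g v)) / N v).
  apply: (mulIf (g0 v)); rewrite /z divfK//.
  have := N0 v; rewrite /N; case: (f v) (g v) => [a b] [c e] /= ne.
  by congr Complex; field.
have rz : continuous (@complex.Re R \o z).
  have -> : @complex.Re R \o z = fun v =>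
    (complex.Re (f v) * complex.Re (g v) + complex.Im (f v) * complex.Im (g v)) / N v.
    by apply/funext => v /=; rewrite zE.
  move=> v; apply: cvgM; last by apply: cvgV => //; exact: cN.
  by apply: cvgD; apply: cvgM; [exact: rf|exact: rg|exact: if_|exact: ig].
have iz : continuous (@complex.Im R \o z).
  have -> : @complex.Im R \o z = fun v =>
    (complex.Im (f v) * complex.Re (g v) - complex.Re (f v) * complex.Im (g v)) / N v.
    by apply/funext => v /=; rewrite zE.
  move=> v; apply: cvgM; last by apply: cvgV => //; exact: cN.
  by apply: cvgB; apply: cvgM; [exact: if_|exact: rg|exact: rf|exact: ig].
have z1 : z 0 = 1 by rewrite /z fg0 divff.
have er := root_of_unity_path_constant n0 zn rz u 0.
have ei := root_of_unity_path_constant n0 zn iz u 0.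
have : z u = 1.
  by rewrite z1 in er ei; case: (z u) er ei => a b /= -> ->.
by rewrite /z => /(congr1 (fun w => w * g u)); rewrite divfK// mul1r.
Qed.

(** Time 1 gives the times 1 / (n + 1) by extraction of continuous roots, then all rationals by
    powers. Continuity is known only at 0 from the right, so t is approached by rationals [r n]
    above it and the factor at time [r n - t] is sent to 1. *)
Lemma semigroup_unique (p q : R -> probability R R) :
  convolution_semigroup p -> convolution_semigroup q ->
  same_law (p 1) (q 1) -> forall t, 0 <= t -> same_law (p t) (q t).
Proof.
move=> sp sq pq1.
have inv n u : cf (p n.+1%:R^-1) u = cf (q n.+1%:R^-1) u.
  have i0 : 0 <= (n.+1%:R : R)^-1 by rewrite invr_ge0.
  apply: (@eq_root_of_continuous _ _ n.+1 isT (@continuous_Re_cf _ _) (@continuous_Im_cf _ _)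
    (@continuous_Re_cf _ _) (@continuous_Im_cf _ _)).
  - by move=> v; exact: cf_semigroup_neq0.
  - by rewrite !cf0.
  - move=> v; rewrite -!cf_semigroupMn//.
    have -> : (n.+1%:R : R)^-1 *+ n.+1 = 1 by rewrite -[LHS]mulr_natr mulVf// pnatr_eq0.
    exact: cf_same_law.
have rat k n u : cf (p (k%:R / n.+1%:R)) u = cf (q (k%:R / n.+1%:R)) u.
  have i0 : 0 <= (n.+1%:R : R)^-1 by rewrite invr_ge0.
  by rewrite mulr_natl !cf_semigroupMn// inv.
move=> t t0; apply: cf_injective => u.
(* The successor of the truncation makes [r n] strictly larger than t, as the limit at [0^'+]
   requires. *)
pose r n : R := (Num.truncn (t * n.+1%:R)).+1%:R / n.+1%:R.
have rt n : 0 < r n - t <= n.+1%:R^-1.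
  have tn0 : 0 <= t * n.+1%:R by rewrite mulr_ge0.
  rewrite /r subr_gt0 ltr_pdivlMr// truncnS_gt/= lerBlDl -(ler_pM2r (ltr0Sn R n)).
  rewrite divfK ?pnatr_eq0// mulrDl mulVf ?pnatr_eq0// -natr1 lerD2r.
  by rewrite truncn_le.
have rt0 : r n - t @[n --> \oo] --> (0 : R).
  apply: (@squeeze_cvgr _ _ _ _ (fun=> 0) (fun n => n.+1%:R^-1)).
  - by apply: nearW => n; have /andP[/ltW -> ->] := rt n.
  - exact: cvg_cst.
  - exact: cvg_harmonic.
have sub (h : R -> R) (l : R) : h x @[x --> 0^'+] --> l -> h (r n - t) @[n --> \oo] --> l.
  move=> /cvg_at_rightP; apply; split => // n.
  by have /andP[] := rt n.
have E n : cf (p t) u * cf (p (r n - t)) u = cf (q t) u * cf (q (r n - t)) u.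
  have /andP[/ltW r0 _] := rt n.
  by rewrite -!cf_semigroupD// addrC subrK; exact: rat.
have Rp := sub _ _ (semigroup_Re_cvg sp u).
have Ip := sub _ _ (semigroup_Im_cvg sp u).
have Rq := sub _ _ (semigroup_Re_cvg sq u).
have Iq := sub _ _ (semigroup_Im_cvg sq u).
case: (cf (p t) u) (cf (q t) u) E => [a b] [c e] E.
have lim (x y : R) (f g : nat -> R) : f n @[n --> \oo] --> (1 : R) -> g n @[n --> \oo] --> (0 : R) ->
    x * f n + y * g n @[n --> \oo] --> x.
  move=> f1 g0; rewrite -[X in _ --> X]addr0 -[X in _ --> X + _]mulr1 -[X in _ --> _ + X](mulr0 y).
  by apply: cvgD; apply: cvgMr.
have e1 : (fun n => a * complex.Re (cf (p (r n - t)) u) + (- b) * complex.Im (cf (p (r n - t)) u)) =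
          (fun n => c * complex.Re (cf (q (r n - t)) u) + (- e) * complex.Im (cf (q (r n - t)) u)).
  by apply/funext => n; have := E n; case: (cf (p _) u) (cf (q _) u) => [? ?] [? ?] [/= + _]; rewrite !mulNr.
have e2 : (fun n => b * complex.Re (cf (p (r n - t)) u) + a * complex.Im (cf (p (r n - t)) u)) =
          (fun n => e * complex.Re (cf (q (r n - t)) u) + c * complex.Im (cf (q (r n - t)) u)).
  apply/funext => n; have := E n; case: (cf (p _) u) (cf (q _) u) => [? ?] [? ?] [/= _].
  by rewrite addrC => ->; rewrite addrC.
have l1 := lim a (- b) _ _ Rp Ip; rewrite e1 in l1.
have l2 := lim b a _ _ Rp Ip; rewrite e2 in l2.
have <- : c = a by apply: (cvg_unique _ (lim c (- e) _ _ Rq Iq) l1).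
have <- : e = b by apply: (cvg_unique _ (lim e c _ _ Rq Iq) l2).
by [].
Qed.

End semigroup_uniqueness.

(** * Independence *)

Section independence.
Context {R : realType} {d : measure_display} {Omega : measurableType d}.
Variable P : probability Omega R.

Definition pr (E : set Omega) : R := fine (P E).

Lemma prE E : measurable E -> P E = (pr E)%:E.
Proof. by move=> mE; rewrite /pr fineK// fin_num_measure. Qed.

Lemma prT : pr setT = 1.
Proof. by rewrite /pr (probability_setT P). Qed.

Lemma pr_ge0 E : 0 <= pr E.
Proof. exact: fine_ge0. Qed.

Lemma le_pr E F : measurable E -> measurable F -> E `<=` F -> pr E <= pr F.
Proof. by move=> mE mF EF; rewrite -lee_fin -!prE// le_measure// inE. Qed.

(** One product formula over the whole index suffices: the indices to be ignored are given
    [setT]. *)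
Definition fin_indep (I : finType) (Y : I -> Omega -> R) : Prop :=
  forall B : I -> set R, (forall i, measurable (B i)) ->
    pr (\bigcap_i (Y i @^-1` B i)) = \prod_i pr (Y i @^-1` B i).

Lemma bigcap_fintype_measurable d' (S : measurableType d') (I : finType) (D : set I) (E : I -> set S) :
  (forall i, measurable (E i)) -> measurable (\bigcap_(i in D) E i).
Proof. by move=> mE; apply: fin_bigcap_measurable => // i _. Qed.

Lemma bigcap_fintypeD1 (T : Type) (I : finType) (E : I -> set T) (i : I) :
  \bigcap_j E j = E i `&` \bigcap_(j in [set j | j != i]) E j.
Proof.
apply/seteqP; split=> [w h|w [h1 h2] j _]; first by split=> [|j _]; exact: h.
by have [->//|ji] := eqVneq j i; exact: h2.
Qed.

(** The pi-lambda argument, applied to one index at a time: the list s records the indices already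
    extended from [G k] to the sigma-algebra it generates. *)
Lemma pr_generated_indep (K : finType) (G : K -> set (set Omega)) :
  (forall k, G k `<=` measurable) -> (forall k, setI_closed (G k)) ->
  (forall k, G k setT) ->
  (forall E : K -> set Omega, (forall k, G k (E k)) ->
    pr (\bigcap_k E k) = \prod_k pr (E k)) ->
  forall E : K -> set Omega, (forall k, <<s G k >> (E k)) ->
    pr (\bigcap_k E k) = \prod_k pr (E k).
Proof.
move=> Gm GI GT GE.
have sGm k : <<s G k >> `<=` measurable.
  by apply: smallest_sub; [exact: sigma_algebra_measurable|exact: Gm].
suff H (s : seq K) : forall E : K -> set Omega, (forall k, k \in s -> <<s G k >> (E k)) ->
    (forall k, k \notin s -> G k (E k)) -> pr (\bigcap_k E k) = \prod_k pr (E k).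
  by move=> E sE; apply: (H (enum K)) => // k; rewrite mem_enum.
elim: s => [|k0 s IH] E sE GE_; first by apply: GE => k; exact: GE_.
have mE k : measurable (E k).
  have [ks|ks] := boolP (k \in k0 :: s); first by apply: (sGm k); exact: sE.
  by apply: (Gm k); exact: GE_.
have [k0s|k0s] := boolP (k0 \in s).
  apply: IH => k ks; first by apply: sE; rewrite inE ks orbT.
  by apply: GE_; rewrite inE negb_or ks andbT; apply: contraNneq ks => ->.
pose F := \bigcap_(k in [set k | k != k0]) E k.
have mF : measurable F by apply: bigcap_fintype_measurable.
pose c := \prod_(k | k != k0) pr (E k).
have c0 : 0 <= c by apply: prodr_ge0 => k _; exact: pr_ge0.
(* With the other events frozen, both sides of the product formula are finite measures of the event
   at k0, and they agree on the pi-system [G k0]. *)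
pose m1 : {measure set Omega -> \bar R} := mrestr P mF.
pose m2 : {measure set Omega -> \bar R} := mscale (NngNum c0) P.
have m12 A : G k0 A -> m1 A = m2 A.
  move=> GA; pose E' k := if k == k0 then A else E k.
  have mA : measurable A by exact: (Gm k0).
  have E'k k : k != k0 -> E' k = E k by rewrite /E' => /negbTE ->.
  have := IH E'; rewrite (bigcap_fintypeD1 _ k0) (bigD1 k0)//= (_ : E' k0 = A); last by rewrite /E' eqxx.
  rewrite (_ : \bigcap_(j in _) E' j = F); last by apply: eq_bigcapr => k; exact: E'k.
  rewrite (_ : \prod_(i | i != k0) _ = c); last by apply: eq_bigr => k /E'k ->.
  move=> h; rewrite /m1 /m2 /= /mrestr /mscale/= prE; last exact: measurableI.
  rewrite h ?prE//.
  - by rewrite -EFinM mulrC.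
  - move=> k ks; rewrite E'k; first by apply: sE; rewrite inE ks orbT.
    by apply: contraNneq k0s => <-.
  - move=> k ks; have [->|kk0] := eqVneq k k0; first by rewrite /E' eqxx.
    by rewrite E'k//; apply: GE_; rewrite inE negb_or kk0.
have : m1 (E k0) = m2 (E k0).
  apply: (@g_sigma_algebra_measure_unique _ _ _ (G k0) (Gm k0) (fun=> setT)) => //.
  - by rewrite bigcup_const//; exists 0%N.
  - by move=> _; rewrite /m1/= /mrestr (le_lt_trans (probability_le1 P _)) ?ltry//; exact: measurableI.
  - by apply: sE; rewrite inE eqxx.
rewrite /m1 /m2 /= /mrestr /mscale/= (bigcap_fintypeD1 _ k0) (bigD1 k0)//=.
rewrite !prE//; last exact: measurableI.
by rewrite -EFinM => -[->]; rewrite mulrC.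
Qed.

(** The map t sorts the indices into groups. Rectangles constraining only the group of k form a
    pi-system generating the information carried by that group. *)
Definition block (I K : finType) (t : I -> K) (Y : I -> Omega -> R) (k : K)
    : set (set Omega) :=
  [set E | exists B : I -> set R, [/\ forall i, measurable (B i),
     forall i, t i != k -> B i = setT & E = \bigcap_i (Y i @^-1` B i)]].

Section blocks.
Variables (I K : finType) (t : I -> K) (Y : I -> Omega -> R).
Hypotheses (mY : forall i, measurable_fun setT (Y i)) (indY : fin_indep Y).

Lemma block_measurable k : block t Y k `<=` measurable.
Proof.
move=> _ [B [mB _ ->]]; apply: bigcap_fintype_measurable => i.
by rewrite -[X in measurable X]setTI; exact: mY.
Qed.

Lemma measurable_fun_block i (k : K) : t i = k ->
  measurable_fun (setT : set (g_sigma_algebraType (block t Y k))) (Y i).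
Proof.
move=> tik _ B mB; rewrite setTI; apply: sub_sigma_algebra.
exists (fun j => if j == i then B else setT); split.
- by move=> j; case: ifP.
- by move=> j; case: (eqVneq j i) => // ->; rewrite tik eqxx.
- apply/seteqP; split=> [w h j _ /=|w /(_ i Logic.I)]; last by rewrite /= eqxx.
  by case: eqVneq => // ->.
Qed.

(** Functions of disjoint groups of independent variables are independent: on rectangles each index
    is constrained only through its own group, so the product regroups along t. *)
Lemma pr_block_indep (E : K -> set Omega) : (forall k, <<s block t Y k >> (E k)) ->
  pr (\bigcap_k E k) = \prod_k pr (E k).
Proof.
apply: pr_generated_indep.
- exact: block_measurable.
- move=> k _ _ [B [mB BT ->]] [C [mC CT ->]]; exists (fun i => B i `&` C i); split.
  + by move=> i; exact: measurableI.
  + by move=> i tik; rewrite BT// CT// setTI.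
  + apply/seteqP; split=> [w [h1 h2] i _|w h]; first by split; [exact: h1|exact: h2].
    by split=> i _; have [] := h i Logic.I.
- move=> k; exists (fun=> setT); split => //.
  by apply/seteqP; split=> // w _ i _.
- move=> {}E /choice[B BE].
  have mB k i : measurable (B k i) by have [] := BE k.
  have BT k i : t i != k -> B k i = setT by have [_ + _] := BE k; apply.
  have EE k : E k = \bigcap_i (Y i @^-1` B k i) by have [] := BE k.
  have -> : \bigcap_k E k = \bigcap_i (Y i @^-1` B (t i) i).
    apply/seteqP; split=> [w h i _|w h k _].
      by have := h (t i) Logic.I; rewrite EE; exact.
    rewrite EE => i _; have [<-|tik] := eqVneq (t i) k; first exact: h.
    by rewrite BT.
  rewrite indY// (partition_big t xpredT)//=; apply: eq_bigr => k _.
  rewrite EE indY// [RHS](bigID (fun i => t i == k))/= [X in _ * X]big1 ?mulr1.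
    by apply: eq_bigr => i /eqP ->.
  by move=> i tik; rewrite BT// preimage_setT prT.
Qed.

Lemma pr_block_indep_fun d' (S : measurableType d') (f : K -> Omega -> S) :
  (forall k, measurable_fun (setT : set (g_sigma_algebraType (block t Y k))) (f k)) ->
  forall B : K -> set S, (forall k, measurable (B k)) ->
    pr (\bigcap_k (f k @^-1` B k)) = \prod_k pr (f k @^-1` B k).
Proof.
move=> mf B mB; apply: pr_block_indep => k.
by have := mf k measurableT _ (mB k); rewrite setTI.
Qed.

Lemma fin_indep_sum :
  fin_indep (fun k w => \sum_(i | t i == k) Y i w).
Proof.
move=> B mB; apply: (@pr_block_indep_fun _ _ (fun k w => \sum_(i | t i == k) Y i w)) => // k.
rewrite (_ : (fun w => _) = (fun w => \sum_(i <- [seq i <- enum I | t i == k]) Y i w)); last first.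
  by apply/funext => w; rewrite big_filter big_enum_cond.
have : {in [seq i <- enum I | t i == k], forall i, t i = k}.
  by move=> i; rewrite mem_filter => /andP[/eqP].
elim: [seq _ <- _ | _] => [_|i s IH h].
  by under eq_fun do rewrite big_nil; exact: measurable_cst.
under eq_fun do rewrite big_cons.
apply: measurable_funD; first by apply: measurable_fun_block; apply: h; rewrite inE eqxx.
by apply: IH => j js; apply: h; rewrite inE js orbT.
Qed.

End blocks.

Lemma measurable_fun_sumf d' (S : measurableType d') (I : Type) (s : seq I) (p : pred I) (Y : I -> S -> R) :
  (forall i, measurable_fun setT (Y i)) ->
  measurable_fun setT (fun w => \sum_(i <- s | p i) Y i w).
Proof.
move=> mY; elim: s => [|i s IH].
  by under eq_fun do rewrite big_nil; exact: measurable_cst.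
under eq_fun do rewrite big_cons.
by case: (p i) => //; exact: measurable_funD.
Qed.

Lemma fin_indep_reindex (I J : finType) (h : J -> I) (Y : I -> Omega -> R) :
  (forall i, measurable_fun setT (Y i)) -> injective h ->
  fin_indep Y -> fin_indep (Y \o h).
Proof.
move=> mY hi iY B mB.
(* Injectivity leaves a single constraint on the image of h; off the image the intersection is
   empty, hence [setT], with factor 1. *)
pose C i := \bigcap_(j in [set j | h j == i]) B j.
have mC i : measurable (C i) by exact: bigcap_fintype_measurable.
have Ch j : C (h j) = B j.
  apply/seteqP; split=> [x /(_ j)|x Bx j' /= /eqP/hi -> //]; apply; exact/eqP.
have := iY C mC.
have -> : \bigcap_i (Y i @^-1` C i) = \bigcap_j ((Y \o h) j @^-1` B j).
  apply/seteqP; split=> [w H j _|w H i _ j /= /eqP <-]; last exact: (H j Logic.I).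
  by rewrite /preimage/= -Ch; exact: H.
move=> ->; rewrite (bigID (fun i => i \in h @: predT))/= [X in _ * X]big1 ?mulr1; last first.
  move=> i ih; rewrite (_ : Y i @^-1` C i = setT) ?prT//; apply/seteqP; split=> // w _ j /= /eqP hji.
  by move: ih; rewrite -hji imset_f.
rewrite big_imset/=; last by move=> ? ? _ _; exact: hi.
by apply: eq_bigr => j _; rewrite Ch.
Qed.

Definition mfun_of d' (S : measurableType d') (f : Omega -> S)
    (mf : measurable_fun setT f) : {mfun Omega >-> S} :=
  HB.pack f (isMeasurableFun.Build _ _ _ _ f mf).

Definition cfv (X : Omega -> R) (u : R) : R[i] :=
  Complex (\int[P]_w cos (u * X w)) (\int[P]_w sin (u * X w)).

Lemma cf_law (X : {RV P >-> R}) u : cf (law X) u = cfv X u.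
Proof.
have mc := measurable_cosM u; have ms := measurable_sinM u.
rewrite /cf /cfv /law; congr Complex; congr fine; rewrite integral_distribution//;
  try exact/measurable_EFinP.
- apply: (@bounded_integrable _ _ _ P (fun w => cos (u * X w)) 1) => [|x]; last exact: normr_cos_le1.
  exact: (measurableT_comp mc).
- apply: (@bounded_integrable _ _ _ P (fun w => sin (u * X w)) 1) => [|x]; last exact: normr_sin_le1.
  exact: (measurableT_comp ms).
Qed.

Lemma same_law_convolution (X Y Z : {RV P >-> R}) :
  (forall w, Z w = X w + Y w) ->
  (forall A B, measurable A -> measurable B ->
    pr (X @^-1` A `&` Y @^-1` B) = pr (X @^-1` A) * pr (Y @^-1` B)) ->
  same_law (law Z) (convolution (law X) (law Y)).
Proof.
move=> ZE ind B mB.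
have mXY : measurable_fun setT (fun w => (X w, Y w)) by exact: measurable_fun_pair.
have mpre (W : {RV P >-> R}) A : measurable A -> measurable (W @^-1` A).
  by move=> mA; rewrite -[X in measurable X]setTI; exact: (measurable_funP W).
have := @product_measure_unique _ _ _ _ _ (law X) (law Y) (distribution P (mfun_of mXY)) _ (sum_pair @^-1` B).
move=> h; apply: esym; apply: etrans (h _ _) _.
- move=> A C mA mC.
  suff : P (X @^-1` A `&` Y @^-1` C) = (P (X @^-1` A) * P (Y @^-1` C))%E by [].
  by rewrite !prE ?ind//; [exact: mpre|exact: mpre|apply: measurableI; exact: mpre].
- by rewrite -[X in measurable X]setTI; exact: measurable_sum_pair.
- rewrite /law /distribution /pushforward/=; congr (P _).
  by apply/seteqP; split=> w; rewrite /preimage/= ZE.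
Qed.

Lemma cfvD (X Y : Omega -> R) u : measurable_fun setT X -> measurable_fun setT Y ->
  (forall A B, measurable A -> measurable B ->
    pr (X @^-1` A `&` Y @^-1` B) = pr (X @^-1` A) * pr (Y @^-1` B)) ->
  cfv (fun w => X w + Y w) u = cfv X u * cfv Y u.
Proof.
move=> mX mY ind; have mZ := measurable_funD mX mY.
have sl := @same_law_convolution (mfun_of mX) (mfun_of mY) (mfun_of mZ) (fun=> erefl) ind.
have := cf_same_law sl u; rewrite cf_convolution.
by rewrite (@cf_law (mfun_of mX)) (@cf_law (mfun_of mY)) (@cf_law (mfun_of mZ)).
Qed.

Lemma cfv_cst0 u : cfv (fun=> 0) u = 1.
Proof.
by rewrite /cfv !mulr0 cos0 sin0 !Rintegral_probability_cst.
Qed.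

Lemma cfv_sum (I : finType) (Y : I -> Omega -> R) (s : seq I) u :
  (forall i, measurable_fun setT (Y i)) -> fin_indep Y -> uniq s ->
  cfv (fun w => \sum_(i <- s) Y i w) u = \prod_(i <- s) cfv (Y i) u.
Proof.
move=> mY iY; elim: s => [_|i s IH /= /andP[iNs us]].
  by under eq_fun do rewrite big_nil; rewrite big_nil cfv_cst0.
under eq_fun do rewrite big_cons.
rewrite big_cons -IH//; apply: cfvD => //; first exact: measurable_fun_sumf.
move=> A B mA mB.
(* Two groups, the index i alone and all the others, separate the head from the tail sum. *)
pose t j := j == i.
pose f b := if b then Y i else fun w => \sum_(j <- s) Y j w.
have mf (b : bool) : measurable_fun (setT : set (g_sigma_algebraType (block t Y b))) (f b).
  case: b; first by apply: measurable_fun_block => //; rewrite /t eqxx.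
  rewrite /f; elim: s iNs {IH us f} => [_|j s IH].
    by under eq_fun do rewrite big_nil; exact: measurable_cst.
  rewrite inE negb_or => /andP[ij iNs]; under eq_fun do rewrite big_cons.
  apply: measurable_funD; last exact: IH.
  by apply: measurable_fun_block => //; rewrite /t eq_sym (negbTE ij).
have := @pr_block_indep_fun _ _ _ _ mY iY _ _ f mf (fun b => if b then A else B).
rewrite big_bool/= (_ : \bigcap_k _ = Y i @^-1` A `&` (fun w => \sum_(j <- s) Y j w) @^-1` B).
  by apply; case.
apply/seteqP; split=> [w h|w [h1 h2] [] _ //].
by split; [exact: (h true Logic.I)|exact: (h false Logic.I)].
Qed.

Lemma mutually_independent_fin (I : finType) (Y : I -> {RV P >-> R}) :
  mutually_independent Y <-> fin_indep (fun i => Y i : Omega -> R).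
Proof.
have mpre (W : {RV P >-> R}) A : measurable A -> measurable (W @^-1` A).
  by move=> mA; rewrite -[X in measurable X]setTI; exact: (measurable_funP W).
have prodE (J : Type) (s : seq J) (p : pred J) (E : J -> set Omega) : (forall j, measurable (E j)) ->
    (\big[*%E/1%E]_(j <- s | p j) P (E j) = (\prod_(j <- s | p j) pr (E j))%:E)%E.
  move=> mE; elim/big_rec2: _ => // j x y _ ->; rewrite prE// -EFinM//.
split=> [mi B mB|fi J B mB].
  have := mi [fset i | i in I]%fset B mB; rewrite prodE; last by move=> i; exact: mpre.
  rewrite (_ : \bigcap_(i in _) _ = \bigcap_i (Y i @^-1` B i)); last first.
    by apply/seteqP; split=> w h i _; apply: h; rewrite /= ?inE.
  rewrite prE; last by apply: bigcap_fintype_measurable => i; exact: mpre.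
  by move=> [->]; rewrite big_uniq ?fset_uniq//=; apply: eq_bigl => i; rewrite !inE.
pose C i := if i \in J then B i else setT.
have mC i : measurable (C i) by rewrite /C; case: ifP.
have := fi C mC.
have -> : \bigcap_i (Y i @^-1` C i) = \bigcap_(i in [set` J]) (Y i @^-1` B i).
  apply/seteqP; split=> w h i.
    by move=> iJ; have := h i Logic.I; rewrite /C iJ.
  by move=> _; rewrite /C /preimage/=; case: ifPn => // iJ; exact: h.
rewrite prodE; last by move=> i; exact: mpre.
rewrite prE; last by apply: fin_bigcap_measurable => // i _; exact: mpre.
move=> ->; congr EFin.
rewrite (bigID (fun i => i \in J))/= [X in _ * X]big1 ?mulr1; last first.
  by move=> i iJ; rewrite /C (negbTE iJ) preimage_setT prT.
rewrite big_uniq ?fset_uniq//=; apply: eq_bigr => i iJ.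
by rewrite /C iJ.
Qed.

End independence.

Section joint_law.
Context {R : realType}.

Definition cylinder_sets (I : Type) (D : set I) : set (set (I -> R)) :=
  [set E | exists i (B : set R), [/\ D i, measurable B & E = [set f | B (f i)]]].

(** Events constraining finitely many coordinates of D form a pi-system that generates the cylinder
    sigma-algebra. *)
Lemma joint_law_unique (I : eqType) (D : set I)
    (d : measure_display) (Omega : measurableType d) (P : probability Omega R)
    (d' : measure_display) (Omega' : measurableType d') (P' : probability Omega' R)
    (X : I -> Omega -> R) (Y : I -> Omega' -> R) :
  (forall i, measurable_fun setT (X i)) -> (forall i, measurable_fun setT (Y i)) ->
  (forall (s : seq I) (B : I -> set R), (forall i, i \in s -> D i) ->
    (forall i, measurable (B i)) ->
    P (\bigcap_(i in [set` s]) (X i @^-1` B i)) =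
    P' (\bigcap_(i in [set` s]) (Y i @^-1` B i))) ->
  forall E, <<s cylinder_sets D >> E ->
    P [set w | E (X ^~ w)] = P' [set w | E (Y ^~ w)].
Proof.
move=> mX mY XY E sE.
pose G : set (set (I -> R)) := [set E | exists (s : seq I) (B : I -> set R),
  [/\ forall i, i \in s -> D i, forall i, measurable (B i) &
     E = [set f | forall i, i \in s -> B i (f i)]]].
have GE : <<s G >> E.
  apply: sub_sigma_algebra2 sE => _ [i [B [Di mB ->]]].
  exists [:: i], (fun=> B); split=> //.
    by move=> j; rewrite inE => /eqP ->.
  by apply/seteqP; split=> f /= => [Bf j|]; [rewrite inE => /eqP -> |apply; rewrite inE].
have GI : setI_closed G.
  move=> _ _ [s [B [sD mB ->]]] [s' [B' [sD' mB' ->]]].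
  exists (s ++ s'), (fun i => (if i \in s then B i else setT) `&` (if i \in s' then B' i else setT)).
  split.
  - by move=> i; rewrite mem_cat => /orP[]; [exact: sD|exact: sD'].
  - by move=> i; apply: measurableI; case: ifP.
  - apply/seteqP; split=> [f [h h'] i _|f h]; first by split; case: ifP => //; [exact: h|exact: h'].
    by split=> i is_; have := h i; rewrite mem_cat is_ ?orbT => /(_ isT)[].
pose S := g_sigma_algebraType G.
have GT : G setT.
  by exists [::], (fun=> setT); split=> //; apply/seteqP; split.
have mf d1 (W : measurableType d1) (Z : I -> W -> R) : (forall i, measurable_fun setT (Z i)) ->
    measurable_fun setT (fun w => (Z ^~ w) : S).
  move=> mZ; apply: (@measurability _ _ _ S _ _ G) => //.
  move=> _ [_ [s [B [_ mB ->]] <-]]; rewrite setTI.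
  rewrite (_ : _ @^-1` _ = \bigcap_(i in [set` s]) (Z i @^-1` B i))//.
  apply: fin_bigcap_measurable => [|i _]; first exact: finite_seq.
  by rewrite -[X in measurable X]setTI; exact: mZ.
have GES : @measurable _ S E by [].
apply: (@g_sigma_algebra_measure_unique _ R S G _ (fun=> setT) _ _
   (distribution P (mfun_of (mf _ _ _ mX))) (distribution P' (mfun_of (mf _ _ _ mY))) GI) => //.
- by move=> A GA; exact: sub_sigma_algebra.
- by rewrite bigcup_const//; exists 0%N.
- by move=> _ [s [B [sD mB ->]]]; exact: XY.
- by move=> k; rewrite (le_lt_trans (probability_le1 _ _)) ?ltry.
Qed.

End joint_law.

Section subset_sums.
Context {V : nmodType} {I : finType}.
Implicit Types (J : {set I}) (F : {set I} -> V).

Lemma big_subset_cons (i : I) (s : seq I) F : i \notin s ->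
  \sum_(J : {set I} | J \subset i :: s) F J =
  \sum_(J : {set I} | J \subset s) (F J + F (i |: J)%SET).
Proof.
move=> iNs; rewrite (bigID (fun J => i \in J))/= addrC big_split/=; congr (_ + _).
  apply: eq_bigl => J; apply/andP/idP => [[Jis iJ]|Js].
    apply/fintype.subsetP => j jJ; have := fintype.subsetP Jis j jJ; rewrite inE => /orP[/eqP ji|//].
    by move: iJ; rewrite -ji jJ.
  split; first by apply: (fintype.subset_trans Js); apply/fintype.subsetP => j js; rewrite inE js orbT.
  by apply: contra iNs; exact: (fintype.subsetP Js).
rewrite (reindex_onto (fun J => i |: J)%SET (fun J => J :\ i)%SET)/=; last first.
  by move=> J /andP[_ iJ]; rewrite finset.setD1K.
apply: eq_bigl => J; rewrite setU11 andbT; apply/andP/idP => [[/fintype.subsetP JS /eqP JE]|/fintype.subsetP Js].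
  apply/fintype.subsetP => j jJ; have := JS j; rewrite !inE jJ orbT => /(_ isT)/orP[/eqP ji|//].
  by move: jJ; rewrite -JE ji !inE eqxx.
have iJ : i \notin J by apply: contra iNs; exact: Js.
split; last by rewrite finset.setU1K.
by apply/fintype.subsetP => j; rewrite !inE => /orP[->//|/Js ->]; rewrite orbT.
Qed.

Lemma big_subset_nil F : \sum_(J : {set I} | J \subset [::]) F J = F (finset.set0).
Proof.
rewrite (big_pred1 finset.set0)// => J; apply/idP/eqP => [/fintype.subsetP h|->].
  by apply/finset.setP => j; rewrite inE; apply/negbTE/negP => /h.
by apply/fintype.subsetP => j; rewrite inE.
Qed.

End subset_sums.

(** * Increments *)

Section inclusion_exclusion.
Context {R : realType} {T : Type}.
Implicit Types (x : set T -> R) (U V C : set T) (s : seq (set T)).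

(** Inclusion-exclusion in recursive form: removing one more set V subtracts the increment over the
    trace on V. Inductions on the list replace manipulations of the alternating sum. *)
Fixpoint list_increment x U s : R :=
  if s is V :: s' then list_increment x U s' - list_increment x (U `&` V) s' else x U.

Definition list_diff U s : set T := [set y | U y /\ forall V, V \in s -> ~ V y].

Lemma list_increment_subsets x (I : finType) (U : I -> set T) (s : seq I) U0 : uniq s ->
  list_increment x U0 [seq U i | i <- s] =
  \sum_(J : {set I} | J \subset s) (-1) ^+ #|J| * x (U0 `&` \bigcap_(j in [set j | j \in J]) U j).
Proof.
elim: s U0 => [|i s IH] U0 /=.
  rewrite big_subset_nil cards0 expr0 mul1r => _; congr x.
  by apply/seteqP; split=> y; [split=> // j /=; rewrite inE|case].
move=> /andP[iNs us]; rewrite big_subset_cons// !IH// -sumrB; apply: eq_bigr => J Js.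
have iJ : i \notin J by apply: contra iNs; exact: (fintype.subsetP Js).
rewrite cardsU1 iJ exprS mulN1r mulNr; congr (_ - _ * x _).
apply/seteqP; split=> y.
  move=> [[U0y Uiy] h]; split=> // j /=; rewrite !inE => /orP[/eqP ->//|]; exact: h.
move=> [U0y h]; split; first by split=> //; apply: h => /=; rewrite !inE eqxx.
by move=> j /= jJ; apply: h => /=; rewrite !inE jJ orbT.
Qed.

End inclusion_exclusion.

Section increments.
Context {R : realType} {d : measure_display} {Omega : measurableType d}.
Context {P : probability Omega R} {T : topologicalType}.
Variables (A : set (set T)) (X : set T -> {RV P >-> R}).
Hypothesis A_setI : forall U V, A U -> A V -> A (U `&` V).
Hypothesis A0 : A set0.

Lemma mfun_sumE (I : Type) (s : seq I) (p : pred I) (F : I -> {mfun Omega >-> R}) w :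
  (\sum_(i <- s | p i) F i) w = \sum_(i <- s | p i) F i w.
Proof. by elim/big_rec2: _ => //= i y f _ <-. Qed.

Lemma mfun_oppE (f : {mfun Omega >-> R}) w : (- f) w = - f w.
Proof. by []. Qed.

Lemma mfun_signM n (f : {mfun Omega >-> R}) w : ((-1) ^+ n * f) w = (-1) ^+ n * f w.
Proof.
elim: n => [|n IH]; first by rewrite !expr0 !mul1r.
by rewrite !exprS -!mulrA !mulN1r mfun_oppE IH.
Qed.

(** The sum graded by cardinality is regrouped over all subsets; the empty subset supplies the
    leading term. *)
Lemma inclusion_exclusionE n U0 (U : 'I_n -> set T) w :
  inclusion_exclusion X U0 U w =
  list_increment (fun V => X V w) U0 [seq U i | i <- enum 'I_n].
Proof.
rewrite list_increment_subsets ?enum_uniq//.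
rewrite (eq_bigl xpredT); last first.
  by move=> J; apply/fintype.subsetP => j _; rewrite mem_enum.
pose G (i : nat) (J : {set 'I_n}) : {mfun Omega >-> R} := (-1) ^+ i.-1 *
  (X (U0 `&` \bigcap_(j in [set j : 'I_n | j \in J]) U j) : {mfun Omega >-> R}).
pose F (i : nat) : {mfun Omega >-> R} := \sum_(J : {set 'I_n} | #|J| == i) G i J.
have -> : inclusion_exclusion X U0 U w =
    (X U0 w : R) - \sum_(1 <= i < n.+1) \sum_(J : {set 'I_n} | #|J| == i) (G i J w : R).
  transitivity ((X U0 w : R) - (\sum_(1 <= i < n.+1) F i : {mfun Omega >-> R}) w) => //.
  congr (_ - _); apply: etrans (mfun_sumE _ _ _ _) _; apply: eq_bigr => i _; exact: mfun_sumE.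
rewrite (bigD1 finset.set0)//= cards0 expr0 mul1r; congr (X _ w + _).
  by apply/seteqP; split=> y; [move=> ?; split=> // j /=; rewrite inE|case].
rewrite (big_morph (fun z : R => - z) (@opprD R) (@oppr0 R)).
under eq_bigr do rewrite (big_morph (fun z : R => - z) (@opprD R) (@oppr0 R)).
rewrite (exchange_big_dep xpredT)//= [RHS]big_mkcond/=.
apply: eq_bigr => J _; under eq_bigl do rewrite eq_sym.
have Jn : (#|J| <= n)%N by rewrite -[X in (_ <= X)%N]card_ord max_card.
rewrite big_nat1_eq -card_gt0 ltnS Jn andbT.
case: ifP => //; case: #|J| => // k _ /=; rewrite exprS mulN1r mulNr; congr (- _).
exact: mfun_signM.
Qed.

Definition list_represents (C U0 : set T) (s : seq (set T)) : Prop :=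
  [/\ A U0, forall V, V \in s -> A V & C = list_diff U0 s].

Lemma class_C_list C : class_C A C <-> exists U0 s, list_represents C U0 s.
Proof.
split=> [[n [U0 [U [AU0 AU ->]]]]|[U0 [s [AU0 As ->]]]].
  exists U0, [seq U i | i <- enum 'I_n]; split=> //.
    by move=> _ /mapP[i _ ->].
  apply/seteqP; split=> y [U0y h]; split=> //.
    by move=> _ /mapP[i _ ->] Uiy; apply: h; exists i.
  by move=> [i _ Uiy]; apply: (h (U i)) => //; rewrite map_f// mem_enum.
exists (size s), U0, (fun i => nth set0 s i); split=> //.
  by move=> i; apply: As; rewrite mem_nth.
apply/seteqP; split=> y [U0y h]; split=> //.
  by move=> [i _] /h; apply; rewrite mem_nth.
move=> V Vs Vy; apply: h; have is_ : (index V s < size s)%N by rewrite index_mem.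
by exists (Ordinal is_) => //=; rewrite nth_index.
Qed.

Hypothesis defX : definite_increments A X.

Lemma increment_represents C n U0 (U : 'I_n -> set T) : represents A C U0 U ->
  increment A X C =1 inclusion_exclusion X U0 U.
Proof.
move=> rep; rewrite /increment; case: xgetP => [Y _ [k [V0 [V [rep' ->]]]]|].
  by have [h _ _] := defX; exact: (h _ _ _ _ _ _ _ rep' rep).
by move=> /(_ (inclusion_exclusion X U0 U))[]; exists n, U0, U.
Qed.

Lemma increment_list C U0 s w : list_represents C U0 s ->
  increment A X C w = list_increment (fun V => X V w) U0 s.
Proof.
move=> [AU0 As CE].
have rep : represents A C U0 (fun i : 'I_(size s) => nth set0 s i).
  split=> //; first by move=> i; apply: As; rewrite mem_nth.
  rewrite CE; apply/seteqP; split=> y [U0y h]; split=> //.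
    by move=> [i _] /h; apply; rewrite mem_nth.
  move=> V Vs Vy; apply: h; have is_ : (index V s < size s)%N by rewrite index_mem.
  by exists (Ordinal is_) => //=; rewrite nth_index.
rewrite (increment_represents rep) inclusion_exclusionE; congr list_increment.
apply: (@eq_from_nth _ set0); first by rewrite size_map size_enum_ord.
move=> i; rewrite size_map size_enum_ord => is_.
by rewrite (nth_map (Ordinal is_)) ?size_enum_ord//= nth_enum_ord.
Qed.

Lemma increment_A U w : A U -> increment A X U w = X U w.
Proof.
move=> AU; rewrite (@increment_list U U [::])//; split=> //.
by apply/seteqP; split=> y; [split|case].
Qed.

Lemma class_C_A U : A U -> class_C A U.
Proof.
move=> AU; apply/class_C_list; exists U, [::]; split=> //.
by apply/seteqP; split=> y; [split|case].
Qed.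

Lemma class_C0 : class_C A set0.
Proof. exact: class_C_A. Qed.

Lemma increment0 w : increment A X set0 w = 0.
Proof. by have [] := defX. Qed.

Lemma class_C_setI C V : class_C A C -> A V -> class_C A (C `&` V).
Proof.
move=> /class_C_list[U0 [s [AU0 As ->]]] AV; apply/class_C_list.
exists (U0 `&` V), s; split=> //; first exact: A_setI.
by apply/seteqP; split=> y; [move=> [[? ?] ?]|move=> [[? ?] ?]].
Qed.

Lemma class_C_setD C V : class_C A C -> A V -> class_C A (C `\` V).
Proof.
move=> /class_C_list[U0 [s [AU0 As ->]]] AV; apply/class_C_list.
exists U0, (V :: s); split=> //; first by move=> W; rewrite inE => /orP[/eqP ->//|]; exact: As.
apply/seteqP; split=> y.
  by move=> [[? h] ?]; split=> // W; rewrite inE => /orP[/eqP ->//|]; exact: h.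
move=> [? h]; split; last by apply: h; rewrite inE eqxx.
by split=> // W Ws; apply: h; rewrite inE Ws orbT.
Qed.

(** Cutting by a member of [A] is one unfolding of [list_increment]; every finite additivity used
    later is obtained by repeating this cut. *)
Lemma increment_split C V w : class_C A C -> A V ->
  increment A X C w = increment A X (C `&` V) w + increment A X (C `\` V) w.
Proof.
move=> /class_C_list[U0 [s [AU0 As CE]]] AV.
rewrite (@increment_list C U0 s)//.
rewrite (@increment_list (C `&` V) (U0 `&` V) s); last first.
  split=> //; first exact: A_setI.
  by rewrite CE; apply/seteqP; split=> y; [move=> [[? ?] ?]|move=> [[? ?] ?]].
rewrite (@increment_list (C `\` V) U0 (V :: s)) /=; last first.
  split=> //; first by move=> W; rewrite inE => /orP[/eqP ->//|]; exact: As.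
  rewrite CE; apply/seteqP; split=> y.
    by move=> [[? h] ?]; split=> // W; rewrite inE => /orP[/eqP ->//|]; exact: h.
  move=> [? h]; split; last by apply: h; rewrite inE eqxx.
  by split=> // W Ws; apply: h; rewrite inE Ws orbT.
by rewrite addrCA subrr addr0.
Qed.

(** The sets V i with i in s cut the space into these pieces. A piece alone may fail to be in
    [class_C], for instance the one outside every V i, so it is always intersected with a set of the
    class. *)
Definition atom (I : finType) (V : I -> set T) (s : seq I) (J : {set I}) : set T :=
  [set y | forall i, i \in s -> (i \in J) <-> V i y].

Lemma atom_nil (I : finType) (V : I -> set T) J : atom V [::] J = setT.
Proof. by apply/seteqP; split. Qed.

Lemma atom_consN (I : finType) (V : I -> set T) i s (J : {set I}) : i \notin J ->
  atom V (i :: s) J = atom V s J `\` V i.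
Proof.
move=> iJ; apply/seteqP; split=> y.
  move=> h; split; first by move=> j js; apply: h; rewrite inE js orbT.
  by move=> Viy; move: iJ; rewrite (h i _).2// inE eqxx.
move=> [h Viy] j; rewrite inE => /orP[/eqP ->|]; last exact: h.
by split=> // iJ'; move: iJ; rewrite iJ'.
Qed.

Lemma atom_consU (I : finType) (V : I -> set T) i s (J : {set I}) : i \notin s ->
  atom V (i :: s) (i |: J)%SET = atom V s J `&` V i.
Proof.
move=> iNs; apply/seteqP; split=> y.
  move=> h; split; last by apply: (h i _).1; rewrite !inE eqxx.
  move=> j js; have := h j; rewrite !inE js orbT => /(_ isT).
  by have [ji|//] := eqVneq j i; move: iNs; rewrite -ji js.
move=> [h Viy] j; rewrite !inE => /orP[/eqP ->|js]; first by rewrite eqxx.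
rewrite (_ : (j == i) = false); first exact: h.
by apply/negbTE; apply: contraNneq iNs => <-.
Qed.

Lemma class_C_atom (I : finType) (V : I -> set T) s J C : (forall i, A (V i)) ->
  class_C A C -> class_C A (C `&` atom V s J).
Proof.
move=> AV CC; elim: s => [|i s IH]; first by rewrite atom_nil setIT.
rewrite (_ : C `&` _ = if i \in J then C `&` atom V s J `&` V i else C `&` atom V s J `\` V i).
  by case: ifP => _; [exact: class_C_setI|exact: class_C_setD].
case: ifPn => iJ; last by rewrite atom_consN// setIDA.
apply/seteqP; split=> y.
  move=> [Cy h]; split; last by apply: (h i _).1 => //; rewrite inE eqxx.
  by split=> // j js; apply: h; rewrite inE js orbT.
move=> [[Cy h] Viy]; split=> // j; rewrite inE => /orP[/eqP ->//|]; exact: h.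
Qed.

Lemma increment_atoms (I : finType) (V : I -> set T) s C w : (forall i, A (V i)) ->
  class_C A C -> uniq s ->
  increment A X C w = \sum_(J : {set I} | J \subset s) increment A X (C `&` atom V s J) w.
Proof.
move=> AV CC; elim: s => [|i s IH] /=.
  by rewrite big_subset_nil atom_nil setIT.
move=> /andP[iNs us]; rewrite IH// big_subset_cons//; apply: eq_bigr => J Js.
have iJ : i \notin J by apply: contra iNs; exact: (fintype.subsetP Js).
rewrite atom_consN// atom_consU// setIDA setIA addrC.
by apply: increment_split => //; exact: class_C_atom.
Qed.

End increments.

Section decomposition.
Context {T : topologicalType}.
Variable A : set (set T).
Hypothesis A_setI : forall U V, A U -> A V -> A (U `&` V).
Hypothesis A0 : A set0.

(** All members of [A] occurring in chosen representations of the C k are pooled; two points of one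
    atom then lie in the same sets C k. *)
Lemma common_atoms (K : finType) (C : K -> set T) : (forall k, class_C A (C k)) ->
  exists (I : finType) (V : I -> set T), (forall i, A (V i)) /\
    forall k (J : {set I}), atom V (enum I) J `<=` C k \/ atom V (enum I) J `&` C k = set0.
Proof.
move=> CC; have rep k := (class_C_list A (C k)).1 (CC k).
have [U0 /choice[s rs]] := choice rep.
pose l := flatten [seq U0 k :: s k | k <- enum K].
have Al W : W \in l -> A W.
  move=> /flatten_mapP[k _]; have [AU As _] := rs k.
  by rewrite inE => /orP[/eqP ->//|]; exact: As.
exists 'I_(size l), (fun i : 'I_(size l) => nth set0 l i); split; first by move=> i; apply: Al; rewrite mem_nth.
move=> k J.
have [_ _ CE] := rs k.
have lW W : W \in U0 k :: s k -> exists i : 'I_(size l), nth set0 l i = W.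
  move=> Ws; have Wl : W \in l by apply/flatten_mapP; exists k => //; rewrite mem_enum.
  have il : (index W l < size l)%N by rewrite index_mem.
  by exists (Ordinal il); rewrite /= nth_index.
have [[y [Jy Cy]]|/nonemptyPn] := pselect ((atom (fun i : 'I_(size l) => nth set0 l i) (enum 'I_(size l)) J `&` C k) !=set0); last by right.
left => z Jz; move: Cy; rewrite CE => -[U0y sy].
have yz W : W \in U0 k :: s k -> W y <-> W z.
  move=> /lW[i <-]; have ie : i \in enum 'I_(size l) by rewrite mem_enum.
  by rewrite -(Jy i ie) (Jz i ie).
split; first exact: (yz (U0 k) (mem_head _ _)).1 U0y.
by move=> W Ws Wz; apply: (sy W Ws); apply/yz => //; rewrite inE Ws orbT.
Qed.

(** Reduces statements about overlapping sets to disjoint pieces. The pieces do not depend on the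
    process, so the additivity clause quantifies over all processes at once. *)
Lemma decomposition (K : finType) (C : K -> set T) : (forall k, class_C A (C k)) ->
  exists (I : finType) (E : I -> set T),
    [/\ forall i, class_C A (E i), trivIset setT E,
        forall k i, E i `<=` C k \/ E i `&` C k = set0,
        forall k y, C k y -> exists i, E i y &
        forall (R : realType) (d : measure_display) (Omega : measurableType d)
          (P : probability Omega R) (X : set T -> {RV P >-> R}),
          definite_increments A X -> forall k w,
          increment A X (C k) w =
          \sum_(i | `[< E i `<=` C k >]) increment A X (E i) w].
Proof.
move=> CC; have [I [V [AV VC]]] := common_atoms CC.
pose a (J : {set I}) := atom V (enum I) J.
(* Atoms inside no C k may lie outside [class_C]; they are replaced by the empty set, over which
   increments vanish. *)
pose E J := if `[< exists k, a J `<=` C k >] then a J else set0.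
have Ea J k : a J `<=` C k -> E J = a J.
  by move=> JC; rewrite /E; case: asboolP => // -[]; exists k.
have aE J k : a J `&` C k !=set0 -> a J `<=` C k.
  by move=> [y h]; have [//|h'] := VC k J; move: h; rewrite h'.
exists {set I}, E; split.
- move=> J; rewrite /E; case: asboolP => [[k JC]|_]; last exact: class_C0.
  rewrite -(setIidr JC); exact: class_C_atom.
- move=> J J' _ _ [y []]; rewrite /E; case: asboolP => // _ Jy; case: asboolP => // _ J'y.
  apply/finset.setP => i; have ie : i \in enum I by rewrite mem_enum.
  by apply/idP/idP => h; [apply/(J'y i ie)/(Jy i ie)|apply/(Jy i ie)/(J'y i ie)].
- move=> k J; rewrite /E; case: asboolP => _; first exact: VC.
  by left.
- move=> k y Cy; pose J := (\bigcup_(i : I | `[< V i y >]) [set i])%SET.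
  have Jy : a J y.
    move=> i _; split.
      by move=> /bigcupP[j /asboolP Vj]; rewrite inE => /eqP ->.
    by move=> Vi; apply/bigcupP; exists i; [exact/asboolP|rewrite inE].
  by exists J; rewrite (Ea _ k)//; apply: aE; exists y.
- move=> R d Omega P X defX k w.
  rewrite (increment_atoms A_setI defX w AV (CC k) (enum_uniq I)).
  rewrite (eq_bigl xpredT); last first.
    by move=> J; apply/fintype.subsetP => j _; rewrite mem_enum.
  rewrite [RHS]big_mkcond/=; apply: eq_bigr => J _.
  have [JC|JC] := pselect (a J `<=` C k).
    by rewrite setIidr// (Ea _ k)//; case: asboolP.
  have -> : C k `&` atom V (enum I) J = set0 by rewrite setIC; have [|] := VC k J.
  rewrite (increment0 defX); case: asboolP => // EC.
  rewrite (_ : E J = set0) ?(increment0 defX)//.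
  by move: EC; rewrite /E; case: asboolP => // _ /JC.
Qed.

End decomposition.

Section independent_increments.
Context {R : realType} {d : measure_display} {Omega : measurableType d}.
Context {P : probability Omega R} {T : topologicalType}.
Variables (A : set (set T)) (X : set T -> {RV P >-> R}).

Definition independent_increments : Prop := forall n (C : 'I_n -> set T),
  (forall i, class_C A (C i)) -> trivIset setT C ->
  mutually_independent (fun i => increment A X (C i)).

Hypothesis A_setI : forall U V, A U -> A V -> A (U `&` V).
Hypothesis A0 : A set0.
Hypothesis indX : independent_increments.

Lemma mRV (Y : {RV P >-> R}) : measurable_fun setT Y.
Proof. exact: measurable_funP. Qed.

Lemma RV_preimage (Y : {RV P >-> R}) B : measurable B -> measurable (Y @^-1` B).
Proof. by move=> mB; rewrite -[X in measurable X]setTI; exact: (mRV Y). Qed.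

Lemma fin_indep_increment (I : finType) (E : I -> set T) :
  (forall i, class_C A (E i)) -> trivIset setT E ->
  fin_indep P (fun i w => increment A X (E i) w).
Proof.
move=> CE tE.
have tE' : trivIset setT (fun j : 'I_#|I| => E (enum_val j)).
  by move=> i j _ _ h; apply: enum_val_inj; exact: tE.
have := (mutually_independent_fin _).1 (indX (fun j => CE (enum_val j)) tE').
move=> /(fin_indep_reindex (fun j => mRV _) (@enum_rank_inj I)).
rewrite (_ : _ \o _ = (fun i w => increment A X (E i) w))//.
by apply/funext => i /=; rewrite enum_rankK.
Qed.

Lemma pr_increment2 C D B B' : class_C A C -> class_C A D -> C `&` D = set0 ->
  measurable B -> measurable B' ->
  pr P (increment A X C @^-1` B `&` increment A X D @^-1` B') =
  pr P (increment A X C @^-1` B) * pr P (increment A X D @^-1` B').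
Proof.
move=> CC CD CD0 mB mB'.
have tE : trivIset setT (fun b : bool => if b then C else D).
  by move=> [] [] _ _ [y /= [h h']] //; exfalso; have : (C `&` D) y by []; rewrite CD0.
have CE b : class_C A (if b then C else D) by case: b.
have := @fin_indep_increment bool (fun b => if b then C else D) CE tE (fun b => if b then B else B').
rewrite big_bool/= => <-; last by case.
congr (pr P _); apply/seteqP; split=> [w [h1 h2] [] _ //|w h].
by split; [exact: (h true Logic.I)|exact: (h false Logic.I)].
Qed.

Hypothesis defX : definite_increments A X.

Lemma cfv_increment_split C V u : class_C A C -> A V ->
  cfv P (increment A X C) u =
  cfv P (increment A X (C `&` V)) u * cfv P (increment A X (C `\` V)) u.
Proof.
move=> CC AV; rewrite -cfvD; [|exact: mRV|exact: mRV|].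
  by congr (cfv P _ u); apply/funext => w; exact: increment_split.
move=> B B' mB mB'; apply: pr_increment2 => //.
- exact: class_C_setI.
- exact: class_C_setD.
- by apply/seteqP; split=> y // [[_ ?] []].
Qed.

End independent_increments.

Lemma measurable_normr_gt (R : realType) (r : R) : measurable [set x : R | r < `|x|].
Proof.
have mn : measurable_fun setT (fun x : R => `|x|) by apply: continuous_measurable_fun; exact: norm_continuous.
have := mn measurableT _ (@measurable_itv R `]r, +oo[); rewrite setTI.
rewrite (_ : _ @^-1` _ = [set x : R | r < `|x|])//.
by apply/seteqP; split=> x; rewrite /preimage/= in_itv/= andbT.
Qed.

Section dirac_laws.
Context {R : realType} {d : measure_display} {Omega : measurableType d}.
Context {P : probability Omega R}.
Implicit Type Y : {RV P >-> R}.

Lemma cfv_eq0 Y : (forall w, Y w = 0) -> cfv P Y = fun=> 1.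
Proof.
move=> Y0; apply/funext => u; rewrite -[RHS](cfv_cst0 P u); congr (cfv P _ u).
exact/funext.
Qed.

Lemma dirac_semigroup : convolution_semigroup (fun=> \d_(0 : R) : probability R R).
Proof.
split=> //.
- by move=> s t _ _; apply: cf_injective => u; rewrite cf_convolution !cf_dirac0 mulr1.
- by move=> f _ _; exact: cvg_cst.
Qed.

Lemma law_dirac0_ae Y : same_law (law Y) (\d_(0 : R)) -> P [set w | Y w != 0] = 0%E.
Proof.
move=> h; have mB : measurable [set~ (0 : R)] by exact: measurableC.
have := h _ mB; rewrite /law /distribution /pushforward/= diracE.
rewrite (_ : 0 \in _ = false); last by apply/negbTE; rewrite notin_setE => /(_ erefl).
move=> h0; apply: etrans h0; congr (P _).
apply/seteqP; split=> w /=; first by move=> /eqP.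
by move=> h'; apply/eqP.
Qed.

(** Where [Y n] is small, f is close to [f 0]; elsewhere the error is at most 2 M on an event of
    vanishing probability. *)
Lemma weak_cvg_in_probability (Y : nat -> {RV P >-> R}) (f : R -> R) :
  (forall e, 0 < e -> P [set w | e < `|Y n w|] @[n --> \oo] --> 0%E) ->
  continuous f -> (exists M, forall x, `|f x| <= M) ->
  \int[P]_w f (Y n w) @[n --> \oo] --> f 0.
Proof.
move=> YP cf [M fM].
have mf := continuous_measurable_fun cf.
have mfY n : measurable_fun setT (fun w => f (Y n w)) by exact: (measurableT_comp mf (mRV _)).
have M0 : 0 <= M by exact: le_trans (fM 0).
apply/cvgrPdist_le => e e0.
have [r /= r0 fr] : \forall r \near nbhs (0 : R), `|f 0 - f r| <= e / 2.
  by have /cvgrPdist_le := cf 0; apply; rewrite divr_gt0.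
have r20 : 0 < r / 2 by rewrite divr_gt0.
(* Multiplied by 2 M this is at most e / 2; the summand 1 covers M = 0. *)
have K0 : 0 < e / (4 * (M + 1)) by rewrite divr_gt0// mulr_gt0// ltr_wpDl.
have mE n : measurable [set w | r / 2 < `|Y n w|] by exact: RV_preimage (measurable_normr_gt _).
have bd n w : `|f 0 - f (Y n w)| <= e / 2 + 2 * M * \1_[set w | r / 2 < `|Y n w|] w.
  rewrite indicE; case: (boolP (w \in _)); rewrite ?notin_setE ?inE /= => h.
    rewrite mulr1 (le_trans (ler_normB _ _))//.
    by apply: (@le_trans _ _ (M + M)); [exact: lerD|rewrite mulr_natl mulr2n lerDr divr_ge0// ltW].
  rewrite mulr0 addr0; apply: fr => /=; rewrite sub0r normrN.
  by move/negP: h; rewrite -leNgt => h; apply: le_lt_trans h _; lra.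
have mD n : measurable_fun setT (fun w => `|f 0 - f (Y n w)|).
  by apply: measurableT_comp => //; exact: measurable_funB.
have mI n : measurable_fun setT (fun w => \1_[set w | r / 2 < `|Y n w|] w : R).
  exact: measurable_indic.
have iI n : P.-integrable setT (EFin \o (fun w => \1_[set w | r / 2 < `|Y n w|] w : R)).
  by apply: (@bounded_integrable _ _ _ P _ 1) => // w; rewrite ger0_norm// indicE lern1 leq_b1.
have est n : `|f 0 - \int[P]_w f (Y n w)| <= e / 2 + 2 * M * pr P [set w | r / 2 < `|Y n w|].
  have ic : P.-integrable setT (EFin \o cst (f 0)).
    by apply: (@bounded_integrable _ _ _ P _ M) => // w; exact: fM.
  have if_ : P.-integrable setT (EFin \o (fun w => f (Y n w))).
    by apply: (@bounded_integrable _ _ _ P _ M).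
  have -> : f 0 - \int[P]_w f (Y n w) = \int[P]_w (f 0 - f (Y n w)).
    by rewrite (RintegralB measurableT ic if_) Rintegral_probability_cst.
  apply: le_trans (le_normr_Rintegral measurableT _) _.
    apply: (@bounded_integrable _ _ _ P _ (M + M)); first exact: measurable_funB.
    by move=> w; rewrite (le_trans (ler_normB _ _))// lerD.
  have ih : P.-integrable setT (EFin \o (fun w => 2 * M * \1_[set w | r / 2 < `|Y n w|] w)).
    apply: (@bounded_integrable _ _ _ P _ (2 * M)); first exact: measurable_funM.
    move=> w; rewrite normrM ger0_norm ?mulr_ge0// ler_piMr ?mulr_ge0//.
    by rewrite ger0_norm// indicE lern1 leq_b1.
  have ie : P.-integrable setT (EFin \o cst (e / 2)).
    by apply: (@bounded_integrable _ _ _ P _ `|e / 2|).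
  apply: (@le_trans _ _ (\int[P]_w (e / 2 + 2 * M * \1_[set w | r / 2 < `|Y n w|] w))).
    apply: le_Rintegral => //.
    - apply: (@bounded_integrable _ _ _ P _ (M + M)) => // w.
      by rewrite normr_id (le_trans (ler_normB _ _))// lerD.
    - apply: (@bounded_integrable _ _ _ P _ (e / 2 + 2 * M)).
        by apply: measurable_funD => //; exact: measurable_funM.
      move=> w; rewrite ger0_norm; last by rewrite addr_ge0 ?mulr_ge0// ltW// divr_gt0.
      by rewrite lerD2l ler_piMr ?mulr_ge0// indicE lern1 leq_b1.
  rewrite (RintegralD measurableT ie ih) Rintegral_probability_cst lerD2l.
  rewrite (RintegralZl _ measurableT (iI n)) ler_wpM2l ?mulr_ge0//.
  by rewrite /Rintegral integral_indic// setIT.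
have := YP _ r20; move=> /fine_cvgP[_ /cvgr_le] /(_ _ K0); apply: filterS => n /= h.
apply: le_trans (est n) _; rewrite [leRHS](splitr e) lerD2l.
apply: le_trans (ler_wpM2l _ h) _; first by rewrite mulr_ge0.
rewrite mulrA ler_pdivrMr ?mulr_gt0 ?ltr_wpDl//; nra.
Qed.

End dirac_laws.

Section semigroup_tails.
Context {R : realType}.
Variable q : R -> probability R R.
Hypothesis sq : convolution_semigroup q.

Lemma semigroup_infinitely_divisible t : 0 <= t -> infinitely_divisible (q t).
Proof.
move=> t0 n n0; exists (q (t / n%:R)); apply: cf_injective => u.
rewrite cf_convolution_iter -cf_semigroupMn ?divr_ge0//.
have -> : t / n%:R *+ n = t by rewrite -[LHS]mulr_natr divfK// pnatr_eq0 -lt0n.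
by [].
Qed.

(** The indicator of the tail is dominated by the bounded continuous function min(1, |x| / e), which
    vanishes at 0, so weak convergence applies. *)
Lemma semigroup_tail_small (e r : R) : 0 < e -> 0 < r ->
  exists2 b, 0 < b & forall t, 0 <= t < b -> pr (q t) [set x | e < `|x|] < r.
Proof.
move=> e0 r0.
pose f (x : R) := Num.min 1 (`|x| / e).
have cf_ : continuous f.
  move=> x; apply: (@continuous_min _ _ (cst 1) (fun y : R => `|y| / e)); first exact: cvg_cst.
  by apply: cvgMl; exact: norm_continuous.
have f01 x : 0 <= f x <= 1 by rewrite /f ge_min lexx/= le_min ler01/= divr_ge0// ltW.
have fM x : `|f x| <= 1 by have /andP[h1 h2] := f01 x; rewrite ger0_norm.
have mf := continuous_measurable_fun cf_.
have mE : measurable [set x : R | e < `|x|] by exact: measurable_normr_gt.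
have lef s : pr (q s) [set x | e < `|x|] <= \int[q s]_x f x.
  have -> : pr (q s) [set x | e < `|x|] = \int[q s]_x (\1_[set x : R | e < `|x|] x : R).
    by rewrite /Rintegral integral_indic// setIT.
  apply: le_Rintegral => //.
  - by apply: (@bounded_integrable _ _ _ (q s) _ 1) => // x; rewrite ger0_norm// indicE lern1 leq_b1.
  - exact: (@bounded_integrable _ _ _ (q s) _ 1).
  - move=> x _; rewrite indicE; case: (boolP (x \in _)); rewrite ?inE /= => h.
      by rewrite /f le_min lexx/= ler_pdivlMr// mul1r ltW.
    by have /andP[] := f01 x.
(* Time 0 is not seen by the right-sided limit and is treated apart. *)
have q0 : pr (q 0) [set x | e < `|x|] = 0.
  have h : q 0 [set x | e < `|x|] = \d_(0 : R) [set x | e < `|x|] := cs_zero sq mE.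
  rewrite /pr h diracE memNset//= normr0; apply/negP; rewrite -leNgt; exact: ltW.
have fq : \int[q s]_x f x @[s --> 0^'+] --> (0 : R).
  have := weak_cvg_dirac0_Rintegral (cs_cvg0 sq) cf_ (ex_intro _ 1 fM).
  by rewrite {2}/f normr0 mul0r min_r.
have /cvgrPdist_lt/(_ _ r0)[b /= b0 hb] := fq.
exists b => // t /andP[t0 tb].
have [->|tn0] := eqVneq t 0; first by rewrite q0.
have tn : 0 < t by rewrite lt0r tn0 t0.
apply: le_lt_trans (lef t) _; apply: le_lt_trans (ler_norm _) _.
by have := hb t; rewrite /= !sub0r !normrN; apply; rewrite // ger0_norm.
Qed.

Lemma semigroup_tail (e : R) : 0 < e -> forall t : nat -> R, (forall n, 0 <= t n) ->
  t n @[n --> \oo] --> 0 -> q (t n) [set x | e < `|x|] @[n --> \oo] --> 0%E.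
Proof.
move=> e0 t t0 tcvg.
apply: cvg_EFin; first by apply: nearW => n; rewrite fin_num_measure//; exact: measurable_normr_gt.
apply/cvgrPdist_lt => r r0.
have [b b0 hb] := semigroup_tail_small e0 r0.
have /cvgrPdist_lt/(_ _ b0) := tcvg; apply: filterS => n /=.
rewrite !sub0r !normrN => tb; rewrite ger0_norm ?fine_ge0//; apply: hb.
by rewrite t0/=; apply: le_lt_trans tb; exact: ler_norm.
Qed.

End semigroup_tails.

Lemma measurable_normr_gt_preimage {R : realType} {d : measure_display} {S : measurableType d}
    (f : S -> R) (r : R) : measurable_fun setT f -> measurable [set w | r < `|f w|].
Proof.
by move=> mf; rewrite -[X in measurable X]setTI; exact: (mf measurableT _ (measurable_normr_gt r)).
Qed.

Lemma measurable_fun_sum_in {R : realType} {d : measure_display} {S : measurableType d}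
    (I : eqType) (s : seq I) (p : pred I) (Y : I -> S -> R) :
  (forall i, i \in s -> p i -> measurable_fun setT (Y i)) ->
  measurable_fun setT (fun w => \sum_(i <- s | p i) Y i w).
Proof.
elim: s => [_|i s IH mY]; first by under eq_fun do rewrite big_nil; exact: measurable_cst.
have {}IH : measurable_fun setT (fun w => \sum_(i <- s | p i) Y i w).
  by apply: IH => j js; apply: mY; rewrite inE js orbT.
under eq_fun do rewrite big_cons.
by case: (boolP (p i)) => // pi; apply: measurable_funD => //; apply: mY => //; rewrite mem_head.
Qed.

(** * Series of independent variables *)

Section ottaviani.
Context {R : realType} {d : measure_display} {Omega : measurableType d}.
Variable P : probability Omega R.

Lemma pr_bigsetU n (F : nat -> set Omega) : (forall k, measurable (F k)) ->
  trivIset setT F -> pr P (\big[setU/set0]_(k < n) F k) = \sum_(k < n) pr P (F k).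
Proof.
move=> mF tF; apply: EFin_inj; rewrite -prE; last exact: bigsetU_measurable.
rewrite measure_bigsetU// -sumEFin; apply: eq_bigr => k _; exact: prE.
Qed.

Lemma prC E : measurable E -> pr P (~` E) = 1 - pr P E.
Proof.
move=> mE; apply: EFin_inj; rewrite EFinB -!prE//; last exact: measurableC.
exact: probability_setC.
Qed.

(** If level 2 e is first passed at time k and the sum of the terms from k to N stays within e, then
    the full sum exceeds e. That sum is independent of the passage and stays within e with
    probability at least 1/2, whence the factor 2. *)
Lemma ottaviani (Y : nat -> Omega -> R) (N : nat) (e : R) :
  (forall i, measurable_fun setT (Y i)) ->
  fin_indep P (fun i : 'I_N => Y i) ->
  (forall k, (k <= N)%N -> pr P [set w | e < `|\sum_(k <= i < N) Y i w|] <= 2^-1) ->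
  pr P (\bigcup_(k in [set k | (k < N.+1)%N]) [set w | e *+ 2 < `|\sum_(0 <= i < k) Y i w|])
    <= 2 * pr P [set w | e < `|\sum_(0 <= i < N) Y i w|].
Proof.
move=> mY iY half.
pose S k w := \sum_(0 <= i < k) Y i w.
pose Tl k w := \sum_(k <= i < N) Y i w.
have mS k : measurable_fun setT (S k) by exact: measurable_fun_sumf.
have mT k : measurable_fun setT (Tl k) by exact: measurable_fun_sumf.
pose G k := [set w | e *+ 2 < `|S k w|].
(* [F k] is the event that the first passage takes place at time k. *)
pose F := seqDU G.
pose H k := ~` [set w | e < `|Tl k w|].
have mG k : measurable (G k) by exact: measurable_normr_gt_preimage.
have mF k : measurable (F k) by apply: measurableD => //; exact: bigsetU_measurable.
have mH k : measurable (H k) by apply: measurableC; exact: measurable_normr_gt_preimage.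
have FU : \bigcup_(k in [set k | (k < N.+1)%N]) G k = \big[setU/set0]_(k < N.+1) F k.
  by rewrite bigcup_mkord bigsetU_seqDU.
have tF : trivIset setT F by exact: trivIset_seqDU.
rewrite -/G FU pr_bigsetU//.
have ind k : (k <= N)%N -> pr P (F k `&` H k) = pr P (F k) * pr P (H k).
  (* The passage depends on the terms before k, the remainder on the others. *)
  move=> kN; pose t (i : 'I_N) := (i < k)%N.
  pose E (b : bool) := if b then F k else H k.
  have mYb (i : nat) (b : bool) : (i < N)%N -> (i < k)%N = b ->
      measurable_fun (setT : set (g_sigma_algebraType (block t (fun i : 'I_N => Y i) b))) (Y i).
    by move=> iN ib; apply: (@measurable_fun_block _ _ _ _ _ t (fun i : 'I_N => Y i) (Ordinal iN) b).
  have mE b : <<s block t (fun i : 'I_N => Y i) b >> (E b).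
    case: b; rewrite /E.
      have mGb j : (j <= k)%N ->
          measurable (G j : set (g_sigma_algebraType (block t (fun i : 'I_N => Y i) true))).
        move=> jk; apply: measurable_normr_gt_preimage; apply: measurable_fun_sum_in => i + _.
        rewrite mem_index_iota /= => ij; apply: mYb; first exact: leq_trans ij (leq_trans jk kN).
        exact: leq_trans ij jk.
      suff : measurable (F k : set (g_sigma_algebraType (block t (fun i : 'I_N => Y i) true))) by [].
      apply: measurableD; first exact: mGb.
      by apply: bigsetU_measurable => i _; apply: mGb; exact: ltnW.
    suff : measurable (H k : set (g_sigma_algebraType (block t (fun i : 'I_N => Y i) false))) by [].
    apply: measurableC; apply: measurable_normr_gt_preimage; apply: measurable_fun_sum_in => i + _.
    rewrite mem_index_iota => /andP[ki iN]; apply: mYb => //.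
    by rewrite ltnNge ki.
  have := pr_block_indep (fun i : 'I_N => mY i) iY mE.
  rewrite big_bool/= => <-; congr (pr P _); apply/seteqP; split=> [w [h1 h2] [] _ //|w h].
  by split; [exact: (h true Logic.I)|exact: (h false Logic.I)].
have sub k : (k <= N)%N -> F k `&` H k `<=` [set w | e < `|S N w|].
  move=> kN w [[Gk _] /negP]; rewrite -leNgt => Tk /=.
  have -> : S N w = S k w + Tl k w by rewrite /S /Tl (big_cat_nat (leq0n k) kN).
  have := ler_normB (S k w + Tl k w) (Tl k w); rewrite addrK.
  by move: Gk; rewrite /G/= mulr2n; lra.
have mSN : measurable [set w | e < `|S N w|] by exact: measurable_normr_gt_preimage.
have := @le_pr _ _ _ P (\big[setU/set0]_(k < N.+1) (F k `&` H k)) [set w | e < `|S N w|].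
rewrite (@pr_bigsetU N.+1 (fun k => F k `&` H k)); last 2 first.
- by move=> k; exact: measurableI.
- by move=> i j _ _ [w [[Fi _] [Fj _]]]; apply: tF => //; exists w.
move=> /(_ _ mSN) hle.
have {}hle : \sum_(k < N.+1) pr P (F k `&` H k) <= pr P [set w | e < `|S N w|].
  apply: hle; first by apply: bigsetU_measurable => k _; exact: measurableI.
  by rewrite -(bigcup_mkord N.+1 (fun k => F k `&` H k)) => w [k /= kN]; exact: sub.
apply: le_trans (ler_wpM2l (ler0n R 2) hle); rewrite mulr_sumr; apply: ler_sum => k _.
have kN : (k <= N)%N by rewrite -ltnS.
rewrite ind// prC; last exact: measurable_normr_gt_preimage.
by have := half k kN; have := pr_ge0 P (F k); rewrite -/(Tl k); nra.
Qed.

Lemma prU E F : measurable E -> measurable F -> pr P (E `|` F) <= pr P E + pr P F.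
Proof.
move=> mE mF; rewrite -lee_fin EFinD -!prE//; last exact: measurableU.
exact: measureU2.
Qed.

Lemma pr_bigcup_le (F : nat -> set Omega) (r : R) : (forall n, measurable (F n)) ->
  (forall N, pr P (\bigcup_(k in [set k | (k < N.+1)%N]) F k) <= r) ->
  pr P (\bigcup_n F n) <= r.
Proof.
move=> mF h; pose G N := \bigcup_(k in [set k | (k < N.+1)%N]) F k.
have mG N : measurable (G N) by exact: bigcup_measurable.
have GU : \bigcup_n G n = \bigcup_n F n.
  apply/seteqP; split=> w; first by move=> [n _ [k _ Fk]]; exists k.
  by move=> [n _ Fn]; exists n => //; exists n => /=.
have mGU : measurable (\bigcup_n F n) by exact: bigcup_measurable.
have ndG : nondecreasing_seq G.
  by move=> i j ij; apply/subsetPset => w [k /= ki Fk]; exists k => //=; exact: leq_trans ij.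
have := @nondecreasing_cvg_mu _ _ _ P G mG _ ndG; rewrite GU => /(_ mGU) cG.
rewrite -lee_fin -prE//; apply: (cvge_to_le cG); apply: nearW => N /=.
by rewrite prE// lee_fin; exact: h.
Qed.

(** Convergence in probability of the partial sums, together with uniformly small later blocks, is
    upgraded by Ottaviani's inequality: the partial sums stay near Z for ever with probability close
    to 1. *)
Lemma ae_series_cvg (Y : nat -> Omega -> R) (Z : Omega -> R) :
  (forall i, measurable_fun setT (Y i)) -> measurable_fun setT Z ->
  (forall k N, fin_indep P (fun i : 'I_N => Y (k + i)%N)) ->
  (forall e r : R, 0 < e -> 0 < r -> exists k0, forall k, (k0 <= k)%N ->
    pr P [set w | e < `|\sum_(0 <= i < k) Y i w - Z w|] <= r /\
    forall n, pr P [set w | e < `|\sum_(k <= i < n) Y i w|] <= r) ->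
  {ae P, forall w, series (fun n => Y n w) @ \oo --> Z w}.
Proof.
move=> mY mZ iY small.
pose S k w := \sum_(0 <= i < k) Y i w.
have mS k : measurable_fun setT (S k) by exact: measurable_fun_sumf.
pose e l : R := l.+1%:R^-1.
have e0 l : 0 < e l by rewrite invr_gt0.
(* The factor 3 allows 2 for the fluctuation after a rank and 1 for the distance to Z at that
   rank. *)
pose G l k := \bigcup_n [set w | e l *+ 3 < `|S (k + n)%N w - Z w|].
have mG l k : measurable (G l k).
  by apply: bigcup_measurable => n _; apply: measurable_normr_gt_preimage; exact: measurable_funB.
have mGI l : measurable (\bigcap_k G l k) by exact: bigcap_measurable.
have G0 l : P (\bigcap_k G l k) = 0%E.
  rewrite prE//; congr EFin; apply/eqP; rewrite eq_le pr_ge0 andbT.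
  suff hr (r : R) : 0 < r -> pr P (\bigcap_k G l k) <= r.
    by apply/ler_addgt0Pl => r r0; rewrite addr0; exact: hr.
  (* The bound r / 3 is counted twice through Ottaviani's inequality and once for the distance to Z;
     the bound 1/2 is the hypothesis of that inequality. *)
  move=> r0; have r0' : 0 < Num.min (r / 3) 2^-1 by rewrite lt_min; apply/andP; split; lra.
  have [k0 hk0] := small _ _ (e0 l) r0'.
  have [h1 h2] := hk0 k0 (leqnn _).
  have mH n : measurable [set w | e l *+ 2 < `|\sum_(0 <= i < n) Y (k0 + i)%N w|].
    by apply: measurable_normr_gt_preimage; exact: measurable_fun_sumf.
  pose H := \bigcup_n [set w | e l *+ 2 < `|\sum_(0 <= i < n) Y (k0 + i)%N w|].
  have mHU : measurable H by exact: bigcup_measurable.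
  have shift k n w : \sum_(k <= i < n) Y (k0 + i)%N w = \sum_(k0 + k <= i < k0 + n) Y i w.
    by rewrite !(addnC k0) big_addn addnK; apply: eq_bigr => i _; rewrite addnC.
  have HP : pr P H <= 2 * (r / 3).
    apply: pr_bigcup_le => // N.
    apply: le_trans (ottaviani (Y := fun i => Y (k0 + i)%N) (e := e l) _ (iY k0 N) _) _ => //.
    - move=> k kN; under eq_set do rewrite shift.
      have [_ /(_ (k0 + N)%N)] := hk0 (k0 + k)%N (leq_addr _ _).
      by rewrite le_min => /andP[].
    - rewrite ler_wpM2l//; under eq_set do rewrite shift addn0.
      by have := h2 (k0 + N)%N; rewrite le_min => /andP[].
  have mE : measurable [set w | e l < `|S k0 w - Z w|].
    by apply: measurable_normr_gt_preimage; exact: measurable_funB.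
  have sub : \bigcap_k G l k `<=` H `|` [set w | e l < `|S k0 w - Z w|].
    move=> w /(_ k0 Logic.I)[n _ /= Gn]; have [|le1] := ltP (e l) (`|S k0 w - Z w|); first by right.
    left; exists n => //=; have -> : \sum_(0 <= i < n) Y (k0 + i)%N w = S (k0 + n)%N w - S k0 w.
      rewrite shift addn0 /S (big_cat_nat (leq0n k0) (leq_addr n k0)) /=.
      by rewrite [X in _ = X - _]addrC addrK.
    have := ler_normD (S (k0 + n)%N w - S k0 w) (S k0 w - Z w).
    rewrite addrA subrK; move: Gn; rewrite !mulrSr mulr0n; lra.
  apply: le_trans (le_pr _ _ _ sub) _ => //; first exact: measurableU.
  apply: le_trans (prU _ _) _ => //.
  move: h1; rewrite le_min => /andP[h1 _]; rewrite -/(S k0 _) in h1.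
  by apply: le_trans (lerD HP h1) _; lra.
have : P.-negligible (\bigcup_l \bigcap_k G l k).
  by apply: negligible_bigcup => l; exact: (negligibleP _ (mGI l)).2 (G0 l).
apply: negligibleS => w /= nc; apply: contrapT => nG; apply: nc.
apply/cvgrPdist_le => r r0.
  pose l := Num.truncn (3 / r).
  have lr : e l *+ 3 <= r.
    have : 3 / r < l.+1%:R by exact: truncnS_gt.
    rewrite ltr_pdivrMr// => h; have -> : e l *+ 3 = 3 / l.+1%:R by rewrite mulr_natl.
    by rewrite ler_pdivrMr// mulrC ltW.
  have [k nGk] : exists k, ~ G l k w.
    by apply: contrapT => h; apply: nG; exists l => // k _; apply: contrapT => h'; apply: h; exists k.
  exists k => // n /= kn; rewrite distrC; apply: le_trans lr; rewrite leNgt; apply/negP => h.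
  by apply: nGk; exists (n - k)%N => //=; rewrite subnKC.
Qed.

End ottaviani.

Lemma big_nat_shift (V : nmodType) (F : nat -> V) k n :
  \sum_(k <= i < n) F i = \sum_(i < n - k) F (k + i)%N.
Proof.
by rewrite -{1}(add0n k) big_addn big_mkord; apply: eq_bigr => i _; rewrite addnC.
Qed.

Lemma measure_bigcup_fintype {R : realType} {d : measure_display} {T : measurableType d}
    (mu : {measure set T -> \bar R}) (I : finType) (p : pred I) (E : I -> set T) :
  (forall i, measurable (E i)) -> trivIset setT E ->
  mu (\bigcup_(i in [set i | p i]) E i) = (\sum_(i | p i) mu (E i))%E.
Proof.
move=> mE tE; have fD : finite_set [set i | p i] by exact: finite_finset.
rewrite measure_fin_bigcup//; last exact: sub_trivIset tE.
rewrite fsbig_finite// big_uniq ?fset_uniq//=; apply: eq_bigl => i.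
by rewrite (in_fset_set fD); apply/idP/idP; rewrite in_setE.
Qed.

(** Events depend on the coordinates in D alone, so marginals are compared only there;
    [joint_law_cells] relies on this to leave the empty subset free. *)
Lemma fin_indep_joint_law {R : realType} (I : finType) (D : set I)
    (d : measure_display) (Omega : measurableType d) (P : probability Omega R)
    (d' : measure_display) (Omega' : measurableType d') (P' : probability Omega' R)
    (X : I -> Omega -> R) (Y : I -> Omega' -> R) :
  (forall i, measurable_fun setT (X i)) -> (forall i, measurable_fun setT (Y i)) ->
  fin_indep P X -> fin_indep P' Y ->
  (forall i B, D i -> measurable B -> P (X i @^-1` B) = P' (Y i @^-1` B)) ->
  forall E, <<s cylinder_sets D >> E -> P [set w | E (X ^~ w)] = P' [set w | E (Y ^~ w)].
Proof.
move=> mX mY iX iY XY; apply: joint_law_unique => // s B sD mB.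
pose C i := if i \in s then B i else setT.
have mC i : measurable (C i) by rewrite /C; case: ifP.
have capE d1 (W : measurableType d1) (Z : I -> W -> R) :
    \bigcap_(i in [set` s]) (Z i @^-1` B i) = \bigcap_i (Z i @^-1` C i).
  apply/seteqP; split=> w h i; first by move=> _; rewrite /= /C; case: ifP => // /h.
  by move=> /= is_; have := h i Logic.I; rewrite /C /= is_.
have mp d1 (W : measurableType d1) (Z : I -> W -> R) i : measurable_fun setT (Z i) ->
  measurable (Z i @^-1` C i) by move=> mZ; rewrite -[X in measurable X]setTI; exact: mZ.
rewrite !capE !prE; last 2 first.
- by apply: bigcap_fintype_measurable => i; exact: mp.
- by apply: bigcap_fintype_measurable => i; exact: mp.
rewrite iX// iY//; congr EFin; apply: eq_bigr => i _; rewrite /C; case: ifP => [/sD Di|_].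
  by congr fine; exact: XY.
by rewrite !preimage_setT !prT.
Qed.

Lemma measurable_fun_coordinate {R : realType} (I : Type) (D : set I) (i : I) : D i ->
  measurable_fun (setT : set (g_sigma_algebraType (@cylinder_sets R I D))) (fun f => f i).
Proof.
move=> Di _ B mB; rewrite setTI; apply: sub_sigma_algebra.
by exists i, B.
Qed.

Lemma law_sum_semigroup {R : realType} (q : R -> probability R R)
    {d : measure_display} {Omega : measurableType d} (P : probability Omega R)
    (I : finType) (p : pred I) (Y : I -> Omega -> R) (t : I -> R) :
  convolution_semigroup q -> (forall i, measurable_fun setT (Y i)) -> fin_indep P Y ->
  (forall i, 0 <= t i) ->
  (forall i B, measurable B -> P (Y i @^-1` B) = q (t i) B) ->
  forall B, measurable B ->
    P ((fun w => \sum_(i | p i) Y i w) @^-1` B) = q (\sum_(i | p i) t i) B.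
Proof.
move=> sq mY iY t0 YB B mB; pose s := [seq i <- index_enum I | p i].
have us : uniq s by rewrite filter_uniq// index_enum_uniq.
have mZ : measurable_fun setT (fun w => \sum_(i <- s) Y i w) by exact: measurable_fun_sumf.
have sl : same_law (law (mfun_of mZ : {RV P >-> R})) (q (\sum_(i <- s) t i)).
  apply: cf_injective => u; rewrite cf_law (cfv_sum u mY iY us).
  elim: (s) => [|i s' IH]; first by rewrite !big_nil cf_semigroup0.
  rewrite !big_cons cf_semigroupD ?IH//; last exact: sumr_ge0.
  congr (_ * _); rewrite -(cf_law (mfun_of (mY i) : {RV P >-> R})).
  by apply: cf_same_law => D mD; exact: YB.
have := sl B mB; rewrite /s big_filter => <-; congr (P _).
by apply/seteqP; split=> w /=; rewrite big_filter.
Qed.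

Lemma mutually_independent_reindex {R : realType} {d : measure_display} {Omega : measurableType d}
    {P : probability Omega R} (I J : choiceType) (h : J -> I) (Y : I -> {RV P >-> R}) :
  injective h -> mutually_independent Y -> mutually_independent (fun j => Y (h j)).
Proof.
move=> hi iY K F mF.
have [B BP] : exists B : I -> set R, (forall i, measurable (B i)) /\ forall j, B (h j) = F j.
  have /choice[B BP] : forall i, exists D, measurable D /\ forall j, h j = i -> D = F j.
    move=> i; have [[j ji]|nj] := pselect (exists j, h j = i).
      by exists (F j); split=> // k; rewrite -ji => /hi ->.
    by exists setT; split=> // j ji; exfalso; apply: nj; exists j.
  by exists B; split=> [i|j]; [exact: (BP i).1|exact: (BP (h j)).2].
case: BP => mB BE; have := iY (h @` K)%fset B mB.
rewrite big_imfset/=; last by move=> j k _ _; exact: hi.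
under [in RHS]eq_bigr => j _ do rewrite BE.
move=> <-; congr (P _); apply/seteqP; split=> w H.
  by move=> _ /= /imfsetP[j /= jK ->]; rewrite BE; exact: H.
by move=> j /= jK; rewrite -BE; apply: H => /=; apply/imfsetP; exists j.
Qed.

(** The unions of the events from rank n on decrease to an event that excludes convergence to 0,
    hence to a null event. *)
Lemma ae_cvg0_in_probability {R : realType} {d : measure_display} {Omega : measurableType d}
    (P : probability Omega R) (Y : nat -> Omega -> R) (e : R) : 0 < e ->
  (forall n, measurable_fun setT (Y n)) -> {ae P, forall w, Y n w @[n --> \oo] --> 0} ->
  P [set w | e < `|Y n w|] @[n --> \oo] --> 0%E.
Proof.
move=> e0 mY Y0; pose E n := [set w | e < `|Y n w|].
pose G n := \bigcup_(k in [set k | (n <= k)%N]) E k.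
have mE n : measurable (E n) by exact: measurable_normr_gt_preimage.
have mG n : measurable (G n) by exact: bigcup_measurable.
have mGI : measurable (\bigcap_n G n) by exact: bigcap_measurable.
have G0 : P (\bigcap_n G n) = 0%E.
  apply/(negligibleP _ mGI); apply: negligibleS Y0 => w Gw /= cw.
  have /cvgrPdist_lt/(_ _ e0)[N _ hN] := cw.
  have [k /= Nk] := Gw N Logic.I; rewrite /E /= => ek.
  by have := hN k Nk; rewrite /= sub0r normrN ltNge (ltW ek).
have cG : P (G n) @[n --> \oo] --> 0%E.
  rewrite -G0; apply: nonincreasing_cvg_mu => //.
    by rewrite (le_lt_trans (probability_le1 _ _)) ?ltry.
  by move=> n k nk; apply/subsetPset => w [j /= kj ?]; exists j => //=; exact: leq_trans kj.
apply: (@squeeze_cvge _ _ _ _ (fun=> 0%E) _ _ _ _ _ cG); [apply: nearW => n|exact: cvg_cst].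
by rewrite measure_ge0/=; apply: le_measure; rewrite ?inE; [exact: mE|exact: mG|move=> w Ew; exists n => /=].
Qed.

Section independent_model.
Context {R : realType}.

Lemma measurable_fun_cylinder {d : measure_display} {S : measurableType d} (I : Type) (D : set I)
    (Y : I -> S -> R) : (forall i, D i -> measurable_fun setT (Y i)) ->
  measurable_fun setT (fun w => (Y^~ w) : g_sigma_algebraType (@cylinder_sets R I D)).
Proof.
move=> mY; apply: (@measurability _ _ _ (g_sigma_algebraType (@cylinder_sets R I D)) _ _
  (@cylinder_sets R I D)) => //.
by move=> _ [_ [i [B [Di mB ->]] <-]]; exact: mY.
Qed.

(** The space is a product with one factor per element of s, in the order of the nested integrals,
    so that Tonelli identifies [iterated_integral] with an expectation. The coordinates xi off s are
    carried along for the induction. *)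
Lemma exists_independent (I : eqType) (nu : I -> probability R R) (s : seq I) : uniq s ->
  exists (d : measure_display) (Omega : measurableType d) (P : probability Omega R)
    (Y : I -> Omega -> R),
  [/\ forall i, measurable_fun setT (Y i),
      forall B : I -> set R, (forall i, measurable (B i)) ->
        P (\bigcap_(i in [set` s]) (Y i @^-1` B i)) = (\prod_(i <- s) nu i (B i))%E &
      forall F : (I -> R) -> \bar R, (forall x, 0 <= F x)%E ->
        measurable_fun (setT : set (g_sigma_algebraType (@cylinder_sets R I setT))) F ->
        forall xi, iterated_integral nu s F xi =
          (\int[P]_w F (fun j => if j \in s then Y j w else xi j))%E].
Proof.
elim: s => [_|i s IH /= /andP[iNs us]].
  exists _, unit, (\d_tt : probability unit R), (fun _ _ => 0); split.
  - by move=> i; exact: measurable_cst.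
  - move=> B mB; rewrite big_nil (_ : \bigcap_(i in _) _ = setT) ?probability_setT//.
    by apply/seteqP; split.
  - move=> F F0 mF xi /=; rewrite integral_dirac//=; first by rewrite diracT mul1e.
have [d [W [P [Y [mY iY FY]]]]] := IH us.
exists _, (R * W)%type, (nu i \x P)%E, (fun j z => if j == i then z.1 else Y j z.2).
have mZ j : measurable_fun setT (fun z : R * W => if j == i then z.1 else Y j z.2).
  by case: eqP => _; [exact: measurable_fst|exact: (measurableT_comp (mY j) measurable_snd)].
split=> //.
- move=> B mB; rewrite big_cons -iY//.
  rewrite (_ : \bigcap_(j in _) _ = B i `*` \bigcap_(j in [set` s]) (Y j @^-1` B j)).
    apply: product_measure1E => //; apply: fin_bigcap_measurable => // j _.
    by rewrite -[X in measurable X]setTI; exact: mY.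
  apply/seteqP; split=> -[x w] /=.
    move=> h; split; first by have := h i (mem_head _ _); rewrite /= eqxx.
    move=> j /= js; have := h j; rewrite /= inE js orbT => /(_ isT).
    by case: eqP js => // ->; rewrite (negbTE iNs).
  move=> [Bx h] j /=; rewrite inE; case: eqP => [-> //|_] /=; exact: h.
- move=> F F0 mF xi /=.
  rewrite fubini_tonelli1/=; last 2 first.
  + have mG := @measurable_fun_cylinder _ (R * W)%type I setT (fun j z => if j \in i :: s then
      (if j == i then z.1 else Y j z.2) else xi j).
    suff h : forall j, measurable_fun setT (fun z : R * W => if j \in i :: s then
      (if j == i then z.1 else Y j z.2) else xi j) by exact: (measurableT_comp mF (mG (fun j _ => h j))).
    by move=> j; case: (j \in i :: s); [exact: mZ|exact: measurable_cst].
  + by move=> z; exact: F0.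
  apply: eq_integral => x _; rewrite FY// /fubini_F; apply: eq_integral => w _ /=.
  congr F; apply/funext => j; rewrite inE.
  by case: (eqVneq j i) => [->|ji] /=; rewrite ?(negbTE iNs)//.
Qed.

End independent_model.

(** The points lying in exactly the sets C k with k in J. No cardinality occurs here and any finite
    index type is allowed; [cellE] recovers the form used in the formula. *)
Definition cell (T : Type) (K : finType) (C : K -> set T) (J : {set K}) : set T :=
  [set y | forall k, k \in J <-> C k y].

(** The variables off s are put equal to 0, which makes the whole finite family independent and
    matches the initial assignment [fun=> 0] of the iterated integral. *)
Lemma independent_model {R : realType} (I : finType) (nu : I -> probability R R) (s : seq I) :
  uniq s ->
  exists (d : measure_display) (W : measurableType d) (P : probability W R) (Y : I -> W -> R),
  [/\ forall i, measurable_fun setT (Y i), fin_indep P Y,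
      forall i B, i \in s -> measurable B -> P (Y i @^-1` B) = nu i B,
      forall i w, i \notin s -> Y i w = 0 &
      forall F : (I -> R) -> \bar R, (forall x, 0 <= F x)%E ->
        measurable_fun (setT : set (g_sigma_algebraType (@cylinder_sets R I setT))) F ->
        iterated_integral nu s F (fun=> 0) = (\int[P]_w F (Y ^~ w))%E].
Proof.
move=> us; have [d [W [P [Z [mZ iZ FZ]]]]] := exists_independent nu us.
pose Y i w := if i \in s then Z i w else 0.
have mY i : measurable_fun setT (Y i) by rewrite /Y; case: (i \in s) => //; exact: measurable_cst.
have mYB i B : measurable B -> measurable (Y i @^-1` B).
  by move=> mB; rewrite -[X in measurable X]setTI; exact: mY.
have YB i B : i \in s -> measurable B -> P (Y i @^-1` B) = nu i B.
  move=> is_ mB; have := iZ (fun j => if j == i then B else setT) _.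
  rewrite (_ : \bigcap_(j in _) _ = Y i @^-1` B); last first.
    apply/seteqP; split=> w /=; rewrite /Y is_; first by move=> /(_ i is_); rewrite /= eqxx.
    by move=> BZ j _ /=; case: eqP => // ->.
  rewrite (bigD1_seq i)//= eqxx big1 ?mule1; first by apply=> j; case: ifP.
  by move=> j /negbTE ->; exact: probability_setT.
exists d, W, P, Y; split=> //; last 2 first.
- by move=> i w; rewrite /Y => /negbTE ->.
- by move=> F F0 mF; rewrite FZ.
move=> B mB; have mcap : measurable (\bigcap_i (Y i @^-1` B i)).
  by apply: bigcap_fintype_measurable => i; exact: mYB.
(* If some set off s misses 0, both sides vanish; otherwise the constraints off s are always
   satisfied. *)
have [h0|/existsNP[i /not_implyP[iNs nB]]] := pselect (forall i, i \notin s -> B i 0).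
  apply: EFin_inj; rewrite -prE//.
  rewrite (_ : \bigcap_i _ = \bigcap_(i in [set` s]) (Z i @^-1` B i)).
    rewrite iZ// -prodEFin [RHS](bigID (fun i => i \in s))/= [X in (_ * X)%E]big1 ?mule1.
      rewrite -big_uniq//= big_seq [RHS]big_seq; apply: eq_bigr => i is_.
      by rewrite -prE ?YB//; exact: mYB.
    move=> i iNs; rewrite -prE; last exact: mYB.
    rewrite (_ : _ @^-1` _ = setT) ?probability_setT//.
    by apply/seteqP; split=> w //= _; rewrite /Y (negbTE iNs); exact: h0.
  apply/seteqP; split=> w h i.
    by move=> /= is_; have := h i Logic.I; rewrite /= /Y is_.
  move=> _; rewrite /= /Y; case: (boolP (i \in s)) => [is_|iNs]; first exact: h.
  exact: h0.
have Yi0 : Y i @^-1` B i = set0.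
  by apply/seteqP; split=> w //=; rewrite /Y (negbTE iNs).
rewrite (bigD1 i)//= Yi0 (_ : \bigcap_i _ = set0); last first.
  by apply/seteqP; split=> w // /(_ i Logic.I); rewrite Yi0.
by rewrite /pr measure0 mul0r.
Qed.

Lemma mem_enum_card n k (J : {set 'I_n}) :
  (J \in enum [set J : {set 'I_n} | #|J| == k]) = (#|J| == k).
Proof. by rewrite mem_enum; apply/idP/idP => [|h]; [rewrite in_setE|exact/mem_set]. Qed.

Lemma mem_nonempty_subsets n (J : {set 'I_n}) :
  (J \in @nonempty_subsets n) = (J != finset.set0).
Proof.
apply/flatten_mapP/idP => [[k]|J0].
  rewrite mem_iota mem_enum_card => /andP[k0 _] /eqP Jk.
  by rewrite -cards_eq0 Jk -lt0n.
exists #|J|; last by rewrite mem_enum_card.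
rewrite mem_iota lt0n cards_eq0 J0/= add1n ltnS -[leqRHS](card_ord n); exact: max_card.
Qed.

Lemma nonempty_subsets_uniq n : uniq (@nonempty_subsets n).
Proof.
rewrite /nonempty_subsets; have := iota_uniq 1 n; elim: (iota 1 n) => //= k s IH /andP[kNs us].
rewrite cat_uniq enum_uniq IH//= andbT; apply/hasPn => J /flatten_mapP[l ls].
rewrite !mem_enum_card => /eqP Jl; apply/negP => /eqP Jk.
by move: kNs; rewrite -Jk Jl ls.
Qed.

(** A point of all C j with j in J that lies in one further C k belongs to an intersection of #|J| +
    1 sets. Conversely, the indices of sets containing a point of the cell are all in J, too few for
    such an intersection. *)
Lemma cellE (T : Type) n (C : 'I_n -> set T) (J : {set 'I_n}) :
  D_inter C J `\` D_union C #|J|.+1 = cell C J.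
Proof.
apply/seteqP; split=> y.
  move=> [CJ nD] k; split=> [kJ|Ck]; first exact: CJ.
  apply: contrapT => /negP kJ; apply: nD; exists (k |: J)%SET; first by rewrite /= cardsU1 kJ.
  by move=> j /=; rewrite !inE => /orP[/eqP -> //|]; exact: CJ.
move=> h; split=> [k /= kJ|[J' /= J'J CJ']]; first exact/(h k).
have : J' \subset J by apply/fintype.subsetP => k kJ'; apply/(h k); exact: CJ'.
by move=> /subset_leq_card; rewrite J'J ltnn.
Qed.

(** * Kolmogorov extension *)

Definition depends_on (J : eqType) (s : seq J) : set (set (J -> bool)) :=
  [set E | forall f g, (forall j, j \in s -> f j = g j) -> E f -> E g].

Section clopen_sets.
Variable J : eqType.
Implicit Types (s : seq J) (E F : set (J -> bool)).

Lemma depends_onS s s' E : {subset s <= s'} -> depends_on s E -> depends_on s' E.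
Proof. by move=> ss' h f g fg; apply: h => j /ss'; exact: fg. Qed.

Lemma depends_onC s E : depends_on s E -> depends_on s (~` E).
Proof. by move=> h f g fg nE Eg; apply/nE/(h g) => // j js; rewrite fg. Qed.

Lemma depends_onU s s' E F : depends_on s E -> depends_on s' F -> depends_on (s ++ s') (E `|` F).
Proof.
move=> h h' f g fg [Ef|Ff]; [left; apply: h Ef|right; apply: h' Ff] => j js.
  by apply: fg; rewrite mem_cat js.
by apply: fg; rewrite mem_cat js orbT.
Qed.

Lemma depends_onI s s' E F : depends_on s E -> depends_on s' F -> depends_on (s ++ s') (E `&` F).
Proof.
move=> h h' f g fg [Ef Ff]; split; [apply: h Ef|apply: h' Ff] => j js.
  by apply: fg; rewrite mem_cat js.
by apply: fg; rewrite mem_cat js orbT.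
Qed.

Lemma depends_on0 s : depends_on s set0.
Proof. by []. Qed.

Lemma measurable_depends_on {d : measure_display} {S : measurableType d} (Z : S -> J -> bool) s E :
  (forall j, j \in s -> measurable [set w | Z w j]) -> depends_on s E -> measurable (Z @^-1` E).
Proof.
elim: s E => [|j s IH] E mZ dE.
  have [[f Ef]|nE] := pselect (exists f, E f).
    by rewrite (_ : Z @^-1` E = setT)//; apply/seteqP; split=> w //= _; exact: dE Ef.
  by rewrite (_ : Z @^-1` E = set0)//; apply/seteqP; split=> w //= Ew; apply: nE; exists (Z w).
(* The preimage is split according to the value of the bit j, which is then frozen. *)
pose upd (f : J -> bool) b i := if i == j then b else f i.
pose E' b : set (J -> bool) := [set f | E (upd f b)].
have dE' b : depends_on s (E' b).
  move=> f g fg; apply: dE => i; rewrite inE /upd; case: eqP => //= _; exact: fg.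
have mj : measurable [set w | Z w j] by apply: mZ; rewrite mem_head.
have ms i : i \in s -> measurable [set w | Z w i] by move=> is_; apply: mZ; rewrite inE is_ orbT.
rewrite (_ : Z @^-1` E = ([set w | Z w j] `&` Z @^-1` E' true) `|`
    (~` [set w | Z w j] `&` Z @^-1` E' false)).
  by apply: measurableU; apply: measurableI; [|exact: IH|exact: measurableC|exact: IH].
have updK w : upd (Z w) (Z w j) = Z w by apply/funext => i; rewrite /upd; case: eqP => [->|].
apply/seteqP; split=> w /=.
  case E1 : (Z w j) => Ew; [left|right]; split => //; rewrite /E' /= -E1 updK//.
by case=> [[Zj]|[/negP/negbTE Zj]]; rewrite /E' /= -[X in upd _ X]Zj updK.
Qed.

Let K := prod_topology (fun _ : J => bool).

Lemma open_depends_on s E : depends_on s E -> open (E : set K).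
Proof.
move=> dE; rewrite openE => f Ef.
have : nbhs (f : K) [set g : K | forall j, j \in s -> g j = f j].
  elim: s {dE} => [|j s IH]; first by apply: filterS filterT => g.
  have hj : nbhs (f : K) (proj j @^-1` [set f j]).
    by apply: (@proj_continuous _ _ j f); apply: open_nbhs_nbhs; split=> //; exact: discrete_open.
  apply: filterS (filterI IH hj) => g [h1 h2] i; rewrite inE => /orP[/eqP -> //|]; exact: h1.
by apply: filterS => g fg; apply: dE Ef => j js; rewrite fg.
Qed.

(** Sets depending on finitely many bits are open and closed in the product of copies of [bool],
    which is compact by Tychonoff's theorem. *)
Lemma clopen_bigcup_finite (F : nat -> set (J -> bool)) (E : set (J -> bool)) :
  (forall n, exists s, depends_on s (F n)) -> (exists s, depends_on s E) ->
  E `<=` \bigcup_n F n -> exists N, E `<=` \bigcup_(n in [set n | (n < N)%N]) F n.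
Proof.
move=> dF [s dE] EF.
have cT : compact [set: K].
  have := @tychonoff J (fun=> bool) (fun=> setT) (fun=> bool_compact).
  by rewrite (_ : [set f | _] = setT)//; apply/seteqP; split.
have cE : compact (E : set K).
  apply: (subclosed_compact _ cT) => //; rewrite -(setCK E); apply: open_closedC.
  exact: open_depends_on (depends_onC dE).
have := (compact_near_coveringP (E : set K)).1 cE nat \oo
  (fun N f => exists2 n, (n < N)%N & F n f).
move=> /(_ _)[f Ef|N _ hN].
  have [n _ Fn] := EF f Ef; have [s' ds'] := dF n.
  exists (F n, [set N | (n < N)%N]) => /=; last by move=> [x N] [/= Fx nN]; exists n.
  split; last exact: nbhs_infty_gt.
  by apply: open_nbhs_nbhs; split=> //; exact: open_depends_on ds'.
by exists N => f Ef; have [n nN Fn] := hN N (leqnn N) f Ef; exists n.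
Qed.

End clopen_sets.

(** A separate name for the function type, so that it can carry the finitely dependent sets as its
    algebra. *)
Definition bitspace (I : choiceType) : Type := (I * nat)%type -> bool.

Section bitspace.
Variable I : choiceType.

HB.instance Definition _ := Pointed.copy (bitspace I) ((I * nat)%type -> bool).

Let finite_dependence : set (set (bitspace I)) := [set E | exists s, depends_on s E].

Let finite_dependence0 : finite_dependence set0.
Proof. by exists [::]; exact: depends_on0. Qed.

Let finite_dependenceU : setU_closed finite_dependence.
Proof. by move=> E F [s dE] [s' dF]; exists (s ++ s'); exact: depends_onU. Qed.

Let finite_dependenceC : setC_closed finite_dependence.
Proof. by move=> E [s dE]; exists s; exact: depends_onC. Qed.

HB.instance Definition _ := @isAlgebraOfSets.Build default_measure_display (bitspace I)
  finite_dependence finite_dependence0 finite_dependenceU finite_dependenceC.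

End bitspace.

Section kolmogorov.
Context {R : realType} {I : choiceType}.

Definition nth_rat (k : nat) : R := ratr (odflt 0 (choice.unpickle k : option rat)).

(* A real is coded by its rational lower cut. The clopen sets of the compact
   space of codes form an algebra on which every finitely additive measure is
   sigma-additive. *)
Definition bits (x : I -> R) : bitspace I := fun j => nth_rat j.2 < x j.1.

(** Total on the space of codes: a code that is no cut still gets the supremum of its rationals, an
    infinite supremum being sent to 0 by [fine]. *)
Definition unbits (f : bitspace I) (i : I) : R :=
  fine (esups (fun k => if f (i, k) then (nth_rat k)%:E else -oo%E) 0%N).

Lemma bitsK : cancel bits unbits.
Proof.
move=> x; apply/funext => i; rewrite /unbits.
rewrite (_ : esups _ _ = (x i)%:E)//; apply/eqP; rewrite eq_le; apply/andP; split.
  apply: ge_ereal_sup => _ [k _ <-]; rewrite /bits /=; case: ifP => [/ltW|_].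
    by rewrite lee_fin.
  exact: leNye.
rewrite leNgt; apply/negP => lt.
have [y ly yx] : exists2 y : R, (esups (fun k => if bits x (i, k) then (nth_rat k)%:E else -oo) 0%N <= y%:E)%E & y < x i.
  move: lt; case: (esups _ _) => [y| |]; rewrite ?lte_fin//.
    by exists y.
  by move=> _; exists (x i - 1) => //; [exact: leNye|rewrite ltrBlDr ltrDl].
have [r] := rat_in_itvoo yx; rewrite in_itv/= => /andP[yr rx].
have rE : nth_rat (choice.pickle r) = ratr r by rewrite /nth_rat choice.pickleK.
move: ly; apply/negP; rewrite -ltNge.
apply: lt_le_trans (_ : (ratr r)%:E <= _)%E; first by rewrite lte_fin.
apply: ereal_sup_ubound; exists (choice.pickle r) => //=.
by rewrite /bits /= rE rx.
Qed.

Lemma bits_cylinder (s : seq I) (u : seq (I * nat)) (E : set (bitspace I)) :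
  (forall j, j \in u -> j.1 \in s) -> depends_on u E ->
  <<s @cylinder_sets R I [set` s] >> (bits @^-1` E).
Proof.
move=> us; apply: (measurable_depends_on
  (S := g_sigma_algebraType (@cylinder_sets R I [set` s]))) => j ju.
apply: sub_sigma_algebra; exists j.1, [set y | nth_rat j.2 < y]; split=> //.
  exact: us.
by rewrite -set_itvoy.
Qed.

Lemma depends_on_coord (i : I) k : depends_on [:: (i, k)] [set f : bitspace I | f (i, k)].
Proof. by move=> f g fg /= fi; rewrite -fg// inE. Qed.

Lemma measurable_unbits (G : set (set (bitspace I))) (D : set I) :
  (forall i k, D i -> <<s G >> [set f | f (i, k)]) ->
  measurable_fun (setT : set (g_sigma_algebraType G))
    (unbits : _ -> g_sigma_algebraType (@cylinder_sets R I D)).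
Proof.
move=> mG; pose S := g_sigma_algebraType G.
suff h i : D i -> measurable_fun (setT : set S) (unbits^~ i).
  exact: (@measurable_fun_cylinder R _ S I D (fun i f => unbits f i) h).
move=> Di; apply: (@measurableT_comp _ _ _ _ _ _ (@fine R)); first exact: fine_measurable.
apply: measurable_fun_esups => k; apply: measurable_fun_ifT => //.
apply: (@measurable_fun_bool _ _ setT _ true); rewrite setTI.
by apply: mG.
Qed.

Variable p : seq I -> probability (g_sigma_algebraType (@cylinder_sets R I setT)) R.
Hypothesis p_consistent : forall s s', {subset s <= s'} ->
  forall E, <<s @cylinder_sets R I [set` s] >> E -> p s E = p s' E.

Let coords (u : seq (I * nat)) : seq I := [seq j.1 | j <- u].

Let supp (E : set (bitspace I)) : seq (I * nat) := xget [::] [set u | depends_on u E].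

Let mu (E : set (bitspace I)) : \bar R := p (coords (supp E)) (bits @^-1` E).

(** [mu] reads E through one chosen support. Any other support gives the same value, since both are
    compared on a common larger list by consistency. *)
Let muE (u : seq (I * nat)) (s : seq I) E : {subset coords u <= s} -> depends_on u E ->
  mu E = p s (bits @^-1` E).
Proof.
move=> us dE; have dvE : depends_on (supp E) E.
  exact: (@xgetPex _ [::] [set u | depends_on u E] (ex_intro _ u dE)).
have cu (v : seq (I * nat)) j : j \in v -> j.1 \in coords v by exact: map_f.
have mv := bits_cylinder (cu (supp E)) dvE.
have mu_ := bits_cylinder (fun j ju => us _ (cu u j ju)) dE.
rewrite /mu (p_consistent (s' := coords (supp E) ++ s) _ mv); last first.
  by move=> i; rewrite mem_cat => ->.
by rewrite -(p_consistent (s' := coords (supp E) ++ s) _ mu_)// => i; rewrite mem_cat orbC => ->.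
Qed.

Let mu0 : mu set0 = 0%E.
Proof. by rewrite /mu preimage_set0 measure0. Qed.

Let mu_ge0 E : (0 <= mu E)%E.
Proof. exact: measure_ge0. Qed.

(** By compactness, a disjoint sequence whose union is finitely dependent has only finitely many
    nonempty terms. *)
Let mu_sigma_additive : semi_sigma_additive mu.
Proof.
move=> F mF tF mU.
have [N UN] := clopen_bigcup_finite mF mU (@subset_refl _ _).
have F0 n : (N <= n)%N -> F n = set0.
  move=> Nn; apply/seteqP; split=> f // Fn.
  have [k /= kN Fk] : (\bigcup_(n in [set n | (n < N)%N]) F n) f by apply: UN; exists n.
  have nk : n = k by apply: tF => //; exists f.
  by move: kN; rewrite -nk ltnNge Nn.
have [u uF] := choice mF.
pose v := flatten [seq u n | n <- iota 0 N].
have uv n : (n < N)%N -> {subset u n <= v}.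
  by move=> nN j ju; apply/flatten_mapP; exists n => //; rewrite mem_iota.
have dU : depends_on v (\bigcup_n F n).
  move=> f g fg /UN[n nN Fn]; exists n => //; apply: (uF n f) => // j ju.
  by apply: fg; exact: uv ju.
have Fv n : mu (F n) = p (coords v) (bits @^-1` F n).
  have [Nn|nN] := leqP N n; first by rewrite F0// mu0 preimage_set0 measure0.
  by apply: (muE (u := v)) => //; exact: depends_onS (uv n nN) (uF n).
have mbF n : measurable (bits @^-1` F n : set (g_sigma_algebraType (@cylinder_sets R I setT))).
  apply: (measurable_depends_on (S := g_sigma_algebraType (@cylinder_sets R I setT)) _ (uF n)) => j _.
  by apply: sub_sigma_algebra; exists j.1, [set y | nth_rat j.2 < y]; split=> //; rewrite -set_itvoy.
have UE : bits @^-1` (\bigcup_n F n) = \big[setU/set0]_(n < N) bits @^-1` F n.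
  rewrite -(bigcup_mkord N (fun n => bits @^-1` F n)) -preimage_bigcup; congr (_ @^-1` _).
  by apply/seteqP; split=> // f [n nN Fn]; exists n.
have muU : mu (\bigcup_n F n) = (\sum_(n < N) mu (F n))%E.
  apply: etrans (muE (u := v) (s := coords v) _ dU) _ => //; rewrite UE.
  apply: etrans (measure_bigsetU (p (coords v)) mbF _ N) _.
    by move=> i j _ _ [x [Fi Fj]]; apply: tF => //; exists (bits x).
  by apply: eq_bigr => i _; rewrite Fv.
rewrite muU.
apply: cvg_near_cst; exists N => // n /= Nn.
rewrite (big_cat_nat (leq0n N) Nn)/= [X in (_ + X)%E]big_nat [X in (_ + X)%E]big1.
  by rewrite adde0 big_mkord.
by move=> i /andP[Ni _]; rewrite F0.
Qed.

HB.instance Definition _ := isMeasure.Build _ _ _ mu mu0 mu_ge0 mu_sigma_additive.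

Let K : measurableType _ := g_sigma_algebraType (@measurable _ (bitspace I)).

Let nu : {measure set K -> \bar R} := measure_extension mu.

Let nuE (u : seq (I * nat)) (s : seq I) (E : set (bitspace I)) : {subset coords u <= s} -> depends_on u E ->
  nu E = p s (bits @^-1` E).
Proof.
move=> us dE; have mE : measurable E by exists u.
exact: (etrans (measurable_mu_extE mu mE) (muE us dE)).
Qed.

Let nuT : nu setT = 1%E.
Proof. by rewrite (@nuE [::] [::])// preimage_setT probability_setT. Qed.

HB.instance Definition _ := Measure_isProbability.Build _ _ _ (measure_extension mu) nuT.

Let Pbit : probability K R := measure_extension mu.

(** The measure is extended from the algebra of codes to the sigma-algebra it generates, then
    transported to real coordinates by [unbits]. *)
Theorem kolmogorov_extension :
  exists P : probability (g_sigma_algebraType (@cylinder_sets R I setT)) R,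
    forall (s : seq I) E, <<s @cylinder_sets R I [set` s] >> E -> P E = p s E.
Proof.
have mS (E : set (bitspace I)) : measurable E -> measurable (E : set K) by exact: sub_sigma_algebra.
have mu_K : measurable_fun (setT : set K) (unbits : K -> g_sigma_algebraType (@cylinder_sets R I setT)).
  by apply: measurable_unbits => i k _; apply: mS; exists [:: (i, k)]; exact: depends_on_coord.
have mb : measurable_fun setT (bits : g_sigma_algebraType (@cylinder_sets R I setT) -> K).
  apply: (@measurability _ _ _ K _ _ (@measurable _ (bitspace I))) => //.
  move=> _ [E [u dE] <-]; rewrite setTI.
  apply: (measurable_depends_on (S := g_sigma_algebraType (@cylinder_sets R I setT)) _ dE) => j _.
  by apply: sub_sigma_algebra; exists j.1, [set y | nth_rat j.2 < y]; split=> //; rewrite -set_itvoy.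
exists (distribution Pbit (mfun_of mu_K)) => s E sE.
(* Agreement with [p s] is tested on this pi-system: sets depending on finitely many bits of the
   coordinates in s. *)
pose G : set (set (bitspace I)) := [set E | exists2 u, {subset coords u <= s} & depends_on u E].
have GE : <<s G >> (unbits @^-1` E).
  have : measurable_fun (setT : set (g_sigma_algebraType G))
      (unbits : _ -> g_sigma_algebraType (@cylinder_sets R I [set` s])).
    apply: measurable_unbits => i k is_; apply: sub_sigma_algebra.
    exists [:: (i, k)]; first by move=> j; rewrite inE => /eqP ->.
    by move=> f h fh /= fi; rewrite -fh// inE.
  by move=> /(_ measurableT _ sE); rewrite setTI.
have GI : setI_closed G.
  move=> E1 E2 [u us dE1] [v vs dE2]; exists (u ++ v); last exact: depends_onI.
  by move=> i; rewrite /coords map_cat mem_cat => /orP[/us|/vs].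
have GT : G setT by exists [::].
have GK : G `<=` @measurable _ K by move=> F [u _ dF]; apply: mS; exists u.
have := @g_sigma_algebra_measure_unique _ R K G GK (fun=> setT) (fun=> GT) _ Pbit
  (distribution (p s) (mfun_of mb)) GI _ _ _ GE.
rewrite bigcup_const; last by exists 0%N.
move=> /(_ erefl) h; apply: etrans (h _ _) _.
- by move=> F [u us dF]; exact: nuE dF.
- by move=> k; rewrite (le_lt_trans (probability_le1 _ _)) ?ltry.
- by congr (p s _); apply/seteqP; split=> x /=; rewrite bitsK.
Qed.

End kolmogorov.

(** * Linear relations and bases *)

Section linear_extension.
Context {R : fieldType} {T : Type} {I : eqType}.
Variables (v : I -> T -> R) (A : set I).

Definition linear_free (B : set I) : Prop :=
  forall (s : seq I) (c : I -> R), uniq s -> (forall b, b \in s -> B b) ->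
    (forall y, \sum_(b <- s) c b * v b y = 0) -> forall b, b \in s -> c b = 0.

(** Zorn's lemma: a linear relation involves finitely many members, all of which lie in a single set
    of a chain. By maximality, adding one more index creates a relation in which its coefficient is
    nonzero, so it can be solved for. *)
Lemma maximal_linear_free : exists B : set I, [/\ B `<=` A, linear_free B &
  forall i, A i -> exists (s : seq I) (c : I -> R), [/\ uniq s, forall b, b \in s -> B b &
    forall y, v i y = \sum_(b <- s) c b * v b y]].
Proof.
have [B [[BA fB] maxB]] : exists B, (B `<=` A /\ linear_free B) /\
    forall C, B `<` C -> ~ (C `<=` A /\ linear_free C).
  apply: (@Zorn_bigcup _ [set B | B `<=` A /\ linear_free B]) => F FP tF; split.
    by move=> i [C /FP[CA _]]; exact: CA.
  move=> s c us sF h b bs.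
  have [C FC sC] : exists2 C, F C & forall b, b \in s -> C b.
    have [C0 FC0 _] := sF b bs.
    elim: s sF {us h bs} => [|i s IH] sF; first by exists C0.
    have [C FC sC] := IH (fun b bs => sF b (mem_behead (s := i :: s) bs)).
    have [C' FC' C'i] := sF i (mem_head _ _).
    have [CC'|C'C] := tF _ _ FC FC'.
      by exists C' => // j; rewrite inE => /orP[/eqP -> //|/sC /CC'].
    by exists C => // j; rewrite inE => /orP[/eqP ->|/sC //]; exact: C'C.
  by have [_ fC] := FP C FC; exact: (fC s c us sC h b bs).
exists B; split=> // i Ai.
have [Bi|nBi] := pselect (B i).
  exists [:: i], (fun=> 1); split=> //; first by move=> b; rewrite inE => /eqP ->.
  by move=> y; rewrite big_seq1 mul1r.
have : ~ ((B `|` [set i]) `<=` A /\ linear_free (B `|` [set i])).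
  apply: maxB; split; first by move=> j; left.
  by move=> /(_ i (or_intror erefl)).
move=> /not_andP[|]; first by move=> h; exfalso; apply: h => j [/BA //|->].
move=> /existsNP[s /existsNP[c /not_implyP[us /not_implyP[sB /not_implyP[h /existsNP[b /not_implyP[bs cb]]]]]]].
have sB' j : j \in s -> j != i -> B j by move=> /sB[//|->]; rewrite eqxx.
have is_ : i \in s.
  apply: contrapT => /negP iNs; apply: cb; apply: (fB s c us _ h b bs) => j js.
  by apply: sB' => //; apply: contraNneq iNs => <-.
have ci : c i != 0.
  apply/eqP => ci0; apply: cb.
  have [->//|bi] := eqVneq b i.
  apply: (fB (rem i s) c (rem_uniq _ us)) => [j|y|].
  - by rewrite mem_rem_uniq// inE => /andP[ji js]; exact: sB'.
  - by have := h y; rewrite (big_rem i)//= ci0 mul0r add0r.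
  - by rewrite mem_rem_uniq// inE bi.
exists (rem i s), (fun b => - (c b / c i)); split; first exact: rem_uniq.
  by move=> j; rewrite mem_rem_uniq// inE => /andP[ji js]; exact: sB'.
move=> y; have := h y; rewrite (big_rem i)//= => /eqP; rewrite addr_eq0 => /eqP e.
apply: (mulfI ci); rewrite e -sumrN mulr_sumr; apply: eq_bigr => j _.
by rewrite mulNr mulrN; congr (- _); rewrite mulrA mulrCA mulfV ?mulr1.
Qed.

Definition linear_value (s : seq I) (c x : I -> R) : R := \sum_(b <- s) c b * x b.

(* Values prescribed on a basis of the span of the v i extend to a map of f which
   is additive for every x, at the price of depending only on the coordinates
   of f in that basis. *)
Lemma linear_extension : exists (span : set (T -> R)) (S : (T -> R) -> seq I) (c : (T -> R) -> I -> R),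
  [/\ forall i, A i -> span (v i),
      forall f g, span f -> span g -> span (f \- g),
      forall f, span f -> (forall b, b \in S f -> A b) /\
        forall y, f y = linear_value (S f) (c f) (v^~ y) &
      forall x f g, span f -> span g ->
        linear_value (S (f \- g)) (c (f \- g)) x =
        linear_value (S f) (c f) x - linear_value (S g) (c g) x].
Proof.
have [B [BA fB spanB]] := maximal_linear_free.
pose rep (f : T -> R) (s : seq I) (c : I -> R) :=
  [/\ uniq s, forall b, b \in s -> B b & forall y, f y = linear_value s c (v^~ y)].
pose span : set (T -> R) := [set f | exists sc : seq I * (I -> R), rep f sc.1 sc.2].
have [sc scP] : exists sc : (T -> R) -> seq I * (I -> R), forall f, span f -> rep f (sc f).1 (sc f).2.
  have /choice[sc scP] : forall f, exists sc : seq I * (I -> R), span f -> rep f sc.1 sc.2.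
    move=> f; have [[sc h]|h] := pselect (span f); first by exists sc.
    by exists ([::], fun=> 0) => /h.
  by exists sc.
(* Padding with zero coefficients brings two representations to a common support. *)
have ext (s t : seq I) c x : uniq s -> uniq t -> {subset s <= t} ->
    linear_value s c x = linear_value t (fun b => if b \in s then c b else 0) x.
  move=> us ut st; rewrite /linear_value.
  rewrite [RHS](bigID (fun b => b \in s))/= [X in _ + X]big1 ?addr0; last first.
    by move=> b /negbTE ->; rewrite mul0r.
  rewrite -[RHS]big_filter; have ps : perm_eq s [seq b <- t | b \in s].
    apply: uniq_perm => //; first exact: filter_uniq.
    by move=> b; rewrite mem_filter; case: (boolP (b \in s)) => //= /st.
  rewrite (perm_big _ ps)/= big_seq [RHS]big_seq; apply: eq_bigr => b.
  by rewrite mem_filter => /andP[-> _].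
(* Freeness forces equal coefficients on the common support, so the value is the same for every x
   and not only for the evaluations [v^~ y]. *)
have uniq_rep f s1 c1 s2 c2 x : rep f s1 c1 -> rep f s2 c2 -> linear_value s1 c1 x = linear_value s2 c2 x.
  move=> [us1 sB1 e1] [us2 sB2 e2]; pose t := undup (s1 ++ s2).
  have ut : uniq t by exact: undup_uniq.
  have st1 : {subset s1 <= t} by move=> b bs; rewrite mem_undup mem_cat bs.
  have st2 : {subset s2 <= t} by move=> b bs; rewrite mem_undup mem_cat bs orbT.
  rewrite (ext s1 t)// (ext s2 t)//; apply/eqP; rewrite -subr_eq0 -sumrB big_seq big1// => b bt.
  rewrite -mulrBl (fB t (fun b => (if b \in s1 then c1 b else 0) - (if b \in s2 then c2 b else 0)))//.
  - by rewrite mul0r.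
  - by move=> j; rewrite mem_undup mem_cat => /orP[/sB1|/sB2].
  - move=> y; under eq_bigr do rewrite mulrBl.
    by rewrite sumrB -!/(linear_value _ _ _) -!ext// -e1 -e2 subrr.
have rep_sub f g s1 c1 s2 c2 : rep f s1 c1 -> rep g s2 c2 ->
    exists t c, rep (f \- g) t c /\ forall x, linear_value t c x = linear_value s1 c1 x - linear_value s2 c2 x.
  move=> [us1 sB1 e1] [us2 sB2 e2]; pose t := undup (s1 ++ s2).
  have ut : uniq t by exact: undup_uniq.
  have st1 : {subset s1 <= t} by move=> b bs; rewrite mem_undup mem_cat bs.
  have st2 : {subset s2 <= t} by move=> b bs; rewrite mem_undup mem_cat bs orbT.
  exists t, (fun b => (if b \in s1 then c1 b else 0) - (if b \in s2 then c2 b else 0)).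
  have h x : linear_value t (fun b => (if b \in s1 then c1 b else 0) - (if b \in s2 then c2 b else 0)) x =
      linear_value s1 c1 x - linear_value s2 c2 x.
    by rewrite (ext s1 t)// (ext s2 t)// /linear_value -sumrB; apply: eq_bigr => b _; rewrite mulrBl.
  split=> //; split=> //.
    by move=> j; rewrite mem_undup mem_cat => /orP[/sB1|/sB2].
  by move=> y; rewrite h -e1 -e2.
exists span, (fun f => (sc f).1), (fun f => (sc f).2); split.
- by move=> i /spanB[s [c [us sB e]]]; exists (s, c).
- move=> f g [[s1 c1] r1] [[s2 c2] r2]; have [t [c [r _]]] := rep_sub _ _ _ _ _ _ r1 r2.
  by exists (t, c).
- by move=> f /scP[_ sB e]; split=> // b /sB /BA.
- move=> x f g sf sg; have [t [c [r h]]] := rep_sub _ _ _ _ _ _ (scP f sf) (scP g sg).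
  have sfg : span (f \- g) by exists (t, c).
  by rewrite -h; exact: (uniq_rep _ _ _ _ _ x (scP _ sfg) r).
Qed.

End linear_extension.

(** * Convolution powers and changes of time *)

Section powers.
Context {R : realType}.
Implicit Types (q : R -> probability R R) (mu : probability R R).

(** The default of the choice is the constant Dirac mass at 0, itself a convolution semigroup, so
    both branches satisfy the axioms. *)
Lemma convolution_power_semigroup mu : convolution_semigroup (convolution_power mu).
Proof.
rewrite /convolution_power; case: xgetP => [p _ [sp _]//|_].
exact: dirac_semigroup.
Qed.

Lemma convolution_powerE mu q : convolution_semigroup q -> same_law (q 1) mu ->
  forall t, 0 <= t -> same_law (convolution_power mu t) (q t).
Proof.
move=> sq q1; pose Q := [set p | convolution_semigroup p /\ same_law (p 1) mu].
have [sp p1] : Q (convolution_power mu).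
  exact: (@xgetPex _ (fun=> (\d_(0 : R) : probability R R)) Q (ex_intro _ q (conj sq q1))).
by apply: semigroup_unique => // D mD; rewrite (p1 D mD) (q1 D mD).
Qed.

(** Uniqueness is stated for semigroups that agree at time 1; this change of time brings any
    positive time a there. *)
Lemma semigroup_scale q a : 0 < a -> convolution_semigroup q ->
  convolution_semigroup (fun t => q (a * t)).
Proof.
move=> a0 sq; split.
- by rewrite mulr0; exact: cs_zero.
- by move=> s t s0 t0; rewrite mulrDr; apply: cs_add => //; rewrite mulr_ge0// ltW.
- move=> f cf bf; have := cs_cvg0 sq cf bf; apply: cvg_comp.
  move=> D [e /= e0 De]; exists (e / a) => /=; first exact: divr_gt0.
  move=> t /= te t0; apply: De; rewrite /= ?mulr_gt0//.
  move: te; rewrite !sub0r !normrN normrM (gtr0_norm a0) => te.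
  by rewrite mulrC -ltr_pdivlMr.
Qed.

Lemma infinitely_divisible_same_law mu nu : same_law mu nu ->
  infinitely_divisible nu -> infinitely_divisible mu.
Proof.
move=> h idn n n0; have [xi hxi] := idn n n0.
by exists xi => D mD; rewrite (h D mD) (hxi D mD).
Qed.

Lemma semigroup_determined q q' a : 0 < a -> convolution_semigroup q ->
  convolution_semigroup q' -> same_law (q a) (q' a) ->
  forall t, 0 <= t -> same_law (q t) (q' t).
Proof.
move=> a0 sq sq' h t t0.
have := @semigroup_unique _ _ _ (semigroup_scale a0 sq) (semigroup_scale a0 sq').
have e : a * (t / a) = t by rewrite mulrCA mulfV ?mulr1 ?gt_eqF.
by rewrite !mulr1 => /(_ h (t / a)); rewrite e; apply; rewrite divr_ge0// ltW.
Qed.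

End powers.

(** * Indexing collections *)

Section indexing.
Context {R : realType} {d : measure_display} {T : measurableMetricType R d}.
Hypothesis T_borel : @measurable d T = <<s @open T >>.
Variable m : {measure set T -> \bar R}.
Hypothesis m_radon : radon_measure m.
Variable A : set (set T).
Variables (B : nat -> set T) (An : nat -> set (set T)) (g : nat -> set T -> set T).
Hypothesis HA : is_indexing_collection A B An g.
Hypothesis m_empty_prime : m (empty_prime A) = 0%E.
Hypothesis m_continuous : monotonically_continuous m A.
Implicit Types U V W : set T.

Lemma open_measurableT U : open U -> measurable U.
Proof. by move=> oU; rewrite T_borel; exact: sub_sigma_algebra. Qed.

Lemma closed_measurableT U : closed U -> measurable U.
Proof.
by move=> cU; rewrite -(setCK U); apply: measurableC; apply: open_measurableT; exact: closed_openC.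
Qed.

Lemma A_closed U : A U -> closed U.
Proof. by move=> /(ic_compact HA); apply: compact_closed; exact: metric_hausdorff. Qed.

Lemma A_measurable U : A U -> measurable U.
Proof. by move=> /A_closed; exact: closed_measurableT. Qed.

Lemma A_ltoo U : A U -> (m U < +oo)%E.
Proof. by move=> /(ic_compact HA); exact: radon_compact. Qed.

Lemma A_setI U V : A U -> A V -> A (U `&` V).
Proof.
move=> AU AV; rewrite (_ : U `&` V = \bigcap_(W in [set U; V]) W).
  by apply: (ic_bigcap HA); [exists U; left|move=> _ [->|->]].
apply/seteqP; split=> [x [Ux Vx] _ [->|->]//|x h].
by split; apply: h; [left|right].
Qed.

Lemma B_compact n : compact (B n).
Proof.
have [k [U [AU ->]]] := ic_B_unions HA n.
rewrite (_ : \bigcup_i U i = \big[setU/set0]_(i <- enum 'I_k.+1) U i); last first.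
  by rewrite -bigcup_seq; apply/seteqP; split=> x [i _ Uix]; exists i => //=; rewrite mem_enum.
by apply: bigsetU_compact => i _; exact: (ic_compact HA).
Qed.

Lemma subset_B U : compact U -> exists n, U `<=` (B n)°.
Proof.
rewrite compact_cover => cU.
have [|D' _ UD'] := cU nat setT (fun n => (B n)°) (fun n _ => @open_interior _ (B n)).
  by move=> x _; have : setT x by []; rewrite -(ic_B_cover HA).
exists (\max_(i <- D') i)%N => x /UD'[i /= iD' Bi].
apply: (interiorS _ Bi); apply: (ic_B_increasing HA).
exact: (@leq_bigmax_seq _ _ xpredT id).
Qed.

(** Finite intersections of nonempty members are nonempty members, so compactness gives a point
    common to all of them. *)
Lemma A_empty_prime : A (empty_prime A) /\ empty_prime A !=set0.
Proof.
have [n [x Bx]] : exists n, B n !=set0.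
  have : [set: T] point by []; rewrite -(ic_B_cover HA) => -[n _ /interior_subset Bn].
  by exists n, point.
have [k [U [AU BE]]] := ic_B_unions HA n.
have [i _ Uix] : (\bigcup_i U i) x by rewrite -BE.
pose D := [set U | A U /\ U <> set0].
have DU : D (U i) by split => // U0; move: Uix; rewrite U0.
split; first by apply: (ic_bigcap HA) => [|V []//]; exists (U i).
have := ic_compact HA (AU i); rewrite compact_In0 => /(_ _ D (fun V => U i `&` V))[].
- by exists id => // V [AV _]; exact: A_closed.
- move=> D' D'D; have D'D2 V : V \in [fset V | V in D']%fset -> D V.
    by rewrite !inE => /D'D; rewrite inE.
  suff [AX [y Xy]] : A (foldr setI (U i) D') /\ foldr setI (U i) D' !=set0.
    have sub (l : seq (set T)) : foldr setI (U i) l y -> U i y /\ forall V, V \in l -> V y.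
      elim: l => //= W l IH [Wy /IH[Uy ly]]; split => // V; rewrite inE => /orP[/eqP ->|/ly]//.
    by have [Uy ly] := sub _ Xy; exists y => V /= VD'; split => //; exact: ly.
  have {}D'D2 V : V \in enum_fset D' -> D V by move=> VD'; apply: set_mem; exact: D'D.
  elim: (enum_fset D') D'D2 => [_|W s IH sD] /=; first by split => //; exists x.
  have [|AX X0] := IH; first by move=> V Vs; apply: sD; rewrite inE Vs orbT.
  have [AW /eqP/set0P W0] : D W by apply: sD; rewrite inE eqxx.
  by split; [exact: A_setI|exact: (ic_setI_neq0 HA)].
- by move=> y h; exists y => V VD; have [] := h V VD.
Qed.

Lemma empty_prime_sub U : A U -> U !=set0 -> empty_prime A `<=` U.
Proof. by move=> AU /set0P/eqP U0 x; apply. Qed.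

Lemma m_decreasing_cvg (U : nat -> set T) : (forall n, measurable (U n)) ->
  (m (U 0%N) < +oo)%E -> (forall n k, (n <= k)%N -> U k `<=` U n) ->
  m (U n) @[n --> \oo] --> m (\bigcap_n U n).
Proof.
move=> mU U0 dU; apply: nonincreasing_cvg_mu => //.
- exact: bigcap_measurable.
- by move=> n k nk; apply/subsetPset; exact: dU.
Qed.

(** Balls of radius 1 / (n + 1) around finite nets of U. This countable family is what
    [A_intermediate] enumerates. *)
Lemma compact_countable_base U : compact U -> exists Bs : nat -> set T,
  (forall V x, closed V -> U x -> ~ V x -> exists k, Bs k x /\ Bs k `&` V = set0).
Proof.
move=> cU; pose e n : R := n.+1%:R^-1.
have e0 n : 0 < e n by rewrite invr_gt0.
have cov n : exists s : seq T, forall x, U x -> exists2 c, c \in s & ball c (e n) x.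
  have := cU; rewrite compact_cover => /(_ _ U (fun c => (ball c (e n))°))[].
  - by move=> c _; exact: open_interior.
  - by move=> x Ux; exists x => //; apply: nbhsx_ballx.
  - by move=> D' _ UD'; exists (enum_fset D') => x /UD'[c cD' /interior_subset]; exists c.
have [s sP] := choice cov.
exists (fun k => if (choice.unpickle k : option (nat * nat)) is Some nj then
  ball (nth point (s nj.1) nj.2) (e nj.1) else set0).
move=> V x cV Ux Vx.
have : nbhs x (~` V) by apply: open_nbhs_nbhs; split => //; exact: closed_openC.
move=> /nbhs_ballP[r /= r0 rV].
(* Twice the radius is at most r, so a ball of the family that contains x lies within distance r of
   x. *)
pose n := Num.truncn (2 / r).
have er : e n + e n <= r.
  rewrite -mulr2n -mulr_natl ler_pdivrMr// mulrC -ler_pdivrMr//.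
  exact/ltW/truncnS_gt.
have [c cs cx] := sP n x Ux.
exists (choice.pickle (n, index c (s n))); rewrite choice.pickleK/= nth_index//; split => //.
rewrite -subset0 => y [cy Vy]; apply: (rV y) => //.
by apply: (le_ball er); apply: ball_triangle cy; exact: ball_sym.
Qed.

(* W is maximal among the members of A between V0 and U with mass at most s, built
   as the closure of an increasing sequence meeting the sets of a countable base
   one by one whenever possible. If its mass were less than s, then W would be
   the trace on U of some g_n W, hence open and closed in the connected set U. *)
Lemma A_intermediate V0 U s : A V0 -> V0 !=set0 -> A U -> V0 `<=` U ->
  (m V0 <= s)%E -> (s <= m U)%E ->
  exists W, [/\ A W, V0 `<=` W, W `<=` U & m W = s].
Proof.
move=> AV0 V00 AU V0U V0s sU.
have [Bs BsP] := compact_countable_base (ic_compact HA AU).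
pose Q W := [/\ A W, V0 `<=` W, W `<=` U & (m W <= s)%E].
pose C k V W := [/\ Q W, V `<=` W & W `&` Bs k !=set0].
have nxt k V : exists W, Q V -> [/\ Q W, V `<=` W & (exists W', C k V W') -> W `&` Bs k !=set0].
  have [[W [QW VW WO]]|nC] := pselect (exists W', C k V W').
    by exists W => _; split.
  by exists V => QV; split.
have {}nxt : exists f : nat -> set T -> set T, forall k V, Q V ->
    [/\ Q (f k V), V `<=` f k V & (exists W', C k V W') -> f k V `&` Bs k !=set0].
  have h (kV : nat * set T) := nxt kV.1 kV.2.
  have [f fP] := choice h; exists (fun k V => f (k, V)) => k V; exact: (fP (k, V)).
have [f fP] := nxt.
pose F := fix F k := if k is k'.+1 then f k' (F k') else V0.
have QF k : Q (F k).
  by elim: k => [|k IH] /=; [split|have [] := fP k _ IH].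
have FS k : F k `<=` F k.+1 by have [] := fP k _ (QF k).
have Finc : increasing_sets F.
  by move=> n k /subnK <-; elim: (k - n)%N => //= j IH; apply: (subset_trans IH); exact: FS.
pose V := closure (\bigcup_k F k).
have FV k : F k `<=` V by move=> x Fx; apply: subset_closure; exists k.
have AF k : A (F k) by have [] := QF k.
have AV : A V.
  apply: (ic_closure_bigcup HA) => //; have [n Un] := subset_B (ic_compact HA AU).
  exists n => i x Fx; apply: interior_subset; apply: Un.
  by have [_ _ + _] := QF i; apply.
have VU : V `<=` U.
  rewrite [X in _ `<=` X]((closure_id U).1 (A_closed AU)).
  by apply: closureS => x [k _]; have [_ _ + _] := QF k; apply.
have V0V : V0 `<=` V by exact: (FV 0%N).
have Vs : (m V <= s)%E.
  apply: (cvge_to_le (m_continuous AF Finc AV)).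
  by apply: nearW => k; have [] := QF k.
(* A point of W outside V has a base set that contains it and misses V; but W shows that this base
   set could be met at its stage, so V meets it. *)
have maxV W : Q W -> V `<=` W -> W `<=` V.
  move=> [AW V0W WU Ws] VW x Wx; apply: contrapT => Vx.
  have [k [Okx OkV]] := BsP V x (A_closed AV) (WU x Wx) Vx.
  have [_ _ []] := fP k _ (QF k).
    exists W; split=> //; last by exists x.
    exact: (subset_trans (FV k)).
  move=> y [Fy Oy]; have : (Bs k `&` V) y by split => //; exact: (FV k.+1).
  by rewrite OkV.
exists V; split=> //; apply/eqP; rewrite eq_le Vs/=.
pose W n := g n V `&` U.
have AW n : A (W n) by exact: (ic_g_setI HA).
have VW n : V `<=` W n.
  by move=> x Vx; split; [exact: (interior_subset (ic_g_interior HA n AV Vx))|exact: VU].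
have WU n : W n `<=` U by move=> x [].
have Wdec n k : (n <= k)%N -> W k `<=` W n.
  by move=> nk x [gx Ux]; split => //; exact: (ic_g_decreasing HA AV nk).
have capW : \bigcap_n W n = V.
  apply/seteqP; split=> [x h|x Vx n _]; last exact: VW.
  by rewrite (ic_g_limit HA AV) => n _; have [] := h n Logic.I.
have Wcvg : m (W n) @[n --> \oo] --> m V.
  rewrite -capW; apply: m_decreasing_cvg => //; first by move=> n; exact: A_measurable.
  exact: A_ltoo.
have [[n Wns]|nW] := pselect (exists n, (m (W n) <= s)%E); last first.
  apply: (cvge_to_ge Wcvg); apply: nearW => n; rewrite leNgt; apply/negP => Wns.
  by apply: nW; exists n; exact: ltW.
have WV : W n = V.
  apply/seteqP; split=> //; apply: maxV => //; split => //.
  exact: subset_trans (VW n).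
have -> : V = U; last by [].
apply: (ic_connected HA AU).
- by have [x /V0V] := V00; exists x.
- exists (g n V)°; first exact: open_interior.
  apply/seteqP; split=> [x Vx|x [Ux /interior_subset gx]].
    by split; [exact: VU|exact: (ic_g_interior HA n AV)].
  by rewrite -WV.
- exists V; first exact: A_closed.
  by rewrite setIidr.
Qed.

Lemma A_decreasing_bigcap (U : nat -> set T) : (forall n, A (U n)) ->
  A (\bigcap_n U n).
Proof.
move=> AU; rewrite (_ : \bigcap_n U n = \bigcap_(W in range U) W).
  by apply: (ic_bigcap HA) => [|_ [n _ <-]//]; exists (U 0%N), 0%N.
by apply/seteqP; split=> [x h _ [n _ <-]|x h n _]; [exact: h|apply: h; exists n].
Qed.

Section set_limits.
Variables (U : nat -> set T) (V : set T).
Hypotheses (AU : forall n, A (U n)) (AV : A V).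
Let In n := \bigcap_(k in [set k | (n <= k)%N]) U k.
Let Sn n := closure (\bigcup_(k in [set k | (n <= k)%N]) U k).
Hypotheses (inf_lim : closure (\bigcup_n In n) = V) (sup_lim : \bigcap_n Sn n = V).

Lemma A_tail_bigcap n : A (In n).
Proof.
apply: (_ : A (\bigcap_(W in [set W | exists2 k, (n <= k)%N & W = U k]) W) -> _).
  rewrite (_ : \bigcap_(W in _) W = In n)//; apply/seteqP; split.
    by move=> x h k nk; apply: h; exists k.
  by move=> x h _ [k nk ->]; exact: h.
by apply: (ic_bigcap HA) => [|_ [k _ ->]//]; exists (U n), n.
Qed.

Lemma tail_bigcap_sub n : In n `<=` U n.
Proof. by move=> x; apply => /=. Qed.

Lemma tail_bigcap_sub_lim n : In n `<=` V.
Proof. by rewrite -inf_lim => x Ix; apply: subset_closure; exists n. Qed.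

Let In_inc : increasing_sets In.
Proof. by move=> n k nk x h j /= kj; apply: h => /=; exact: leq_trans kj. Qed.

Let Sn_dec n k : (n <= k)%N -> Sn k `<=` Sn n.
Proof.
move=> nk; apply: closureS => x [j /= kj Ux]; exists j => //=; exact: leq_trans kj.
Qed.

Let US n k : (n <= k)%N -> U k `<=` Sn n.
Proof. by move=> nk x Ux; apply: subset_closure; exists k. Qed.

Let B_closed n : closed (B n).
Proof. by apply: compact_closed; [exact: metric_hausdorff|exact: B_compact]. Qed.

(** Closures of tails have finite mass only once the tails are bounded. The shell of [B N] outside
    its interior is compact and misses V, hence misses some [Sn n]; a connected [U k] that meets the
    interior cannot cross it. *)
Lemma tail_bounded : exists n N, forall k, (n <= k)%N -> U k `<=` B N.
Proof.
have [N VB] := subset_B (ic_compact HA AV).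
have [AE E0] := A_empty_prime.
have [V0|/nonemptyPn V0] := pselect (V !=set0); last first.
  apply: contrapT => h.
  (* With V empty, nonempty [U k] of arbitrarily high rank would put the smallest nonempty member
     inside every [Sn n], hence inside V. *)
  have EV : empty_prime A `<=` V.
    rewrite -sup_lim => x Ex n _.
    have [k [nk Uk]] : exists k, (n <= k)%N /\ U k !=set0.
      apply: contrapT => h'; apply: h; exists n, 0%N => k nk y Uy; exfalso; apply: h'.
      by exists k; split=> //; exists y.
    exact: (US nk (empty_prime_sub (AU k) Uk Ex)).
  by have [x /EV] := E0; rewrite V0.
pose F := B N `\` (B N)°.
have cF : compact F.
  apply: (subclosed_compact _ (@B_compact N)); last by move=> x [].
  by apply: closedI; [exact: B_closed|apply: open_closedC; exact: open_interior].
have [n nF] : exists n, forall x, Sn n x -> F x -> False.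
  apply: contrapT => h; move: cF; rewrite compact_In0 => /(_ nat setT (fun n => F `&` Sn n))[].
  - by exists Sn => // n _; exact: closed_closure.
  - move=> D' _; pose n := (\max_(i <- D') i)%N.
    have [x [Sx Fx]] : exists x, Sn n x /\ F x.
      by apply: contrapT => h'; apply: h; exists n => x Sx Fx; apply: h'; exists x.
    exists x => i /= iD'; split=> //; apply: (Sn_dec _ Sx).
    exact: (@leq_bigmax_seq _ _ xpredT id).
  - move=> x h'; have Vx : V x by rewrite -sup_lim => n _; have [] := h' n Logic.I.
    by have [[_ + ] _] := h' 0%N Logic.I; apply; exact: VB.
exists n, N => k nk.
have [Uk0|/nonemptyPn ->] := pselect (U k !=set0); last by [].
have UB : U k `&` (B N)° = U k `&` B N.
  apply/seteqP; split=> x [Ux]; first by move=> /interior_subset.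
  move=> Bx; split => //; apply: contrapT => nB; apply: (nF x) => //.
  exact: (US nk).
have <- : U k `&` B N = U k; last by move=> x [].
apply: (ic_connected HA (AU k)).
- have [x Ex] := E0; exists x; split; first exact: empty_prime_sub Ex.
  by apply: interior_subset; apply: VB; exact: empty_prime_sub Ex.
- by exists (B N)°; [exact: open_interior|rewrite UB].
- by exists (B N).
Qed.

(** The sets [In n] increase to V in mass by monotone continuity, while the sets [Sn n] decrease to
    V with finite mass; [U n] lies between the two. *)
Lemma tail_measure_cvg :
  m (U n `\` In n) @[n --> \oo] --> 0%E /\ m (V `\` In n) @[n --> \oo] --> 0%E.
Proof.
have mV := A_measurable AV.
have mI n := A_measurable (A_tail_bigcap n).
have mU n := A_measurable (AU n).
have mS n : measurable (Sn n) by apply: closed_measurableT; exact: closed_closure.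
have fV : m V \is a fin_num by rewrite ge0_fin_numE// A_ltoo.
have Icvg : m (In n) @[n --> \oo] --> m V.
  rewrite -inf_lim; apply: m_continuous => //; first exact: A_tail_bigcap.
  by rewrite inf_lim.
have fI n : m (In n) \is a fin_num by rewrite ge0_fin_numE// A_ltoo//; exact: A_tail_bigcap.
have [n0 [N UB]] := tail_bounded.
have SB : Sn n0 `<=` B N.
  rewrite [X in _ `<=` X]((closure_id _).1 (@B_closed N)); apply: closureS => x [k /= nk].
  exact: UB.
have mB : (m (B N) < +oo)%E by apply: radon_compact => //; exact: B_compact.
have Soo n : (n0 <= n)%N -> (m (Sn n) < +oo)%E.
  move=> n0n; apply: le_lt_trans mB; apply: le_measure; rewrite ?inE//.
    exact: closed_measurableT.
  exact: (subset_trans (Sn_dec n0n)).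
have Scvg : m (Sn n) @[n --> \oo] --> m V.
  rewrite -(cvg_shiftn n0)/= -sup_lim.
  rewrite (_ : \bigcap_n Sn n = \bigcap_n Sn (n + n0)%N); last first.
    apply/seteqP; split=> x h n _; first exact: h.
    by apply: (Sn_dec (leq_addr n0 n)); exact: h.
  apply: m_decreasing_cvg => //; first exact: Soo.
  by move=> n k nk; apply: Sn_dec; rewrite leq_add2r.
have diff (X : nat -> set T) : (forall n, measurable (X n)) -> (forall n, In n `<=` X n) ->
    (\forall n \near \oo, (m (X n) < +oo)%E) ->
    m (X n) @[n --> \oo] --> m V -> m (X n `\` In n) @[n --> \oo] --> 0%E.
  move=> mX IX Xoo Xcvg; rewrite -(subee fV).
  have : (m (X n) - m (In n))%E @[n --> \oo] --> (m V - m V)%E.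
    by apply: cvgeB => //; exact: fin_num_adde_defr.
  apply: cvg_trans; apply: near_eq_cvg; near=> n.
  rewrite measureD//; last by near: n.
  by rewrite setIidr.
split.
- apply: (@squeeze_cvge _ _ _ _ (fun=> 0%E) _ (fun n => m (Sn n `\` In n))).
  + apply: nearW => n; rewrite measure_ge0/= le_measure ?inE//; try exact: measurableD.
    by apply: setSD; exact: US.
  + exact: cvg_cst.
  + apply: diff => //; last by exists n0.
    by move=> n; apply: (subset_trans (@tail_bigcap_sub n)); exact: US.
- apply: diff => //; first by move=> n; exact: tail_bigcap_sub_lim.
    by apply: nearW => n; exact: A_ltoo.
  exact: cvg_cst.
Unshelve. all: by end_near.
Qed.

End set_limits.

Implicit Types C : set T.

Let A0 : A set0 := ic_set0 HA.

Definition mr C : R := fine (m C).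

Lemma class_C_measurable C : class_C A C -> measurable C.
Proof.
move=> [n [U0 [U [AU0 AU ->]]]]; apply: measurableD; first exact: A_measurable.
by apply: fin_bigcup_measurable => // i _; exact: A_measurable.
Qed.

Lemma class_C_ltoo C : class_C A C -> (m C < +oo)%E.
Proof.
move=> CC; have mC := class_C_measurable CC; move: CC mC => [n [U0 [U [AU0 AU ->]]]] mC.
apply: le_lt_trans (A_ltoo AU0); apply: le_measure; rewrite ?inE//; exact: A_measurable.
Qed.

Lemma mrE C : class_C A C -> m C = (mr C)%:E.
Proof. by move=> /class_C_ltoo h; rewrite fineK// ge0_fin_numE. Qed.

Lemma mr_ge0 C : 0 <= mr C.
Proof. exact: fine_ge0. Qed.

Lemma mr0 : mr set0 = 0.
Proof. by rewrite /mr measure0. Qed.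

Lemma mr_split C V : class_C A C -> A V -> mr C = mr (C `&` V) + mr (C `\` V).
Proof.
move=> CC AV; apply: EFin_inj; rewrite EFinD -!mrE//; last 2 first.
- exact: class_C_setD.
- by apply: class_C_setI => //; exact: A_setI.
rewrite -measureU; last 3 first.
- by apply: measurableI; [exact: class_C_measurable|exact: A_measurable].
- by apply: measurableD; [exact: class_C_measurable|exact: A_measurable].
- by apply/seteqP; split=> y // [[_ ?] []].
by rewrite setUIDK.
Qed.

Lemma mr_setD U W : A U -> A W -> U `<=` W -> mr (W `\` U) = mr W - mr U.
Proof.
move=> AU AW UW; rewrite (mr_split (class_C_A AW) AU) setIidr//.
by rewrite [X in X - _]addrC addrK.
Qed.

Lemma mr_intermediate V0 U s : A V0 -> V0 !=set0 -> A U -> V0 `<=` U ->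
  mr V0 <= s <= mr U -> exists W, [/\ A W, V0 `<=` W, W `<=` U & mr W = s].
Proof.
move=> AV0 V00 AU VU /andP[h1 h2].
have [|//|W [AW VW WU mW]] := A_intermediate AV0 V00 AU VU (s := s%:E).
  by rewrite (mrE (class_C_A AV0)) lee_fin.
  by rewrite (mrE (class_C_A AU)) lee_fin.
by exists W; split; rewrite /mr ?mW.
Qed.

(** * The convolution semigroup of a process *)

Section process.
Context {dO : measure_display} {Omega : measurableType dO} {P : probability Omega R}.
Variable X : set T -> {RV P >-> R}.
Hypothesis defX : definite_increments A X.
Hypothesis indX : independent_increments A X.

Let X0 w : X set0 w = 0. Proof. by have [] := defX. Qed.

Lemma increment_setD0 U : A U -> increment A X (U `\` set0) = X U.
Proof. by move=> AU; apply/mfuneqP => w; rewrite setD0 (increment_A defX). Qed.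

Lemma cfv_chain U W u : A U -> A W -> U `<=` W ->
  cfv P (X W) u = cfv P (X U) u * cfv P (increment A X (W `\` U)) u.
Proof.
move=> AU AW UW; have := cfv_increment_split A_setI indX defX u (class_C_A AW) AU.
rewrite setIidr// => h.
have e V : A V -> cfv P (increment A X V) u = cfv P (X V) u.
  by move=> AV; congr (cfv P _ u); apply/funext => w; exact: increment_A.
by rewrite -!e.
Qed.

Lemma law_class_C q : convolution_semigroup q ->
  (forall U, A U -> same_law (law (X U)) (q (mr U))) ->
  forall C, class_C A C -> same_law (law (increment A X C)) (q (mr C)).
Proof.
move=> sq XU C /class_C_list[U0 [s [AU0 As ->]]]; apply: cf_injective => u.
elim: s U0 AU0 As => [|V s IH] U0 AU0 As.
  have -> : list_diff U0 [::] = U0 by apply/seteqP; split=> y; [case|split].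
  rewrite -(cf_same_law (XU _ AU0)); congr (cf (law _) u).
  by rewrite -increment_setD0// setD0.
have AV : A V by apply: As; rewrite mem_head.
have {}As W : W \in s -> A W by move=> Ws; apply: As; rewrite inE Ws orbT.
set D := list_diff U0 s.
have DC : class_C A D by apply/class_C_list; exists U0, s.
have DV : D `&` V = list_diff (U0 `&` V) s.
  by apply/seteqP; split=> y; [move=> [[? ?] ?]|move=> [[? ?] ?]].
have DVc : D `\` V = list_diff U0 (V :: s).
  apply/seteqP; split=> y.
    by move=> [[? h] ?]; split=> // W; rewrite inE => /orP[/eqP ->//|]; exact: h.
  move=> [? h]; split; last by apply: h; rewrite inE eqxx.
  by split=> // W Ws; apply: h; rewrite inE Ws orbT.
have := cfv_increment_split A_setI indX defX u DC AV.
rewrite -!cf_law IH// DV IH//; last exact: A_setI.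
rewrite -DVc (mr_split DC AV) DV (cf_semigroupD sq) ?mr_ge0//.
(* The law over the difference is isolated by cancelling the factor over the trace, which is
   legitimate because it never vanishes. *)
by move=> /(mulfI (cf_semigroup_neq0 sq _ (mr_ge0 _))) ->.
Qed.

Section semigroup_construction.
(** [H1] and [H2] are the common ground of Lévy processes and stationary scattered measures.
    Continuity is asked only along decreasing sequences whose mass tends to 0. *)
Hypothesis H1 : forall U W U' W', A U -> A W -> A U' -> A W' ->
  U `<=` W -> U' `<=` W' -> m (W `\` U) = m (W' `\` U') ->
  same_law (law (increment A X (W `\` U))) (law (increment A X (W' `\` U'))).
Hypothesis H2 : forall U : nat -> set T, (forall n, A (U n)) ->
  (forall n k, (n <= k)%N -> U k `<=` U n) -> mr (U n) @[n --> \oo] --> 0 ->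
  forall e, 0 < e -> P [set w | e < `|X (U n) w|] @[n --> \oo] --> 0%E.

Let mE_mr C D : class_C A C -> class_C A D -> mr C = mr D -> m C = m D.
Proof. by move=> CC CD h; rewrite !mrE// h. Qed.

Let cfX U W : A U -> A W -> mr U = mr W -> cfv P (X U) =1 cfv P (X W).
Proof.
move=> AU AW UW u; rewrite -!cf_law; apply: cf_same_law.
rewrite -!increment_setD0//; apply: H1 => //; rewrite !setD0.
by apply: mE_mr => //; exact: class_C_A.
Qed.

Let cfD U W Z : A U -> A W -> A Z -> U `<=` W -> mr W - mr U = mr Z ->
  cfv P (increment A X (W `\` U)) =1 cfv P (X Z).
Proof.
move=> AU AW AZ UW e u; rewrite -!cf_law; apply: cf_same_law.
rewrite -(increment_setD0 AZ); apply: H1 => //.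
apply: mE_mr; rewrite ?setD0; [|exact: class_C_A|by rewrite mr_setD].
by apply: class_C_setD => //; exact: class_C_A.
Qed.

Let cf1 U : A U -> mr U = 0 -> cfv P (X U) =1 fun=> 1.
Proof.
move=> AU U0 u; rewrite (cfX AU A0) ?mr0//.
by rewrite (cfv_eq0 X0).
Qed.

Let nonempty_of_mr U : 0 < mr U -> U !=set0.
Proof.
move=> U0; apply: contrapT => /nonemptyPn h; by move: U0; rewrite h mr0 ltxx.
Qed.

Let E := empty_prime A.
Let AE : A E. Proof. by have [] := A_empty_prime. Qed.
Let E0 : E !=set0. Proof. by have [] := A_empty_prime. Qed.
Let mE0 : mr E = 0. Proof. by rewrite /mr m_empty_prime. Qed.

Section positive_mass.
Variable U0 : set T.
Hypotheses (AU0 : A U0) (U0_gt0 : 0 < mr U0).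
Let c := mr U0.
Let EU0 : E `<=` U0 := empty_prime_sub AU0 (nonempty_of_mr U0_gt0).

(** No monotonicity in t is required: the law depends on the mass alone, so one representative of
    each mass is enough. *)
Let S_ex : exists S : R -> set T, forall t, 0 <= t <= c ->
  [/\ A (S t), E `<=` S t, S t `<=` U0 & mr (S t) = t].
Proof.
suff h t : exists W, 0 <= t <= c -> [/\ A W, E `<=` W, W `<=` U0 & mr W = t].
  by have [S SP] := choice h; exists S.
have [tc|] := boolP (0 <= t <= c); last by exists set0.
by have [|W WP] := @mr_intermediate E U0 t AE E0 AU0 EU0; [rewrite mE0|exists W].
Qed.

Let S := projT1 (cid S_ex).
Let SP t : 0 <= t <= c -> [/\ A (S t), E `<=` S t, S t `<=` U0 & mr (S t) = t].
Proof. exact: (projT2 (cid S_ex)). Qed.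

Let phi t u := cfv P (X (S t)) u.

Let phi_law U : A U -> mr U <= c -> cfv P (X U) =1 phi (mr U).
Proof.
move=> AU Uc; have [|AS _ _ mS] := @SP (mr U); first by rewrite mr_ge0.
by apply: cfX.
Qed.

(** Above [S s] there is a member W of mass s + t; the difference has mass t, hence by [H1] the law
    of the process at [S t]. *)
Let phiD s t u : 0 <= s -> 0 <= t -> s + t <= c -> phi (s + t) u = phi s u * phi t u.
Proof.
move=> s0 t0 stc.
have [|AS ES SU mS] := @SP s; first by rewrite s0 (le_trans _ stc)// lerDl.
have [|At _ _ mt] := @SP t; first by rewrite t0 (le_trans _ stc)// lerDr.
have S0 : S s !=set0 by have [x Ex] := E0; exists x; exact: ES.
have [|W [AW SW WU mW]] := @mr_intermediate (S s) U0 (s + t) AS S0 AU0 SU.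
  by rewrite mS lerDl t0.
have -> : phi (s + t) u = cfv P (X W) u by rewrite (phi_law AW) mW.
rewrite (cfv_chain u AS AW SW) (@cfD _ _ (S t))//.
by rewrite mW mS mt addrC addKr.
Qed.

Let phi0 u : phi 0 u = 1.
Proof. by have [|AS _ _ mS] := @SP 0; [rewrite lexx mr_ge0|exact: cf1]. Qed.

(** Masses inside U0 go up to c only; a larger time is made of as many full steps of length c as
    possible and a remainder. *)
Let Q t : probability R R :=
  convolution (convolution_iter (law (X (S c))) (Num.truncn (t / c)))
    (law (X (S (t - (Num.truncn (t / c))%:R * c)))).

Let cf_Q n r u : 0 <= r <= c -> cf (Q (n%:R * c + r)) u = phi c u ^+ n * phi r u.
Proof.
move=> /andP[r0 rc]; have c0 : c != 0 by rewrite gt_eqF.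
have QE k s : 0 <= s < c -> n%:R * c + r = k%:R * c + s ->
    cf (Q (n%:R * c + r)) u = phi c u ^+ k * phi s u.
  move=> /andP[s0 sc] ->; rewrite /Q cf_convolution cf_convolution_iter !cf_law.
  have -> : Num.truncn ((k%:R * c + s) / c) = k.
    apply: truncn_def; rewrite mulrDl mulfK// lerDl divr_ge0 ?(ltW U0_gt0)//=.
    by rewrite -natr1 ltrD2l ltr_pdivrMr// mul1r.
  by rewrite addrC addKr.
move: rc; rewrite le_eqVlt => /orP[/eqP rc|rc]; last by rewrite (QE n r)// r0.
rewrite (QE n.+1 0) ?lexx//; first by rewrite phi0 mulr1 rc exprSr.
by rewrite rc addr0 -natr1 mulrDl mul1r.
Qed.

Let decomp (t : R) : 0 <= t -> exists (n : nat) (r : R), 0 <= r <= c /\ t = n%:R * c + r.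
Proof.
move=> t0; exists (Num.truncn (t / c)), (t - (Num.truncn (t / c))%:R * c).
split; last by rewrite addrC subrK.
have /andP[h1 h2] := truncn_itv (divr_ge0 t0 (ltW U0_gt0)).
rewrite subr_ge0 -ler_pdivlMr// h1/= lerBlDl -[X in _ + X]mul1r -mulrDl natr1.
by rewrite -ler_pdivrMr// ltW.
Qed.

Let cf_Q_small t u : 0 <= t <= c -> cf (Q t) u = phi t u.
Proof.
by move=> h; rewrite -[t in LHS]add0r -[X in X + t](mul0r c) (cf_Q 0)// expr0 mul1r.
Qed.

(** Induction on the number of full steps: U contains a member V with one step less, and the
    difference has mass c. *)
Let Q_law U : A U -> same_law (law (X U)) (Q (mr U)).
Proof.
move=> AU; apply: cf_injective => u; rewrite cf_law.
have [n [r [rc mU]]] := decomp (mr_ge0 U).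
rewrite mU cf_Q//; elim: n U AU mU => [|n IH] U AU mU.
  by rewrite expr0 mul1r phi_law// mU mul0r add0r//; case/andP: rc.
have mU1 : mr U = (n%:R * c + r) + c by rewrite mU -natr1 mulrDl mul1r addrAC.
have nr0 : 0 <= n%:R * c + r.
  by rewrite addr_ge0 ?mulr_ge0 ?(ltW U0_gt0)//; case/andP: rc.
have U_0 : U !=set0 by apply: nonempty_of_mr; rewrite mU1 ltr_wpDl.
have [|V [AV EV VU mV]] := @mr_intermediate E U (n%:R * c + r) AE E0 AU (empty_prime_sub AU U_0).
  by rewrite mE0 nr0 mU1 lerDl (ltW U0_gt0).
have [|ASc _ _ mSc] := @SP c; first by rewrite lexx (ltW U0_gt0).
rewrite (cfv_chain u AV AU VU) (IH V AV mV) (@cfD _ _ (S c))//; last first.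
  by rewrite mU1 mV addrC addKr mSc.
by rewrite exprSr mulrAC.
Qed.

(** If the limit fails, it fails along times that can be taken as small as desired; realized as
    masses of nested members of [A], they contradict [H2]. *)
Let Q_cvg0 : weak_cvg 0^'+ Q (\d_(0 : R)).
Proof.
move=> f cf_ [M fM]; have mf := continuous_measurable_fun cf_.
rewrite integral_dirac//=; last exact/measurable_EFinP.
rewrite diracT mul1e.
suff h : \int[Q t]_x f x @[t --> 0^'+] --> f 0.
  have -> : (fun t => \int[Q t]_x (f x)%:E)%E = (fun t => (\int[Q t]_x f x)%:E).
    apply/funext => t; rewrite /Rintegral fineK//.
    exact: (integrable_fin_num measurableT (bounded_integrable (Q t) mf fM)).
  by apply: cvg_EFin; [exact: nearW|exact: h].
apply: contrapT => nh.
have [e e0 bad] : exists2 e : R, 0 < e & forall r : R, 0 < r -> exists t : R, 0 < t < r /\ e <= `|f 0 - \int[Q t]_x f x|.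
  apply: contrapT => h; apply: nh; apply/cvgrPdist_lt => e e0.
  apply: contrapT => h'; apply: h; exists e => // r r0.
  apply: contrapT => h''; apply: h'; exists r => //= t /= tr t0.
  rewrite ltNge; apply/negP => et; apply: h''; exists t; split => //.
  by rewrite t0/=; move: tr; rewrite sub0r normrN gtr0_norm.
have [tau tauP] : exists tau : R -> R, forall r : R, 0 < r -> 0 < tau r < r /\ e <= `|f 0 - \int[Q (tau r)]_x f x|.
  suff h (r : R) : exists t : R, 0 < r -> 0 < t < r /\ e <= `|f 0 - \int[Q t]_x f x|.
    by have [tau tauP] := choice h; exists tau.
  have [r0|] := boolP (0 < r); last by exists 0.
  by have [t tP] := bad _ r0; exists t.
(* Each bad time is chosen below half of the previous one: the times tend to 0 and, being
   decreasing, can be masses of nested sets. *)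
pose t := fix t n := if n is n'.+1 then tau (t n' / 2) else tau c.
have t0 n : 0 < t n.
  by elim: n => [|n IH] /=; [have [/andP[]] := tauP c U0_gt0|have [/andP[]] := tauP _ (divr_gt0 IH (ltr0Sn R 1))].
have te n : e <= `|f 0 - \int[Q (t n)]_x f x|.
  case: n => [|n] /=; first by have [] := tauP c U0_gt0.
  by have [] := tauP _ (divr_gt0 (t0 n) (ltr0Sn R 1)).
have th n : t n.+1 < t n / 2.
  by have [/andP[]] := tauP _ (divr_gt0 (t0 n) (ltr0Sn R 1)).
have tc n : t n <= c * (1 / 2) ^+ n.
  elim: n => [|n IH]; first by rewrite expr0 mulr1; have [/andP[_ /ltW]] := tauP c U0_gt0.
  apply: le_trans (ltW (th n)) _.
  have -> : c * (1 / 2) ^+ n.+1 = c * (1 / 2) ^+ n / 2 by rewrite exprSr; field.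
  by rewrite ler_pM2r.
have tlec n : t n <= c.
  apply: le_trans (tc n) _; rewrite ler_piMr ?(ltW U0_gt0)//.
  by rewrite exprn_ile1//; lra.
have [h hP] : exists h : set T -> R -> set T, forall V s, A V -> E `<=` V -> 0 <= s <= mr V ->
    [/\ A (h V s), E `<=` h V s, h V s `<=` V & mr (h V s) = s].
  have ex (Vs : set T * R) : exists W, A Vs.1 -> E `<=` Vs.1 -> 0 <= Vs.2 <= mr Vs.1 ->
      [/\ A W, E `<=` W, W `<=` Vs.1 & mr W = Vs.2].
    case: Vs => V s /=; have [[AV [EV sV]]|nn] := pselect (A V /\ E `<=` V /\ 0 <= s <= mr V).
      by have [|W WP] := @mr_intermediate E V s AE E0 AV EV; [rewrite mE0|exists W].
    by exists set0 => AV EV sV; exfalso; apply: nn.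
  by have [h hP] := choice ex; exists (fun V s => h (V, s)) => V s; exact: (hP (V, s)).
(* Each set is found inside the preceding one by the intermediate value property. *)
pose F := fix F n := if n is n'.+1 then h (F n') (t n) else S (t 0%N).
have FP n : [/\ A (F n), E `<=` F n & mr (F n) = t n].
  elim: n => [|n [AF EF mF]].
    by have [|? ? _ ?] := @SP (t 0%N); [rewrite tlec (ltW (t0 _))|split].
  have [|? ? _ ?] := @hP (F n) (t n.+1) AF EF; last by split.
  by rewrite mF (ltW (t0 _))/= (le_trans (ltW (th n)))// ler_pdivrMr// ler_peMr ?ler1n// ltW.
have FS n : F n.+1 `<=` F n.
  have [AF EF mF] := FP n.
  have [|? ? + _] := @hP (F n) (t n.+1) AF EF; last by [].
  by rewrite mF (ltW (t0 _))/= (le_trans (ltW (th n)))// ler_pdivrMr// ler_peMr ?ler1n// ltW.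
have Fdec n k : (n <= k)%N -> F k `<=` F n.
  by move=> /subnK <-; elim: (k - n)%N => // j IH; exact: subset_trans (FS _) IH.
have tcvg : t n @[n --> \oo] --> (0 : R).
  apply: (@squeeze_cvgr _ _ _ _ (fun=> 0) (fun n => c * (1 / 2) ^+ n)).
  - by apply: nearW => n; rewrite (ltW (t0 n)) tc.
  - exact: cvg_cst.
  - by apply: cvg_geometric; rewrite ger0_norm; lra.
have mF : mr (F n) @[n --> \oo] --> 0.
  by rewrite (_ : (fun n => mr (F n)) = t)//; apply/funext => n; have [] := FP n.
have AF n : A (F n) by have [] := FP n.
have := weak_cvg_in_probability (H2 AF Fdec mF) cf_ (ex_intro _ M fM).
move=> /cvgrPdist_lt/(_ _ e0)[N _ /(_ N (leqnn N))] /=; apply/negP; rewrite -leNgt.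
apply: le_trans (te N) _; rewrite -(_ : \int[Q (t N)]_x f x = \int[P]_w f (X (F N) w))//.
rewrite -(eq_Rintegral_same_law f (_ : same_law (law (X (F N))) (Q (t N)))); last first.
  by have [_ _ <-] := FP N; exact: Q_law.
congr fine; rewrite /law integral_distribution//; first exact/measurable_EFinP.
apply: (@bounded_integrable _ _ _ P (fun w => f (X (F N) w)) M) => //.
exact: (measurableT_comp mf (mRV _)).
Qed.

Lemma semigroup_positive_mass : exists q, convolution_semigroup q /\
  forall U, A U -> same_law (law (X U)) (q (mr U)).
Proof.
exists Q; split; last exact: Q_law.
split; last exact: Q_cvg0.
- apply: cf_injective => u; rewrite cf_Q_small ?lexx ?(ltW U0_gt0)//.
  by rewrite phi0 cf_dirac0.
- move=> s t s0 t0; apply: cf_injective => u; rewrite cf_convolution.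
  have [n [r [rc ->]]] := decomp s0; have [k [r' [rc' ->]]] := decomp t0.
  have /andP[r0 rlec] := rc; have /andP[r'0 r'lec] := rc'.
  rewrite (@cf_Q n r u rc) (@cf_Q k r' u rc') mulrACA -exprD; have [rr|rr] := leP (r + r') c.
    rewrite (_ : n%:R * c + r + _ = (n + k)%N%:R * c + (r + r')); last by rewrite natrD; ring.
    by rewrite (@cf_Q _ (r + r')) ?addr_ge0// phiD.
  rewrite (_ : n%:R * c + r + _ = (n + k).+1%:R * c + (r + r' - c)); last by rewrite -natr1 natrD; ring.
  rewrite (@cf_Q _ (r + r' - c)); last by apply/andP; split; lra.
  rewrite exprSr -mulrA; congr (_ * _).
  (* When r + r' exceeds c one full step is carried: the step is split at r, and r' is split at c -
     r. *)
  have e1 : phi c u = phi r u * phi (c - r) u by rewrite -phiD ?subr_ge0// addrC subrK.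
  have e2 : phi r' u = phi (c - r) u * phi (r + r' - c) u.
    by rewrite -phiD; [congr (phi _ u); ring|lra|lra|lra].
  by rewrite e1 e2 mulrA.
Qed.

End positive_mass.

Lemma semigroup_exists : exists q, convolution_semigroup q /\
  forall C, class_C A C -> same_law (law (increment A X C)) (q (mr C)).
Proof.
suff [q [sq qA]] : exists q, convolution_semigroup q /\
    forall U, A U -> same_law (law (X U)) (q (mr U)).
  by exists q; split => //; exact: law_class_C.
have [[U0 [AU0 U0_gt0]]|h] := pselect (exists U0, A U0 /\ 0 < mr U0).
  exact: semigroup_positive_mass AU0 U0_gt0.
(* If no member has positive mass, every law is that of the increment over the empty set. *)
exists (fun=> \d_(0 : R) : probability R R); split; first exact: dirac_semigroup.
move=> U AU; apply: cf_injective => u; rewrite cf_dirac0 cf_law cf1//.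
apply: le_anti; rewrite mr_ge0 andbT leNgt; apply/negP => U0; apply: h.
by exists U.
Qed.

End semigroup_construction.
End process.

Record levy_like (q : R -> probability R R) {dO : measure_display}
    {Omega : measurableType dO} {P : probability Omega R} (X : set T -> {RV P >-> R}) : Prop := {
  ll_definite : definite_increments A X ;
  ll_independent : independent_increments A X ;
  ll_law : forall C, class_C A C -> same_law (law (increment A X C)) (q (mr C))
}.

Lemma mr_decomposition (K I : finType) (C : K -> set T) (E : I -> set T) :
  (forall k, class_C A (C k)) -> (forall i, class_C A (E i)) -> trivIset setT E ->
  (forall k i, E i `<=` C k \/ E i `&` C k = set0) ->
  (forall k y, C k y -> exists i, E i y) ->
  forall k, mr (C k) = \sum_(i | `[< E i `<=` C k >]) mr (E i).
Proof.
move=> CC CE tE dE cE k; apply: EFin_inj; rewrite -mrE// -sumEFin.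
under eq_bigr do rewrite -mrE//.
have CkE : C k = \bigcup_(i in [set i | `[< E i `<=` C k >]]) E i.
  apply/seteqP; split=> y; last by move=> [i /= /asboolP Ei Ey]; exact: Ei.
  move=> Cy; have [i Ey] := cE k y Cy; exists i => //=; apply/asboolP.
  by have [//|h] := dE k i; have : (E i `&` C k) y by []; rewrite h.
by rewrite [in LHS]CkE measure_bigcup_fintype// => i; exact: class_C_measurable.
Qed.

(** [None] stands for the ambient set, [Some k] for disjoint parts of it. An empty piece lies in
    every part and would be subtracted several times, so h must vanish on it. *)
Lemma signed_sum_decomposition (K I : finType) (C : option K -> set T) (E : I -> set T)
    (V : zmodType) (h : I -> V) : (forall i, E i = set0 -> h i = 0) ->
  (forall k, C (Some k) `<=` C None) -> trivIset setT (fun k => C (Some k)) ->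
  \sum_(i | `[< E i `<=` C None >]) h i - \sum_k \sum_(i | `[< E i `<=` C (Some k) >]) h i =
  \sum_(i | `[< E i `<=` C None /\ forall k, ~ E i `<=` C (Some k) >]) h i.
Proof.
move=> h0 CN tC; under [X in _ - X]eq_bigr do rewrite big_mkcond/=.
rewrite exchange_big/= [X in X - _]big_mkcond [RHS]big_mkcond -sumrB; apply: eq_bigr => i _.
have [Ei0|[y Ey]] : E i = set0 \/ E i !=set0.
  by have [|/nonemptyPn] := pselect (E i !=set0); [right|left].
  rewrite (h0 i Ei0); rewrite [X in _ - X]big1; last by move=> k _; case: ifP.
  by rewrite subr0; case: ifP; case: ifP.
have [[k Ek]|nk] := pselect (exists k, E i `<=` C (Some k)).
  rewrite (bigD1 k)//= big1 ?addr0; last first.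
    move=> j jk; case: asboolP => // Ej; move/eqP: jk; case; apply: tC => //.
    by exists y; split; [exact: Ej|exact: Ek].
  have -> : `[< E i `<=` C None >] by apply/asboolP; exact: subset_trans (CN k).
  have -> : `[< E i `<=` C (Some k) >] by apply/asboolP.
  by rewrite subrr; case: asboolP => // -[_ /(_ k)].
rewrite big1 ?subr0; last first.
  by move=> k _; case: asboolP => // Ek; exfalso; apply: nk; exists k.
rewrite (asbool_equiv_eq (Q := E i `<=` C None))//; split=> [[]//|EN].
by split=> // k Ek; apply: nk; exists k.
Qed.

(** * Properties of Lévy-like processes *)

Section consequences.
Variable q : R -> probability R R.
Hypothesis sq : convolution_semigroup q.
Context {dO : measure_display} {Omega : measurableType dO} {P : probability Omega R}.
Variable X : set T -> {RV P >-> R}.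
Hypothesis LX : levy_like q X.

Let defX := ll_definite LX.
Let indX := ll_independent LX.
Let lawX := ll_law LX.

Lemma law_sum_increments (I : finType) (p : pred I) (E : I -> set T) :
  (forall i, class_C A (E i)) -> trivIset setT E ->
  forall D, measurable D ->
  P ((fun w => \sum_(i | p i) increment A X (E i) w) @^-1` D) =
  q (\sum_(i | p i) mr (E i)) D.
Proof.
move=> CE tE D mD.
apply: (law_sum_semigroup p (Y := fun i w => increment A X (E i) w) (t := fun i => mr (E i))
  sq _ (fin_indep_increment indX CE tE)) => //.
- by move=> i; exact: mr_ge0.
- by move=> i F mF; exact: lawX.
Qed.

(** What remains of D need not be in [class_C], so its law is computed from the pieces of D
    contained in no C k. *)
Lemma law_residual (K : finType) (D : set T) (C : K -> set T) : class_C A D ->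
  (forall k, class_C A (C k)) -> (forall k, C k `<=` D) -> trivIset setT C ->
  forall F, measurable F ->
  P ((fun w => increment A X D w - \sum_k increment A X (C k) w) @^-1` F) =
  q (mr D - \sum_k mr (C k)) F.
Proof.
move=> CD CC CsubD tC F mF; pose G k := if k is Some k' then C k' else D.
have CG k : class_C A (G k) by case: k.
have [I [E [CE tE dE cE GE]]] := decomposition A_setI A0 CG.
have mG := mr_decomposition CG CE tE dE cE.
have S0 (V : zmodType) (h : I -> V) := @signed_sum_decomposition K I G E V h.
have -> : mr D - \sum_k mr (C k) =
    \sum_(i | `[< E i `<=` G None /\ forall k, ~ E i `<=` G (Some k) >]) mr (E i).
  rewrite -S0 => [|i ->||//]; [|exact: mr0|by []].
  by congr (_ - _); [exact: (mG None)|apply: eq_bigr => k _; exact: (mG (Some k))].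
rewrite (_ : (fun w => _) = (fun w => \sum_(i | `[< E i `<=` G None /\
    forall k, ~ E i `<=` G (Some k) >]) increment A X (E i) w)); first exact: law_sum_increments.
apply/funext => w; rewrite -S0 => [|i ->||//]; [|by rewrite increment0|by []].
congr (_ - _); first exact: (GE _ _ _ _ _ defX None).
by apply: eq_bigr => k _; exact: (GE _ _ _ _ _ defX (Some k)).
Qed.

Lemma levy_like_stationary : stationary_random_measure A m X.
Proof.
move=> C1 C2 CC1 CC2 mC D mD; rewrite (lawX CC1 mD) (lawX CC2 mD).
by rewrite /mr mC.
Qed.

Lemma levy_like_infinitely_divisible : infinitely_divisible_increments A X.
Proof.
move=> C CC n n0.
have [nu h] := semigroup_infinitely_divisible sq (mr_ge0 C) n0.
by exists nu => D mD; rewrite (lawX CC mD) (h D mD).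
Qed.

Lemma mutually_independent_increments (I : choiceType) (C : I -> set T) :
  (forall i, class_C A (C i)) -> trivIset setT C ->
  mutually_independent (fun i => increment A X (C i)).
Proof.
move=> CC tC J F mF.
have tJ : trivIset setT (fun j : J => C (val j)).
  by move=> i j _ _ h; apply: val_inj; exact: tC.
have := congr1 EFin (fin_indep_increment indX (fun j : J => CC (val j)) tJ (fun j => mF (val j))).
rewrite -prE; last first.
  by apply: bigcap_fintype_measurable => j; exact: RV_preimage.
rewrite big_seq_fsetE/= -prodEFin => h.
rewrite (_ : \bigcap_(i in _) _ = \bigcap_(j : J) increment A X (C (val j)) @^-1` F (val j)).
  by rewrite h; apply: eq_bigr => j _; rewrite -prE//; exact: RV_preimage.
apply/seteqP; split=> w h'; first by move=> j _; apply: h'; exact: valP.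
by move=> i iJ; exact: (h' (FSetSub iJ) Logic.I).
Qed.

Lemma mr_bigcup_cvg (C : nat -> set T) : (forall n, class_C A (C n)) -> trivIset setT C ->
  class_C A (\bigcup_n C n) ->
  \sum_(0 <= i < n) mr (C i) @[n --> \oo] --> mr (\bigcup_n C n).
Proof.
move=> CC tC CU; have mC n := class_C_measurable (CC n).
have := @measure_semi_sigma_additive _ _ _ m C mC tC (bigcup_measurable (fun n _ => mC n)).
rewrite mrE// => /fine_cvgP[_]; apply: cvg_trans; apply: near_eq_cvg; apply: nearW => n /=.
by under eq_bigr do rewrite mrE//; rewrite sumEFin.
Qed.

(** The remainder of the series and all its later blocks have laws [q] of masses bounded by the
    remaining mass, which tends to 0; [ae_series_cvg] applies. *)
Lemma levy_like_scattered : independently_scattered A X.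
Proof.
move=> C CC tC; split=> [|CU]; first exact: mutually_independent_increments.
have sm := mr_bigcup_cvg CC tC CU.
have tN (k N : nat) : trivIset setT (fun i : 'I_N => C (k + i)%N).
  by move=> i j _ _ h; apply: val_inj; apply: (@addnI k); exact: tC.
have mrs k n : 0 <= \sum_(k <= i < n) mr (C i) by apply: sumr_ge0 => i _; exact: mr_ge0.
have mr_le n : \sum_(0 <= i < n) mr (C i) <= mr (\bigcup_n C n).
  apply: (cvgr_to_ge sm); near=> k.
  rewrite (big_cat_nat (leq0n n) (_ : (n <= k)%N))/= ?lerDl//.
  by near: k; exact: nbhs_infty_ge.
apply: ae_series_cvg.
- by move=> i; exact: mRV.
- exact: mRV.
- by move=> k N; exact: (fin_indep_increment indX (fun i => CC _) (tN k N)).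
move=> e r e0 r0; have [b b0 hb] := semigroup_tail_small sq e0 r0.
(* Beyond k0 the remaining mass is below the threshold b under which tails at level e have
   probability less than r. *)
have /cvgrPdist_lt/(_ _ b0)[k0 _ hk0] := sm.
exists k0 => k kk0; have := hk0 k kk0; rewrite /= ger0_norm ?subr_ge0// => kb.
have mE : measurable [set x : R | e < `|x|] by exact: measurable_normr_gt.
split=> [|n].
  rewrite (_ : [set w | _] = (fun w => increment A X (\bigcup_n C n) w -
      \sum_(i < k) increment A X (C i) w) @^-1` [set x | e < `|x|]); last first.
    by apply/seteqP; split=> w /=; rewrite distrC big_mkord.
  rewrite /pr law_residual//; last 2 first.
  - by move=> i y Cy; exists i.
  - by have := tN 0%N k; under eq_fun do rewrite add0n.
  by apply/ltW/hb; rewrite -(big_mkord xpredT (fun i => mr (C i))) subr_ge0 mr_le.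
have [nk|kn] := leqP n k.
  under eq_set do rewrite big_geq// normr0.
  rewrite (_ : [set _ | _] = set0) ?/pr ?measure0 ?ltW//.
  by apply/seteqP; split=> w //=; rewrite ltNge ltW.
rewrite (_ : [set w | _] = (fun w => \sum_(i < n - k | xpredT i) increment A X (C (k + i)%N) w)
    @^-1` [set x | e < `|x|]); last first.
  by apply/seteqP; split=> w /=; rewrite big_nat_shift.
rewrite /pr (@law_sum_increments _ xpredT (fun i : 'I_(n - k) => C (k + i)%N))//; last exact: tN.
apply/ltW/hb; rewrite sumr_ge0/=; last by move=> i _; exact: mr_ge0.
apply: le_lt_trans kb.
have := mr_le n; rewrite (big_cat_nat (leq0n k) (ltnW kn))/=.
by rewrite lerBrDl [X in _ + X](big_nat_shift (fun i => mr (C i))).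
Unshelve. all: by end_near.
Qed.

(** An increasing sequence is cut into successive shells, the first of which removes only V; process
    and mass telescope in the same way. *)
Lemma increasing_increments V (U : nat -> set T) w : A V -> (forall i, A (U i)) ->
  increasing_sets U -> forall i,
  increment A X (U i `\` V) w =
  \sum_(0 <= j < i.+1) increment A X ((U j `\` V) `\` (if j is k.+1 then U k else set0)) w /\
  mr (U i `\` V) =
  \sum_(0 <= j < i.+1) mr ((U j `\` V) `\` (if j is k.+1 then U k else set0)).
Proof.
move=> AV AU iU; have CUV i : class_C A (U i `\` V) by apply: class_C_setD => //; exact: class_C_A.
elim=> [|i [IH1 IH2]]; first by rewrite !big_nat1 setD0.
have UI : (U i.+1 `\` V) `&` U i = U i `\` V.
  apply/seteqP; split=> y; first by move=> [[_ ?] ?].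
  by move=> [Uy ?]; split => //; split => //; apply: iU Uy.
rewrite !(@big_nat_recr _ _ _ i.+1)//= -IH1 -IH2; split.
  by rewrite (increment_split A_setI defX w (CUV i.+1) (AU i)) UI.
by rewrite (mr_split (CUV i.+1) (AU i)) UI.
Qed.

(** Both vectors are the same function f, partial sums, of independent shell increments. Equal
    cumulated masses give equal shell masses by subtraction, hence equal marginals. *)
Lemma levy_like_increments_law n V (U W : nat -> set T) :
  A V -> (forall i, A (U i)) -> (forall i, A (W i)) ->
  increasing_sets U -> increasing_sets W ->
  (forall i, m (U i `\` V) = m (W i)) ->
  forall F : set (n.-tuple R), measurable F ->
    P (random_vector n (fun i => increment A X (U i `\` V)) @^-1` F) =
    P (random_vector n (fun i => increment A X (W i)) @^-1` F).
Proof.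
move=> AV AU AW iU iW mUW F mF.
pose D (V : set T) (U : nat -> set T) (j : nat) := (U j `\` V) `\` (if j is k.+1 then U k else set0).
have CD (V' : set T) (U' : nat -> set T) j : A V' -> (forall i, A (U' i)) -> class_C A (D V' U' j).
  move=> AV' AU'; apply: class_C_setD; last by case: j.
  by apply: class_C_setD => //; exact: class_C_A.
have tD (V' : set T) (U' : nat -> set T) : increasing_sets U' -> trivIset setT (fun j : 'I_n => D V' U' j).
  move=> iU' j k _ _ [y [[[jy Vy] jy'] [[ky _] ky']]]; apply: val_inj => /=.
  move: jy jy' ky ky'; case: (ltngtP j k) => // jk.
    by case: (nat_of_ord k) jk => // k' jk jy _ _ h; exfalso; apply: h; apply: iU' jy.
  by case: (nat_of_ord j) jk => // j' jk _ h ky _; exfalso; apply: h; apply: iU' ky.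
have mrD : forall j, mr (D V U j) = mr (D set0 W j).
  have h i : \sum_(0 <= j < i.+1) mr (D V U j) = \sum_(0 <= j < i.+1) mr (D set0 W j).
    have [_ <-] := increasing_increments point AV AU iU i.
    have [_ <-] := increasing_increments point A0 AW iW i.
    by rewrite setD0 /mr mUW.
  case=> [|j]; first by have := h 0%N; rewrite !big_nat1.
  by have := h j.+1; rewrite !(@big_nat_recr _ _ _ j.+1)//= h => /addrI.
pose f (x : 'I_n -> R) : n.-tuple R := [tuple \sum_(j < n | (j <= i)%N) x j | i < n].
have mf : measurable_fun (setT : set (g_sigma_algebraType (@cylinder_sets R 'I_n setT))) f.
  apply/measurable_fun_tnthP => i.
  rewrite (_ : _ \o _ = fun x => \sum_(j < n | (j <= i)%N) x j).
    by apply: measurable_fun_sum_in => j _ _; exact: measurable_fun_coordinate.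
  by apply/funext => x /=; rewrite tnth_mktuple.
have vecE (V' : set T) (U' : nat -> set T) w : A V' -> (forall i, A (U' i)) -> increasing_sets U' ->
    random_vector n (fun i => increment A X (U' i `\` V')) w =
    f (fun j : 'I_n => increment A X (D V' U' j) w).
  move=> AV' AU' iU'; apply: eq_from_tnth => i; rewrite !tnth_mktuple.
  have [-> _] := increasing_increments w AV' AU' iU' i.
  rewrite (big_nat_widen _ _ n)//.
  by rewrite big_mkord; apply: eq_bigl => j /=.
have -> : (fun i => increment A X (W i)) = (fun i => increment A X (W i `\` set0)).
  by apply/funext => i; rewrite setD0.
pose Y (V' : set T) (U' : nat -> set T) (j : 'I_n) w := increment A X (D V' U' j) w.
have -> : random_vector n (fun i => increment A X (U i `\` V)) @^-1` F =
    [set w | (f @^-1` F) ((Y V U)^~ w)].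
  by apply/seteqP; split=> w /=; rewrite vecE.
have -> : random_vector n (fun i => increment A X (W i `\` set0)) @^-1` F =
    [set w | (f @^-1` F) ((Y set0 W)^~ w)].
  by apply/seteqP; split=> w /=; rewrite vecE.
apply: (fin_indep_joint_law (D := setT)).
- by move=> j; exact: mRV.
- by move=> j; exact: mRV.
- by apply: (fin_indep_increment indX (fun j : 'I_n => CD V U j AV AU)); exact: tD.
- by apply: (fin_indep_increment indX (fun j : 'I_n => CD set0 W j A0 AW)); exact: tD.
- move=> j G _ mG; apply: etrans (lawX (CD V U j AV AU) mG) _.
  by rewrite mrD; exact: esym (lawX (CD set0 W j A0 AW) mG).
- by have := mf measurableT _ mF; rewrite setTI.
Qed.

Lemma levy_like_start : {ae P, forall w, X (empty_prime A) w = 0}.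
Proof.
have [AE _] := A_empty_prime.
have h := lawX (class_C_A AE).
have m0 : mr (empty_prime A) = 0 by rewrite /mr m_empty_prime.
have P0 : P [set w | increment A X (empty_prime A) w != 0] = 0%E.
  by apply: law_dirac0_ae => D mD; rewrite (h D mD) m0; exact: (cs_zero sq).
have mE : measurable [set w | increment A X (empty_prime A) w != 0].
  rewrite (_ : [set _ | _] = increment A X (empty_prime A) @^-1` [set~ 0]).
    by apply: RV_preimage; exact: measurableC.
  by apply/seteqP; split=> w /= /eqP.
apply: negligibleS ((negligibleP _ mE).2 P0) => w /= /eqP.
by rewrite (increment_A defX).
Qed.

(** [U n] and V both contain the tail intersection [J n], and both differences have mass tending to
    0. A gap above e forces one of the two increments above e / 2. *)
Lemma levy_like_continuous (U : nat -> set T) (V : set T) :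
    (forall n, A (U n)) -> A V ->
    closure (\bigcup_n \bigcap_(k in [set k | (n <= k)%N]) U k) = V ->
    \bigcap_n closure (\bigcup_(k in [set k | (n <= k)%N]) U k) = V ->
    forall e : R, 0 < e ->
      P [set w | e < `|X (U n) w - X V w|] @[n --> \oo] --> 0%E.
Proof.
move=> AU AV iV sV e e0.
pose J n := \bigcap_(k in [set k | (n <= k)%N]) U k.
have AJ n : A (J n) := A_tail_bigcap AU n.
have [cU cV] := tail_measure_cvg AU AV iV sV.
have JU n : J n `<=` U n := @tail_bigcap_sub U n.
have JV n : J n `<=` V by exact: tail_bigcap_sub_lim.
have CU n : class_C A (U n `\` J n) by apply: class_C_setD => //; exact: class_C_A.
have CV n : class_C A (V `\` J n) by apply: class_C_setD => //; exact: class_C_A.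
have e2 : 0 < e / 2 by rewrite divr_gt0.
pose E := [set x : R | e / 2 < `|x|].
have mE : measurable E by exact: measurable_normr_gt.
have tail (C : nat -> set T) : (forall n, class_C A (C n)) -> m (C n) @[n --> \oo] --> 0%E ->
    P (increment A X (C n) @^-1` E) @[n --> \oo] --> 0%E.
  move=> CC Cm0; have : q (mr (C n)) E @[n --> \oo] --> 0%E.
    by apply: semigroup_tail => //; [move=> n; exact: mr_ge0|exact: fine_cvg].
  apply: cvg_trans; apply: near_eq_cvg; apply: nearW => n.
  by rewrite -(lawX (CC n) mE).
have := cvgeD _ (tail _ CU cU) (tail _ CV cV); rewrite adde0 => /(_ _ isT) cs.
apply: (@squeeze_cvge _ _ _ _ (fun=> 0%E) _ _ _ _ _ cs); [apply: nearW => n|exact: cvg_cst].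
rewrite measure_ge0/=; apply: le_trans (measureU2 _ _ _); [|exact: RV_preimage|exact: RV_preimage].
apply: le_measure; rewrite ?inE; last 2 first.
- by apply: measurableU; exact: RV_preimage.
- move=> w; rewrite /E /= => ew.
  have sp W : A W -> J n `<=` W -> X W w = X (J n) w + increment A X (W `\` J n) w.
    move=> AW JW; rewrite -(increment_A defX w AW) (increment_split A_setI defX w (class_C_A AW) (AJ n)).
    by rewrite setIidr// (increment_A defX).
  have [|h] := ltP (e / 2) `|increment A X (U n `\` J n) w|; first by left.
  right; move: ew; rewrite (sp _ (AU n) (JU n)) (sp _ AV (JV n)).
  set a := increment _ _ _ _ in h *; set b := increment _ _ _ _.
  rewrite opprD addrACA subrr add0r => ab.
  by have := ler_normB a b; lra.
- apply: measurable_normr_gt_preimage; apply: measurable_funB; exact: mRV.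
Qed.

Lemma levy_like_levy : levy_process A m X.
Proof.
split=> //.
- exact: levy_like_start.
- exact: levy_like_increments_law.
- exact: levy_like_continuous.
Qed.

End consequences.

(** * Lévy processes and stationary scattered measures are Lévy-like *)

Section characterizations.
Context {dO : measure_display} {Omega : measurableType dO} {P : probability Omega R}.
Variable X : set T -> {RV P >-> R}.

Lemma mr_bigcap0 (U : nat -> set T) : (forall n, A (U n)) ->
  mr (U n) @[n --> \oo] --> 0 -> m (\bigcap_n U n) = 0%E.
Proof.
move=> AU U0; have AV := A_decreasing_bigcap AU.
rewrite mrE; last exact: class_C_A.
congr EFin; apply/eqP; rewrite eq_le mr_ge0 andbT.
apply: (cvgr_to_ge U0); apply: nearW => n; rewrite -lee_fin -!mrE; [|exact: class_C_A..].
by apply: le_measure; rewrite ?inE; [exact: (A_measurable AV)|exact: (A_measurable (AU n))|move=> y; exact].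
Qed.

Lemma in_probability_of_null (U : nat -> set T) (V : set T) :
  P [set w | X V w != 0] = 0%E ->
  (forall e : R, 0 < e -> P [set w | e < `|X (U n) w - X V w|] @[n --> \oo] --> 0%E) ->
  forall e : R, 0 < e -> P [set w | e < `|X (U n) w|] @[n --> \oo] --> 0%E.
Proof.
move=> XV cU e e0.
apply: (@squeeze_cvge _ _ _ _ (fun=> 0%E) _ _ _ _ _ (cU e e0)); [apply: nearW => n|exact: cvg_cst].
rewrite measure_ge0/=.
have mE : measurable [set w | X V w != 0].
  rewrite (_ : [set _ | _] = X V @^-1` [set~ 0]); first by apply: RV_preimage; exact: measurableC.
  by apply/seteqP; split=> w /= /eqP.
have mD : measurable [set w | e < `|X (U n) w - X V w|].
  by apply: measurable_normr_gt_preimage; apply: measurable_funB; exact: mRV.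
apply: (@le_trans _ _ (P ([set w | e < `|X (U n) w - X V w|] `|` [set w | X V w != 0]))).
  apply: le_measure; rewrite ?inE.
  - by apply: measurable_normr_gt_preimage; exact: mRV.
  - exact: measurableU.
  - move=> w /= h; have [z|z] := eqVneq (X V w) 0; [left|by right].
    by rewrite z subr0.
apply: le_trans (measureU2 _ mD mE) _; rewrite -[leRHS]adde0; apply: leeD => //.
by move: XV => /eqP; rewrite eq_le => /andP[].
Qed.

Section levy.
Hypothesis LX : levy_process A m X.
Let defX := levy_definite LX.

Lemma levy_law_increment U W Z : A U -> A W -> A Z -> m (W `\` U) = m Z ->
  same_law (law (increment A X (W `\` U))) (law (increment A X Z)).
Proof.
move=> AU AW AZ h D mD.
have mF : measurable [set t : 1.-tuple R | D (tnth t ord0)].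
  by rewrite -[X in measurable X]setTI; exact: measurable_tnth.
have := levy_stationary LX (n := 1) (V := U) (U := fun=> W) (W := fun=> Z) AU (fun=> AW) (fun=> AZ)
  (fun _ _ _ => @subset_refl _ _) (fun _ _ _ => @subset_refl _ _) (fun=> h) mF.
rewrite /law /distribution /pushforward => /=.
rewrite (_ : _ @^-1` _ = increment A X (W `\` U) @^-1` D); last first.
  by apply/seteqP; split=> w /=; rewrite tnth_mktuple.
move=> e; apply: etrans e _; congr (P _).
by apply/seteqP; split=> w /=; rewrite tnth_mktuple.
Qed.

(** Stationarity compares a difference only with members of [A]; two differences of equal mass are
    compared through a member Z of that mass. *)
Lemma exists_same_measure U W : A U -> A W -> U `<=` W ->
  exists2 Z, A Z & m (W `\` U) = m Z.
Proof.
move=> AU AW UW.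
have CWU : class_C A (W `\` U) by apply: class_C_setD => //; exact: class_C_A.
have [W0|/nonemptyPn W0] := pselect (W !=set0); last first.
  by exists set0 => //; rewrite W0 set0D.
have [AE E0] := A_empty_prime.
have [|Z [AZ _ _ mZ]] := mr_intermediate AE E0 AW
    (empty_prime_sub AW W0) (s := mr (W `\` U)).
  rewrite {1}/mr m_empty_prime mr_ge0/= -lee_fin -!mrE//; last exact: class_C_A.
  have mW := A_measurable AW; have mU := A_measurable AU.
  by apply: le_measure; rewrite ?inE//; exact: measurableD.
by exists Z => //; rewrite mrE// mrE ?mZ//; exact: class_C_A.
Qed.

Lemma levy_is_levy_like : exists2 q, convolution_semigroup q & levy_like q X.
Proof.
have H1 U W U' W' : A U -> A W -> A U' -> A W' -> U `<=` W -> U' `<=` W' ->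
    m (W `\` U) = m (W' `\` U') ->
    same_law (law (increment A X (W `\` U))) (law (increment A X (W' `\` U'))).
  move=> AU AW AU' AW' UW UW' h.
  have [Z AZ mZ] := exists_same_measure AU AW UW.
  move=> D mD; rewrite (levy_law_increment AU AW AZ mZ mD).
  by rewrite (levy_law_increment AU' AW' AZ _ mD)// -h.
have [|q [sq lq]] := semigroup_exists defX
    (levy_independent LX) H1; last by exists q => //; split => //; exact: levy_independent LX.
move=> U AU dU U0; have AV := A_decreasing_bigcap AU.
set V := \bigcap_n U n in AV.
have mV : m V = 0%E by exact: mr_bigcap0.
have IV n : \bigcap_(k in [set k | (n <= k)%N]) U k = V.
  apply/seteqP; split=> y h k _; last exact: h.
  by apply: dU (leq_maxl k n) _ _; apply: h; exact: leq_maxr.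
have cV : closed V by exact: (A_closed AV).
apply: (in_probability_of_null (V := V)).
  have [AE _] := A_empty_prime.
  have mN : measurable [set~ (0 : R)] by exact: measurableC.
  (* V and [empty_prime A] both have mass 0, so the process vanishes almost surely at V as it does
     at [empty_prime A]. *)
  have := levy_law_increment A0 AV AE; rewrite setD0 mV m_empty_prime => /(_ erefl _ mN).
  have XE W : A W -> increment A X W = X W.
    by move=> AW; apply/mfuneqP => w; exact: increment_A.
  rewrite !XE// /law /distribution /pushforward/= => h.
  have NE W : X W @^-1` [set~ 0] = [set w | X W w != 0] by apply/seteqP; split=> w /= /eqP.
  apply: etrans (congr1 P (esym (NE V))) _; apply: etrans h _; change (P (X (empty_prime A) @^-1` [set~ 0]) = 0%E); apply/negligibleP; first exact: RV_preimage.
  by apply: negligibleS (levy_start LX) => w /=.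
apply: (levy_continuous LX) => //.
  rewrite (_ : \bigcup_n _ = V); first exact: esym ((closure_id V).1 cV).
  by apply/seteqP; split=> y; [move=> [n _]; rewrite IV|move=> Vy; exists 0%N => //; rewrite IV].
apply/seteqP; split=> y h n _.
  rewrite (closure_id (U n)).1; last exact: (A_closed (AU n)).
  by apply: closureS (h n Logic.I) => z [k /= nk]; exact: dU.
by apply: subset_closure; exists n => //=; exact: h.
Qed.

End levy.

Section scattered.
Hypothesis defX : definite_increments A X.
Hypothesis SX : independently_scattered A X.
Hypothesis stX : stationary_random_measure A m X.

Lemma scattered_independent_increments : independent_increments A X.
Proof.
(* A finite family is padded with empty sets, since scattering is stated for sequences. *)
move=> n C CC tC; pose C' k := if insub k is Some i then C i else set0.
have C'E (i : 'I_n) : C' i = C i by rewrite /C' valK.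
have CC' k : class_C A (C' k) by rewrite /C'; case: insubP => // _; exact: class_C0.
have tC' : trivIset setT C'.
  move=> i j _ _ [y []]; rewrite /C'; case: insubP => // i' _ <- Ci; case: insubP => // j' _ <- Cj.
  by congr val; apply: tC => //; exists y.
have := mutually_independent_reindex (@ord_inj n) (SX CC' tC').1.
by under eq_fun do rewrite C'E.
Qed.

(** Continuity is not assumed here; almost sure additivity over the shells of a decreasing sequence
    supplies [H2]. *)
Lemma scattered_is_levy_like : exists2 q, convolution_semigroup q & levy_like q X.
Proof.
have indX := scattered_independent_increments.
have CD U W : A U -> A W -> class_C A (W `\` U).
  by move=> AU AW; apply: class_C_setD => //; exact: class_C_A.
have H1 U W U' W' : A U -> A W -> A U' -> A W' -> U `<=` W -> U' `<=` W' ->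
    m (W `\` U) = m (W' `\` U') ->
    same_law (law (increment A X (W `\` U))) (law (increment A X (W' `\` U'))).
  by move=> AU AW AU' AW' _ _; apply: stX; exact: CD.
have [|q [sq lq]] := semigroup_exists defX
    indX H1; last by exists q => //; split.
move=> U AU dU U0; have AV := A_decreasing_bigcap AU.
set V := \bigcap_n U n in AV.
have mV : m V = 0%E by exact: mr_bigcap0.
have XV : P [set w | X V w != 0] = 0%E.
  have mN : measurable [set~ (0 : R)] by exact: measurableC.
  have := stX (class_C_A AV) (class_C0 A0) (etrans mV (esym (measure0 m))) mN.
  rewrite /law /distribution /pushforward/= => h.
  have -> : [set w | X V w != 0] = increment A X V @^-1` [set~ 0].
    by apply/seteqP; split=> w /=; rewrite (increment_A defX)// => /eqP.
  apply: etrans h _; change (P (increment A X set0 @^-1` [set~ 0]) = 0%E).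
  rewrite (_ : _ @^-1` _ = set0) ?measure0//.
  by apply/seteqP; split=> w //= /(_ (increment0 defX w)).
(* [U 0] is the disjoint union of the limit V and the shells. The partial sums equal X V + X (U 0) -
   X (U n), so convergence of the series to X (U 0) means that X (U n) tends to X V. *)
pose D k := if k is k'.+1 then U k' `\` U k'.+1 else V.
have CDk k : class_C A (D k) by case: k => [|k]; [exact: class_C_A|exact: CD].
have tD : trivIset setT D.
  have aux i j : (i < j)%N -> D i `&` D j = set0.
    case: j => // j; case: i => [_|i ij]; apply/seteqP; split=> y // [].
      by move=> Vy [_ /(_ (Vy j.+1 Logic.I))].
    by move=> [_ nUy] [Uy _]; apply: nUy; exact: dU Uy.
  move=> i j _ _ [y Dy]; have [h|h|//] := ltngtP i j.
    by exfalso; rewrite (aux i j h) in Dy.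
  by exfalso; rewrite setIC (aux j i h) in Dy.
have DU : \bigcup_k D k = U 0%N.
  apply/seteqP; split=> y.
    move=> [[|k] _]; first exact.
    by move=> [h _]; exact: dU (leq0n k) _ h.
  move=> U0y; have [Vy|nVy] := pselect (V y); first by exists 0%N.
  have [k Uk nUk] : exists2 k, U k y & ~ U k.+1 y.
    apply: contrapT => h; apply: nVy => k _; elim: k => // k IH.
    by apply: contrapT => nU; apply: h; exists k.
  by exists k.+1.
have [_] := SX CDk tD; rewrite DU => /(_ (class_C_A (AU 0%N))) aeS.
have sumE n w : series (fun k => increment A X (D k) w) n.+1 = X V w + (X (U 0%N) w - X (U n) w).
  rewrite /series /=; elim: n => [|n IH]; first by rewrite big_nat1 subrr addr0 increment_A.
  rewrite big_nat_recr// IH /= -(increment_A defX w (AU n)).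
  rewrite (increment_split A_setI defX w (class_C_A (AU n)) (AU n.+1)) setIidr; last exact: dU.
  by rewrite (increment_A defX w (AU n.+1)); ring.
apply: (in_probability_of_null (V := V)) => // e e0.
apply: ae_cvg0_in_probability => //.
  by move=> n; apply: measurable_funB; exact: mRV.
apply: filterS aeS => w; rewrite (increment_A defX)// => cw.
have {}cw : series (fun k => increment A X (D k) w) n.+1 @[n --> \oo] --> X (U 0%N) w.
  by move: cw; rewrite -cvg_shiftS.
have -> : (fun n => X (U n) w - X V w) =
    (fun n => X (U 0%N) w - series (fun k => increment A X (D k) w) n.+1).
  by apply/funext => n; rewrite sumE; ring.
by rewrite -(subrr (X (U 0%N) w)); apply: cvgB => //; exact: cvg_cst.
Qed.

End scattered.

End characterizations.

(** * Joint laws through cells *)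

Section cells.
Variable K : finType.
Variable C : K -> set T.
Hypothesis CC : forall k, class_C A (C k).

Section decomposed.
Variable I : finType.
Variable E : I -> set T.
Hypotheses (CE : forall i, class_C A (E i)) (tE : trivIset setT E).
Hypothesis dE : forall k i, E i `<=` C k \/ E i `&` C k = set0.
Hypothesis cE : forall k y, C k y -> exists i, E i y.

Let trace i : {set K} := [set k | `[< E i `<=` C k >]]%SET.

Lemma sum_trace (V : nmodType) (h : I -> V) k :
  \sum_(i | `[< E i `<=` C k >]) h i = \sum_(J : {set K} | k \in J) \sum_(i | trace i == J) h i.
Proof.
rewrite (partition_big trace (fun J : {set K} => k \in J)).
  apply: eq_bigr => J kJ; apply: eq_bigl => i.
  by apply: andb_idl => /eqP iJ; move: kJ; rewrite -iJ inE.
by move=> i ik; rewrite inE.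
Qed.

(** The label [trace i] is the set of all k with E i inside C k. The pieces cover every C k but not
    the complement of their union, which is why J is nonempty. *)
Lemma mr_trace J : J != finset.set0 -> \sum_(i | trace i == J) mr (E i) = mr (cell C J).
Proof.
move=> /set0Pn[k kJ]; have -> : cell C J = \bigcup_(i in [set i | trace i == J]) E i.
  apply/seteqP; split=> y.
    move=> h; have [i Ey] := cE ((h k).1 kJ); exists i => //=; apply/eqP/setP => l; rewrite inE.
    have [Eil|Eil] := dE l i.
      have -> : l \in J by apply/(h l); exact: Eil.
      exact/asboolP.
    have -> : (l \in J) = false.
      by apply/negbTE/negP => /(h l) Cy; have : (E i `&` C l) y by []; rewrite Eil.
    apply/negbTE/negP => /asboolP Eil'.
    have : (E i `&` C l) y by split => //; exact: Eil'.
    by rewrite Eil.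
  move=> [i /= /eqP <- Ey] l; rewrite inE; split=> [/asboolP|Cy]; first exact.
  by apply/asboolP; have [//|Eil] := dE l i; have : (E i `&` C l) y by []; rewrite Eil.
apply: EFin_inj; rewrite /mr (measure_bigcup_fintype m (fun i => trace i == J)) //.
  rewrite -sumEFin fineK; last by apply/sum_fin_numP => i _ _; rewrite mrE.
  by apply: eq_bigr => i _; rewrite -mrE.
by move=> i; exact: class_C_measurable.
Qed.

(** Adding up the pieces of each cell shows that any decomposition gives the joint law computed from
    one variable per cell. The variable of the empty subset enters no sum and its law is left
    free. *)
Lemma joint_law_cells (q : R -> probability R R) (d1 : measure_display) (W1 : measurableType d1)
    (P1 : probability W1 R) (xi : I -> W1 -> R)
    (d2 : measure_display) (W2 : measurableType d2) (P2 : probability W2 R)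
    (eta : {set K} -> W2 -> R) :
  convolution_semigroup q ->
  (forall i, measurable_fun setT (xi i)) -> fin_indep P1 xi ->
  (forall i F, measurable F -> P1 (xi i @^-1` F) = q (mr (E i)) F) ->
  (forall J, measurable_fun setT (eta J)) -> fin_indep P2 eta ->
  (forall J F, J != finset.set0 -> measurable F -> P2 (eta J @^-1` F) = q (mr (cell C J)) F) ->
  forall G, <<s @cylinder_sets R K setT >> G ->
    P1 [set w | G (fun k => \sum_(i | `[< E i `<=` C k >]) xi i w)] =
    P2 [set w | G (fun k => \sum_(J : {set K} | k \in J) eta J w)].
Proof.
move=> sq mxi ixi lxi meta ieta leta G mG.
pose f (x : {set K} -> R) (k : K) := \sum_(J : {set K} | k \in J) x J.
pose D := [set J : {set K} | J != finset.set0].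
have mf : measurable_fun (setT : set (g_sigma_algebraType (cylinder_sets D)))
    (f : _ -> g_sigma_algebraType (@cylinder_sets R K setT)).
  apply: (@measurable_fun_cylinder _ _ (g_sigma_algebraType (cylinder_sets D)) K setT (fun k x => f x k)) => k _.
  apply: measurable_fun_sum_in => J _ kJ.
  by apply: measurable_fun_coordinate; apply/set0Pn; exists k.
have mGf : <<s cylinder_sets D >> (f @^-1` G).
  by have := mf measurableT _ mG; rewrite setTI.
have -> : [set w | G (fun k => \sum_(i | `[< E i `<=` C k >]) xi i w)] =
    [set w | (f @^-1` G) (fun J => \sum_(i | trace i == J) xi i w)].
  have fE w : (fun k => \sum_(i | `[< E i `<=` C k >]) xi i w) = f (fun J => \sum_(i | trace i == J) xi i w).
    by apply/funext => k; exact: sum_trace.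
  by apply/seteqP; split=> w /=; rewrite fE.
apply: (fin_indep_joint_law (D := D)) mGf => //.
- by move=> J; exact: measurable_fun_sumf.
- exact: fin_indep_sum.
- move=> J F J0 mF; rewrite leta// -mr_trace//.
  apply: (law_sum_semigroup (fun i => trace i == J) (Y := xi) (t := fun i => mr (E i)) sq) => //.
  by move=> i; exact: mr_ge0.
Qed.

End decomposed.

End cells.

(** The laws nu are prescribed only on Borel sets and for nonempty J, so the statement serves both
    for [q] itself and for convolution powers. *)
Lemma levy_like_fdd (q : R -> probability R R) {dO : measure_display}
    {Omega : measurableType dO} {P : probability Omega R} (X : set T -> {RV P >-> R}) :
  convolution_semigroup q -> levy_like q X ->
  forall (n : nat) (C : 'I_n -> set T) (F : 'I_n -> set R) (nu : {set 'I_n} -> probability R R),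
  (forall i, class_C A (C i)) -> (forall i, measurable (F i)) ->
  (forall J, J != finset.set0 -> same_law (nu J) (q (mr (cell C J)))) ->
  P (\bigcap_i (increment A X (C i) @^-1` F i)) =
  iterated_integral nu (@nonempty_subsets n)
    (fun xi => (\prod_(i < n) \1_(F i) (\sum_(J : {set 'I_n} | i \in J) xi J))%:E)
    (fun=> 0).
Proof.
move=> sq LX n C F nu CC mF nuq.
have [d2 [W [P2 [Y [mY iY lY _ FY]]]]] := independent_model nu (nonempty_subsets_uniq n).
have [I [E [CE tE dE cE DE]]] := decomposition A_setI A0 CC.
pose G := [set x : 'I_n -> R | forall i, F i (x i)].
have mG : <<s @cylinder_sets R 'I_n setT >> G.
  have -> : G = \bigcap_i [set x | F i (x i)] by apply/seteqP; split=> x h; [move=> i _|move=> i]; exact: h.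
  suff : measurable (\bigcap_i [set x | F i (x i)] : set (g_sigma_algebraType (@cylinder_sets R 'I_n setT))) by [].
  apply: bigcap_fintype_measurable => i.
  by apply: sub_sigma_algebra; exists i, (F i).
have := joint_law_cells CE tE dE cE sq (xi := fun i w => increment A X (E i) w)
  (fun i => mRV _) (fin_indep_increment (ll_independent LX) CE tE)
  (fun i D mD => ll_law LX (CE i) mD) mY iY _ mG.
have -> : [set w | G (fun k => \sum_(i | `[< E i `<=` C k >]) increment A X (E i) w)] =
    \bigcap_i (increment A X (C i) @^-1` F i).
  apply/seteqP; split=> w h i; first by move=> _; rewrite /= (DE _ _ _ _ _ (ll_definite LX)); exact: h.
  by have := h i Logic.I; rewrite /= (DE _ _ _ _ _ (ll_definite LX)).
move=> ->; last first.
  by move=> J D J0 mD; rewrite lY ?mem_nonempty_subsets//; exact: nuq.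
pose f (x : {set 'I_n} -> R) (k : 'I_n) := \sum_(J : {set 'I_n} | k \in J) x J.
have mf : measurable_fun (setT : set (g_sigma_algebraType (@cylinder_sets R {set 'I_n} setT)))
    (f : _ -> g_sigma_algebraType (@cylinder_sets R 'I_n setT)).
  apply: (@measurable_fun_cylinder _ _ (g_sigma_algebraType (@cylinder_sets R {set 'I_n} setT))
    'I_n setT (fun k x => f x k)) => k _.
  by apply: measurable_fun_sum_in => J _ _; exact: measurable_fun_coordinate.
have mfG : measurable (f @^-1` G : set (g_sigma_algebraType (@cylinder_sets R {set 'I_n} setT))).
  by have := mf measurableT _ mG; rewrite setTI.
(* The product of indicators is the indicator of one measurable event, so the iterated integral
   becomes a probability. *)
pose H (x : {set 'I_n} -> R) : \bar R := (\1_(f @^-1` G) x)%:E.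
rewrite (_ : (fun xi => _) = H); last first.
  apply/funext => x; rewrite /H; congr EFin; rewrite [RHS]indicE.
  have [Gx|/existsNP[i nF]] := pselect (G (f x)).
    by rewrite mem_set// big1// => i _; rewrite indicE mem_set//; exact: Gx.
  rewrite memNset; last by move=> /= /(_ i).
  by rewrite (bigD1 i)//= indicE memNset// mul0r.
rewrite FY; last 2 first.
- by move=> x; rewrite lee_fin.
- exact/measurable_EFinP/measurable_indic.
have mE : measurable [set w | G (f (Y^~ w))].
  have := measurable_fun_cylinder (fun J _ => mY J) measurableT mfG.
  by rewrite setTI.
by rewrite /H (_ : (fun w => _) = fun w => (\1_[set w | G (f (Y^~ w))] w)%:E)// integral_indic// setIT.
Qed.

(** * Existence *)

Section existence.
Variable q : R -> probability R R.
Hypothesis sq : convolution_semigroup q.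

Let S := g_sigma_algebraType (@cylinder_sets R (set T) setT).

(** Coordinates are indexed by all subsets of T although laws are prescribed on [A] only; a subset
    outside [A] is treated as the empty set. *)
Definition trim (U : set T) : set T := if `[< A U >] then U else set0.

Lemma A_trim U : A (trim U).
Proof. by rewrite /trim; case: asboolP. Qed.

Lemma trimE U : A U -> trim U = U.
Proof. by rewrite /trim; case: asboolP. Qed.

Definition cell_variables (K : finType) (C : K -> set T) (d' : measure_display)
    (W : measurableType d') (P : probability W R) (eta : {set K} -> W -> R) : Prop :=
  [/\ forall J, measurable_fun setT (eta J), fin_indep P eta &
      forall J F, J != finset.set0 -> measurable F ->
        P (eta J @^-1` F) = q (mr (cell C J)) F].

(** The quantification over all realizations by cell variables makes consistency immediate: two
    models are compared through any common realization. *)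
Definition finite_model (s : seq (set T)) (p : probability S R) : Prop :=
  forall (K : finType) (C : K -> set T), (forall k, C k \in s) ->
  forall (d' : measure_display) (W : measurableType d') (P : probability W R)
    (eta : {set K} -> W -> R), cell_variables (fun k => trim (C k)) P eta ->
  forall G, <<s @cylinder_sets R K setT >> G ->
    p [set x | G (fun k => x (C k))] = P [set w | G (fun k => \sum_(J : {set K} | k \in J) eta J w)].

Lemma exists_cell_variables (K : finType) (C : K -> set T) :
  exists (d' : measure_display) (W : measurableType d') (P : probability W R)
    (eta : {set K} -> W -> R), cell_variables C P eta.
Proof.
have [d' [W [P [Y [mY iY lY _ _]]]]] := independent_model (fun J => q (mr (cell C J)))
  (index_enum_uniq {set K}).
by exists d', W, P, Y; split=> // J F _ mF; rewrite lY// mem_index_enum.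
Qed.

Lemma exists_finite_model (s : seq (set T)) : exists p, finite_model s p.
Proof.
have CC (k : 'I_(size s)) : class_C A (trim (nth set0 s k)) by apply: class_C_A; exact: A_trim.
have [I [E [CE tE dE cE _]]] := decomposition A_setI A0 CC.
have [d1 [W1 [P1 [Y [mY iY lY _ _]]]]] := independent_model (fun i => q (mr (E i)))
  (index_enum_uniq I).
pose Z (U : set T) w := \sum_(i | `[< E i `<=` trim U >]) Y i w.
have mZ : measurable_fun setT (fun w => (Z^~ w) : S).
  apply: (@measurable_fun_cylinder R _ W1 (set T) setT Z) => U _.
  exact: measurable_fun_sumf.
exists (distribution P1 (mfun_of mZ)) => K C Cs d2 W2 P2 eta [meta ieta leta] G mG.
apply: etrans _ (joint_law_cells (C := fun k => trim (C k)) CE tE _ _ sq mY iY _ meta ieta leta mG).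
- by [].
- move=> k i; have js : (index (C k) s < size s)%N by rewrite index_mem.
  by have := dE (Ordinal js) i; rewrite /= nth_index.
- move=> k y; have js : (index (C k) s < size s)%N by rewrite index_mem.
  by have := cE (Ordinal js) y; rewrite /= nth_index.
- by move=> i F mF; rewrite lY// mem_index_enum.
Qed.

Lemma exists_consistent_process : exists P : probability S R,
  forall (K : finType) (C : K -> set T)
    (d' : measure_display) (W : measurableType d') (P' : probability W R)
    (eta : {set K} -> W -> R), cell_variables (fun k => trim (C k)) P' eta ->
  forall G, <<s @cylinder_sets R K setT >> G ->
    P [set x | G (fun k => x (C k))] = P' [set w | G (fun k => \sum_(J : {set K} | k \in J) eta J w)].
Proof.
have [p pP] := choice exists_finite_model.
have mcoord (U : set T) : measurable_fun (setT : set S) (fun x => x U).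
  exact: measurable_fun_coordinate.
have [s s' ss' E sE|P PE] := @kolmogorov_extension R (set T) p.
  apply: (@joint_law_unique R (set T) [set` s] _ S (p s) _ S (p s') (fun U x => x U) (fun U x => x U)) => //.
  move=> t F ts mF; pose C (k : 'I_(size t)) := nth set0 t k.
  have Ct k : C k \in t by exact: mem_nth.
  have [d' [W [P' [eta heta]]]] := exists_cell_variables (fun k => trim (C k)).
  pose G := [set y : 'I_(size t) -> R | forall k, F (C k) (y k)].
  have mG : <<s @cylinder_sets R 'I_(size t) setT >> G.
    have -> : G = \bigcap_k [set y | F (C k) (y k)].
      by apply/seteqP; split=> y h; [move=> k _|move=> k]; exact: h.
    suff : measurable (\bigcap_k [set y | F (C k) (y k)] :
      set (g_sigma_algebraType (@cylinder_sets R 'I_(size t) setT))) by [].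
    apply: bigcap_fintype_measurable => k; apply: sub_sigma_algebra.
    by exists k, (F (C k)).
  have capE : \bigcap_(U in [set` t]) [set x : set T -> R | F U (x U)] = [set x | G (fun k => x (C k))].
    apply/seteqP; split=> x h; first by move=> k; exact: (h _ (Ct k)).
    move=> U /= Ut; have kt : (index U t < size t)%N by rewrite index_mem.
    by have := h (Ordinal kt); rewrite /C /= nth_index.
  rewrite capE (pP s _ C (fun k => ts _ (Ct k)) _ _ _ _ heta _ mG).
  by rewrite (pP s' _ C (fun k => ss' _ (ts _ (Ct k))) _ _ _ _ heta _ mG).
exists P => K C d' W P' eta heta G mG.
pose s := [seq C k | k <- enum K].
have Cs k : C k \in s by apply: map_f; rewrite mem_enum.
rewrite (PE s); first exact: (pP s).
have mf : measurable_fun (setT : set (g_sigma_algebraType (@cylinder_sets R (set T) [set` s])))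
    (fun x => (fun k => x (C k)) : g_sigma_algebraType (@cylinder_sets R K setT)).
  apply: (@measurable_fun_cylinder R _ (g_sigma_algebraType (@cylinder_sets R (set T) [set` s])) K setT
    (fun k x => x (C k))) => k _.
  by apply: measurable_fun_coordinate; exact: Cs.
by have := mf measurableT _ mG; rewrite setTI.
Qed.

Section additive_process.

Variable P : probability S R.
Hypothesis PP : forall (K : finType) (C : K -> set T)
    (d' : measure_display) (W : measurableType d') (P' : probability W R)
    (eta : {set K} -> W -> R), cell_variables (fun k => trim (C k)) P' eta ->
  forall G, <<s @cylinder_sets R K setT >> G ->
    P [set x | G (fun k => x (C k))] = P' [set w | G (fun k => \sum_(J : {set K} | k \in J) eta J w)].

Variables (span : set (T -> R)) (supp : (T -> R) -> seq (set T)) (c : (T -> R) -> set T -> R).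
Hypothesis span_A : forall U, A U -> span (\1_U).
Hypothesis span_sub : forall f h, span f -> span h -> span (f \- h).
Hypothesis span_value : forall f, span f -> (forall b, b \in supp f -> A b) /\
  forall y, f y = linear_value (supp f) (c f) (fun b => \1_b y).
Let Lin (f : T -> R) (x : set T -> R) := linear_value (supp f) (c f) x.
Hypothesis Lin_sub : forall x f h, span f -> span h -> Lin (f \- h) x = Lin f x - Lin h x.

Lemma measurable_linear_value {d' : measure_display} {W : measurableType d'} (Y : set T -> W -> R)
    (s : seq (set T)) (a : set T -> R) : (forall b, b \in s -> measurable_fun setT (Y b)) ->
  measurable_fun setT (fun w => linear_value s a (Y^~ w)).
Proof.
move=> mY; apply: measurable_fun_sum_in => b bs _.
by apply: measurable_funM; [exact: measurable_cst|exact: mY].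
Qed.

Let mLin f : measurable_fun (setT : set S) (Lin f).
Proof.
apply: (@measurable_linear_value _ S (fun b x => x b)) => b _.
exact: measurable_fun_coordinate.
Qed.

(* The value at U is read off the coordinates of a basis extracted from the
   indicators of the members of A, so that linear relations between indicators
   hold at every point. *)
Definition additive_process (U : set T) : {RV P >-> R} := mfun_of (mLin (\1_U)).
Local Notation X := additive_process.

Let Lin0 x : Lin (\1_set0) x = 0.
Proof.
have -> : (\1_set0 : T -> R) = \1_set0 \- \1_set0.
  by apply/funext => y; rewrite /= !indicE in_set0 subrr.
by rewrite Lin_sub ?subrr//; exact: span_A.
Qed.

(** Indicators of [list_diff] satisfy the recursion of [list_increment], and [Lin] respects
    differences. The increment thus depends only on the set, not on its representation. *)
Let Lin_list U0 s x : A U0 -> (forall V, V \in s -> A V) ->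
  span (\1_(list_diff U0 s)) /\ list_increment (fun V => X V x) U0 s = Lin (\1_(list_diff U0 s)) x.
Proof.
elim: s U0 => [|V s IH] U0 AU0 As.
  have -> : list_diff U0 [::] = U0 by apply/seteqP; split=> y; [case|split].
  by split; [exact: span_A|].
have AV : A V by apply: As; rewrite mem_head.
have As' W : W \in s -> A W by move=> Ws; apply: As; rewrite inE Ws orbT.
have [s1 e1] := IH U0 AU0 As'; have [s2 e2] := IH (U0 `&` V) (A_setI AU0 AV) As'.
have -> : (\1_(list_diff U0 (V :: s)) : T -> R) =
    \1_(list_diff U0 s) \- \1_(list_diff (U0 `&` V) s).
  apply/funext => y; rewrite /= !indicE.
  have [y1|n1] := pselect (list_diff U0 s y); last first.
    rewrite !memNset ?subrr//; first by move=> [[? ?] h]; apply: n1.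
    move=> [U0y h]; apply: n1; split=> // W Ws; apply: h; by rewrite inE Ws orbT.
  rewrite (mem_set y1); have [Vy|nVy] := pselect (V y).
    rewrite memNset ?mem_set ?subrr//; first by case: y1 => ? ?; split.
    by move=> [_ /(_ V (mem_head _ _))].
  rewrite (mem_set (_ : list_diff U0 (V :: s) y)) ?memNset ?subr0//; first by move=> [[]].
  by case: y1 => U0y h; split=> // W; rewrite inE => /orP[/eqP ->//|]; exact: h.
by split; [exact: span_sub|rewrite /= e1 e2 Lin_sub].
Qed.

Let represents_Lin C n U0 (U : 'I_n -> set T) x : represents A C U0 U ->
  span (\1_C) /\ inclusion_exclusion X U0 U x = Lin (\1_C) x.
Proof.
move=> [AU0 AU ->]; rewrite inclusion_exclusionE.
have -> : U0 `\` \bigcup_i U i = list_diff U0 [seq U i | i <- enum 'I_n].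
  apply/seteqP; split=> y [U0y h]; split=> //.
    by move=> _ /mapP[i _ ->] Uiy; apply: h; exists i.
  by move=> [i _ Uiy]; apply: (h (U i)) => //; rewrite map_f// mem_enum.
by apply: Lin_list => // _ /mapP[i _ ->].
Qed.

Lemma additive_process_definite : definite_increments A X.
Proof.
split=> [C n U0 U k V0 V r1 r2 x|x|x].
- by have [_ ->] := represents_Lin x r1; have [_ ->] := represents_Lin x r2.
- exact: Lin0.
- rewrite /increment; case: xgetP => [Y _ [k [V0 [V [r ->]]]]|//].
  by have [_ ->] := represents_Lin x r; exact: Lin0.
Qed.

Let increment_Lin C x : class_C A C -> span (\1_C) /\ increment A X C x = Lin (\1_C) x.
Proof.
move=> [n [U0 [U r]]]; rewrite (increment_represents additive_process_definite r).
exact: represents_Lin.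
Qed.

(** Increments are combinations of finitely many coordinates, whose joint law is known. Evaluated on
    sums over pieces, these combinations collapse to the sum over the pieces inside D j. *)
Lemma additive_process_joint_law (J : finType) (D : J -> set T) : (forall j, class_C A (D j)) ->
  exists (I : finType) (E : I -> set T) (d' : measure_display) (W : measurableType d')
    (P' : probability W R) (xi : I -> W -> R),
  [/\ forall i, class_C A (E i), trivIset setT E,
      forall j i, E i `<=` D j \/ E i `&` D j = set0,
      forall j y, D j y -> exists i, E i y &
      [/\ forall i, measurable_fun setT (xi i), fin_indep P' xi,
          forall i F, measurable F -> P' (xi i @^-1` F) = q (mr (E i)) F,
          forall i w, E i = set0 -> xi i w = 0 &
          forall G, <<s @cylinder_sets R J setT >> G ->
            P [set x | G (fun j => increment A X (D j) x)] =
            P' [set w | G (fun j => \sum_(i | `[< E i `<=` D j >]) xi i w)]]].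
Proof.
move=> CD; pose f j : T -> R := \1_(D j).
pose t := flatten [seq supp (f j) | j <- enum J].
have sf j : span (f j) by have [] := increment_Lin point (CD j).
have ft j : {subset supp (f j) <= t}.
  by move=> b bs; apply/flatten_mapP; exists j => //; rewrite mem_enum.
have At b : b \in t -> A b.
  by move=> /flatten_mapP[j _]; have [h _] := span_value (sf j); exact: h.
pose K := seq_sub t; pose C (k : K) := ssval k.
have AC k : A (C k) by exact: At (ssvalP k).
(* The pieces must be adapted both to the basis sets and to the sets D j. *)
pose F (k : K + J) := match k with inl k => C k | inr j => D j end.
have CF k : class_C A (F k) by case: k => [k|j]; [exact: class_C_A (AC k)|exact: CD].
have [I [E [CE tE dE cE _]]] := decomposition A_setI A0 CF.
(* Variables of empty pieces are set to 0 surely, because an empty piece is included in every set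
   and would otherwise be counted everywhere. *)
pose s := [seq i <- index_enum I | `[< E i !=set0 >]].
have us : uniq s by rewrite filter_uniq// index_enum_uniq.
have [d1 [W1 [P1 [xi [mxi ixi lxi xi0 _]]]]] := independent_model (fun i => q (mr (E i))) us.
have xi_0 i w : E i = set0 -> xi i w = 0.
  by move=> Ei; apply: xi0; rewrite mem_filter Ei; case: asboolP => // -[].
have lxi' i G : measurable G -> P1 (xi i @^-1` G) = q (mr (E i)) G.
  move=> mG; have [Ei|/nonemptyPn Ei] := pselect (E i !=set0).
    by apply: lxi => //; rewrite mem_filter mem_index_enum andbT; exact/asboolP.
  have q0 : q 0 G = \d_(0 : R) G := cs_zero sq mG.
  rewrite Ei mr0 q0 diracE.
  have [G0|G0] := boolP (0 \in G).
    rewrite (_ : _ @^-1` _ = setT) ?probability_setT//.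
    by apply/seteqP; split=> w //= _; rewrite xi_0//; exact: set_mem.
  have -> : xi i @^-1` G = set0.
    by apply/seteqP; split=> w //=; rewrite xi_0// => /mem_set G0'; rewrite G0' in G0.
  exact: (measure0 P1).
exists I, E, d1, W1, P1, xi; split=> //.
- by move=> j i; exact: (dE (inr j)).
- by move=> j y; exact: (cE (inr j)).
split=> // G mG.
pose ext (y : K -> R) (b : set T) : R := if insub b is Some k then y k else 0.
have extE (x : set T -> R) b : b \in t -> ext (fun k => x (C k)) b = x b.
  by move=> bt; rewrite /ext insubT.
pose h (y : K -> R) (j : J) := Lin (f j) (ext y).
have mh : measurable_fun (setT : set (g_sigma_algebraType (@cylinder_sets R K setT)))
    (h : _ -> g_sigma_algebraType (@cylinder_sets R J setT)).
  apply: (@measurable_fun_cylinder R _ (g_sigma_algebraType (@cylinder_sets R K setT)) J setT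
    (fun j y => h y j)) => j _.
  apply: (@measurable_linear_value _ (g_sigma_algebraType (@cylinder_sets R K setT))
    (fun b y => ext y b)) => b bs.
  rewrite /ext; case: insubP => [k _ _|_]; last exact: measurable_cst.
  exact: measurable_fun_coordinate.
have mGh : <<s @cylinder_sets R K setT >> (h @^-1` G).
  by have := mh measurableT _ mG; rewrite setTI.
have hE x : h (fun k => x (C k)) = fun j => Lin (f j) x.
  apply/funext => j; rewrite /h /Lin /linear_value big_seq [RHS]big_seq.
  by apply: eq_bigr => b bs; rewrite extE//; exact: ft bs.
have [d2 [W2 [P2 [eta heta]]]] := exists_cell_variables (fun k => trim (C k)).
have heta' : cell_variables C P2 eta.
  have tC : (fun k => trim (C k)) = C by apply/funext => k; exact: trimE.
  by move: heta; rewrite tC.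
have -> : [set x | G (fun j => increment A X (D j) x)] = [set x : S | (h @^-1` G) (fun k => x (C k))].
  apply/seteqP; split=> x /=; rewrite hE;
    by congr G; apply/funext => j; have [_ ->] := increment_Lin x (CD j).
rewrite (PP heta mGh); case: heta' => meta ieta leta.
rewrite -(joint_law_cells CE tE (fun k => dE (inl k)) (fun k => cE (inl k))
  sq mxi ixi lxi' meta ieta leta mGh).
suff e w : h (fun k => \sum_(i | `[< E i `<=` C k >]) xi i w) =
    fun j => \sum_(i | `[< E i `<=` D j >]) xi i w.
  by congr (P1 _); apply/seteqP; split=> w /=; rewrite e.
rewrite (hE (fun b => \sum_(i | `[< E i `<=` b >]) xi i w)); apply/funext => j.
rewrite /Lin /linear_value.
under eq_bigr do rewrite big_mkcond/= mulr_sumr.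
rewrite exchange_big [RHS]big_mkcond/=; apply: eq_bigr => i _.
have [Ei0|[y Ey]] : E i = set0 \/ E i !=set0.
  by have [|/nonemptyPn] := pselect (E i !=set0); [right|left].
  rewrite xi_0//; case: ifP => _; by rewrite big1// => b _; case: ifP; rewrite mulr0.
have [_ /(_ y) e] := span_value (sf j).
have indE k : (\1_(F k) y : R) = (`[< E i `<=` F k >] : bool)%:R.
  rewrite indicE; congr (_%:R); apply/esym; have [Eik|Eik] := dE k i.
    by rewrite (mem_set (Eik _ Ey)) asboolT.
  rewrite memNset; last by move=> Fy; have : (E i `&` F k) y by []; rewrite Eik.
  rewrite asboolF// => h'; have : (E i `&` F k) y by split => //; exact: h'.
  by rewrite Eik.
(* At a point y of the piece, the expansion of the indicator of D j in the basis gives the total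
   coefficient of the piece: 1 if it lies in D j, and 0 otherwise. *)
transitivity ((f j y) * xi i w); last first.
  by rewrite /f (indE (inr j)) /=; case: asboolP => _; rewrite ?mul1r ?mul0r.
rewrite e /linear_value mulr_suml big_seq [RHS]big_seq; apply: eq_bigr => b bs.
have := indE (inl (SeqSub (ft j b bs))); rewrite /= /C /= => ->.
by case: asboolP => _; rewrite ?mulr1 // mulr0 mul0r.
Qed.

(** A nonempty piece lies in at most one of the disjoint sets D j, so the sums use disjoint groups
    of variables; [None] collects the remaining pieces. *)
Lemma fin_indep_trace_sums (I J : finType) (D : J -> set T) (E : I -> set T)
    (d' : measure_display) (W : measurableType d') (P' : probability W R) (xi : I -> W -> R) :
  trivIset setT D -> (forall i, measurable_fun setT (xi i)) -> fin_indep P' xi ->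
  (forall i w, E i = set0 -> xi i w = 0) ->
  fin_indep P' (fun j w => \sum_(i | `[< E i `<=` D j >]) xi i w).
Proof.
move=> tD mxi ixi xi0.
pose t i : option J := if `[< E i !=set0 >] then [pick j | `[< E i `<=` D j >]] else None.
have sumE j w : \sum_(i | `[< E i `<=` D j >]) xi i w = \sum_(i | t i == Some j) xi i w.
  rewrite big_mkcond [RHS]big_mkcond; apply: eq_bigr => i _; rewrite /t.
  have [y0|/nonemptyPn Ei] := pselect (E i !=set0); last first.
    by rewrite xi0//; case: ifP; case: ifP.
  rewrite (asboolT y0); case: y0 => y Ey.
  case: pickP => [k /asboolP Ek|nE]; last by rewrite nE.
  have [[kj]|kj] := eqVneq (Some k) (Some j); first by rewrite asboolT// -kj.
  rewrite asboolF// => Ej; move/eqP: kj; apply; congr Some.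
  by apply: tD => //; exists y; split; [exact: Ek|exact: Ej].
have := fin_indep_sum t mxi ixi.
have msum k : measurable_fun setT (fun w => \sum_(i | t i == k) xi i w).
  exact: measurable_fun_sumf.
have SI : injective (@Some J) by move=> j k [].
move=> /(fin_indep_reindex msum SI).
rewrite (_ : _ \o _ = fun j w => \sum_(i | `[< E i `<=` D j >]) xi i w)//.
by apply/funext => j; apply/funext => w /=; rewrite sumE.
Qed.

Lemma additive_process_levy_like : levy_like q X.
Proof.
split; first exact: additive_process_definite.
  move=> n D CD tD; apply/mutually_independent_fin => F mF.
  have [I [E [d1 [W1 [P1 [xi [CE tE dE cE [mxi ixi lxi xi0 PE]]]]]]]] := additive_process_joint_law CD.
  have iZ := fin_indep_trace_sums tD mxi ixi xi0.
  have mc j : measurable ([set y | F j (y j)] : set (g_sigma_algebraType (@cylinder_sets R 'I_n setT))).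
    by apply: sub_sigma_algebra; exists j, (F j).
  have h1 j : pr P ((increment A X (D j) : S -> R) @^-1` F j) =
      pr P1 ((fun w => \sum_(i | `[< E i `<=` D j >]) xi i w) @^-1` F j).
    by congr fine; exact: (PE [set y | F j (y j)] (mc j)).
  under eq_bigr do rewrite h1.
  rewrite -iZ//; congr fine.
  have mcap : <<s @cylinder_sets R 'I_n setT >> (\bigcap_j [set y | F j (y j)]).
    suff : measurable (\bigcap_j [set y | F j (y j)] :
      set (g_sigma_algebraType (@cylinder_sets R 'I_n setT))) by [].
    exact: bigcap_fintype_measurable.
  exact: (PE _ mcap).
move=> C CC F mF.
have [I [E [d1 [W1 [P1 [xi [CE tE dE cE [mxi ixi lxi xi0 PE]]]]]]]] :=
  additive_process_joint_law (fun _ : unit => CC).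
rewrite (mr_decomposition (fun _ : unit => CC) CE tE dE cE tt).
rewrite -(law_sum_semigroup (fun i => `[< E i `<=` C >]) (Y := xi) (t := fun i => mr (E i)) sq mxi ixi)//.
  by apply: (PE [set y | F (y tt)]); apply: sub_sigma_algebra; exists tt, F.
by move=> i; exact: mr_ge0.
Qed.

End additive_process.

End existence.

End indexing.

Lemma exists_levy_like (R : realType) (d : measure_display) (T : measurableMetricType R d)
    (T_borel : @measurable d T = <<s @open T >>) (m : {measure set T -> \bar R})
    (m_radon : radon_measure m) (A : set (set T)) (A_indexing : indexing_collection A)
    (q : R -> probability R R) : convolution_semigroup q ->
  exists (dO : measure_display) (Omega : measurableType dO) (P : probability Omega R)
    (X : set T -> {RV P >-> R}), levy_like m A q X.
Proof.
move=> sq; have [B [An [g HA]]] := A_indexing.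
have [P PP] := exists_consistent_process T_borel m_radon HA sq.
have [span [supp [c [h1 h2 h3 h4]]]] := @linear_extension R T (set T) (fun U => \1_U) A.
exists _, _, P, (additive_process P supp c).
exact: (additive_process_levy_like T_borel m_radon HA sq PP h1 h2 h3 h4).
Qed.

Theorem theorem4p3 (R : realType) (d : measure_display)
    (T : measurableMetricType R d)
    (T_borel : @measurable d T = <<s @open T >>)
    (T_locally_compact : locally_compact [set: T])
    (m : {measure set T -> \bar R}) (m_radon : radon_measure m)
    (A : set (set T)) (A_indexing : indexing_collection A)
    (m_empty_prime : m (empty_prime A) = 0%E)
    (m_continuous : monotonically_continuous m A) :
  [/\ (* (i) *)
      forall (dO : measure_display) (Omega : measurableType dO)
        (P : probability Omega R) (X : set T -> {RV P >-> R}),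
        levy_process A m X ->
        forall U0 : set T, A U0 -> (0 < m U0)%E ->
        let mu := convolution_power (law (X U0)) (fine (m U0))^-1 in
        [/\ infinitely_divisible (law (X U0)),
            infinitely_divisible mu,
            forall U, A U ->
              same_law (law (X U)) (convolution_power mu (fine (m U))) &
            forall (dO' : measure_display) (Omega' : measurableType dO')
              (P' : probability Omega' R) (Y : set T -> {RV P' >-> R}),
              levy_process A m Y -> same_law (law (X U0)) (law (Y U0)) ->
              same_process_law A X Y],
      (* (ii) *)
      forall (dO : measure_display) (Omega : measurableType dO)
        (P : probability Omega R) (X : set T -> {RV P >-> R}),
        levy_process A m X <->
        [/\ definite_increments A X,
            independently_scattered A X,
            infinitely_divisible_increments A X &
            stationary_random_measure A m X],
      (* (iii) *)
      forall mu : probability R R, infinitely_divisible mu ->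
        exists (dO : measure_display) (Omega : measurableType dO)
          (P : probability Omega R) (X : set T -> {RV P >-> R}),
          levy_process A m X /\
          forall U, A U ->
            same_law (law (X U)) (convolution_power mu (fine (m U))) &
      (* finite-dimensional distributions *)
      forall (dO : measure_display) (Omega : measurableType dO)
        (P : probability Omega R) (X : set T -> {RV P >-> R}),
        levy_process A m X ->
        (exists mu : probability R R, infinitely_divisible mu /\
          forall U, A U ->
            same_law (law (X U)) (convolution_power mu (fine (m U)))) /\
        forall mu : probability R R, infinitely_divisible mu ->
          (forall U, A U ->
             same_law (law (X U)) (convolution_power mu (fine (m U)))) ->
          forall (n : nat) (C : 'I_n -> set T) (B : 'I_n -> set R),
            (0 < n)%N -> (forall i, class_C A (C i)) ->
            (forall i, measurable (B i)) ->
            P (\bigcap_i (increment A X (C i) @^-1` B i)) =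
            increment_fdd m mu C B].
Proof.
have [B [An [g HA]]] := A_indexing.
have A0 : A set0 := ic_set0 HA.
have AI U V : A U -> A V -> A (U `&` V) := @A_setI _ _ _ _ _ _ _ HA U V.
have to_ll (dO : measure_display) (Omega : measurableType dO) (P : probability Omega R)
    (X : set T -> {RV P >-> R}) (LX : levy_process A m X) :=
  levy_is_levy_like T_borel m_radon HA m_empty_prime m_continuous LX.
have of_ll q (sq : convolution_semigroup q) (dO : measure_display) (Omega : measurableType dO)
    (P : probability Omega R) (X : set T -> {RV P >-> R}) (LX : levy_like m A q X) :=
  levy_like_levy T_borel m_radon HA m_empty_prime m_continuous sq LX.
have lawA q (dO : measure_display) (Omega : measurableType dO)
    (P : probability Omega R) (X : set T -> {RV P >-> R}) : levy_like m A q X ->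
    forall U, A U -> same_law (law (X U)) (q (mr m U)).
  move=> LX U AU D mD; rewrite -(ll_law LX (class_C_A AU) mD).
  by congr (P _); apply/seteqP; split=> w /=; rewrite (increment_A (ll_definite LX)).
split.
- move=> dO Omega P X levyX U0 AU0 mU0 mu.
  have [q sq LX] := to_ll _ _ _ _ levyX.
  have a0 : 0 < mr m U0.
    by rewrite -lte_fin -(mrE T_borel m_radon HA (class_C_A AU0)).
  (* The semigroup [q] with time multiplied by m U0 has at time 1 the law of X at U0; its value at 1
     / m U0 is [q 1]. *)
  have mu_q1 : same_law (q 1) mu.
    have h := convolution_powerE (semigroup_scale a0 sq) (mu := law (X U0)).
    move=> D mD; rewrite /mu (h _ _ _ D mD); first by rewrite divff ?gt_eqF.
      by rewrite mulr1 => F mF; rewrite (lawA _ _ _ _ _ LX U0 AU0 F mF).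
    by rewrite invr_ge0 ltW.
  have lawX U : A U -> same_law (law (X U)) (convolution_power mu (fine (m U))).
    move=> AU D mD; rewrite (convolution_powerE sq mu_q1 _ mD) ?mr_ge0//.
    exact: (lawA _ _ _ _ _ LX).
  split=> //.
  + apply: infinitely_divisible_same_law (lawA _ _ _ _ _ LX U0 AU0) _.
    exact: semigroup_infinitely_divisible (mr_ge0 _ _).
  + apply: (infinitely_divisible_same_law (nu := q 1)); first by move=> D mD; rewrite mu_q1.
    exact: semigroup_infinitely_divisible.
  move=> dO' Omega' P' Y levyY XY.
  have [q' sq' LY'] := to_ll _ _ _ _ levyY.
  (* Agreement at the single positive time m U0 forces the two semigroups to coincide, so both
     processes are Lévy-like for the same [q]. *)
  have qq' := semigroup_determined a0 sq sq' _.
  have {}qq' t : 0 <= t -> same_law (q t) (q' t).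
    apply: qq' => D mD; rewrite -(lawA _ _ _ _ _ LX U0 AU0 D mD) (XY D mD).
    exact: (lawA _ _ _ _ _ LY').
  have LY : levy_like m A q Y.
    split; [exact: ll_definite LY'|exact: ll_independent LY'|].
    by move=> C CC D mD; rewrite (ll_law LY' CC mD) (qq' _ _ D mD)// mr_ge0.
  move=> E mE.
  apply: (@joint_law_unique R (set T) A _ Omega P _ Omega' P' (fun U w => X U w) (fun U w => Y U w)) mE.
  + by move=> U; exact: mRV.
  + by move=> U; exact: mRV.
  (* On finitely many members of [A] the values are increments, whose joint law is given by a
     formula involving only [q] and the masses of cells. *)
  move=> s F sA mF; pose C (k : 'I_(size s)) := nth set0 s k.
  have AC k : A (C k) by apply: sA; exact: mem_nth.
  have cap (dW : measure_display) (W : measurableType dW) (Q : probability W R)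
      (Z : set T -> {RV Q >-> R}) : definite_increments A Z ->
      \bigcap_(U in [set` s]) (Z U @^-1` F U) = \bigcap_k (increment A Z (C k) @^-1` F (C k)).
    move=> dZ; apply/seteqP; split=> w h.
      by move=> k _; rewrite /= (increment_A dZ w (AC _)); apply: h; exact: mem_nth.
    move=> U /= Us; have ks : (index U s < size s)%N by rewrite index_mem.
    by have := h (Ordinal ks) Logic.I; rewrite /= (increment_A dZ w (AC _)) /C /= nth_index.
  have ACC k : class_C A (C k) by exact: class_C_A.
  rewrite (cap _ _ _ _ (ll_definite LX)) (cap _ _ _ _ (ll_definite LY)).
  rewrite (levy_like_fdd T_borel m_radon HA sq LX (nu := fun J => q (mr m (cell C J))) ACC (fun k => mF (C k)))//.
  by rewrite (levy_like_fdd T_borel m_radon HA sq LY (nu := fun J => q (mr m (cell C J))) ACC (fun k => mF (C k))).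
- move=> dO Omega P X; split=> [levyX|[defX SX idX stX]].
    have [q sq LX] := to_ll _ _ _ _ levyX; split.
    + exact: ll_definite LX.
    + exact: (levy_like_scattered T_borel m_radon HA sq LX).
    + exact: (levy_like_infinitely_divisible sq LX).
    + exact: (levy_like_stationary LX).
  have [q sq LX] := scattered_is_levy_like T_borel m_radon HA m_empty_prime m_continuous defX SX stX.
  exact: of_ll sq _ _ _ _ LX.
- move=> mu idmu; have sq := convolution_power_semigroup mu.
  have [dO [W [P [X LX]]]] := exists_levy_like T_borel m_radon A_indexing sq.
  exists dO, W, P, X; split; first exact: of_ll sq _ _ _ _ LX.
  exact: lawA LX.
- move=> dO Omega P X levyX; have [q sq LX] := to_ll _ _ _ _ levyX.
  split.
    exists (q 1); split; first exact: semigroup_infinitely_divisible.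
    move=> U AU D mD; rewrite (convolution_powerE sq _ _ mD) ?mr_ge0//.
    exact: (lawA _ _ _ _ _ LX).
  move=> mu idmu lawX n C F _ CC mF.
  have sp := convolution_power_semigroup mu.
  (* The laws on [A] fix those over [class_C], so the formula holds with the powers of the given mu
     in place of [q]. *)
  have LX' : levy_like m A (convolution_power mu) X.
    split; [exact: ll_definite LX|exact: ll_independent LX|].
    exact: (law_class_C T_borel m_radon HA (ll_definite LX) (ll_independent LX) sp lawX).
  rewrite /increment_fdd; apply: (levy_like_fdd T_borel m_radon HA sp LX' CC mF) => J _.
  by rewrite cellE.
Qed.
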